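(* Let $k\ge 1$ and let $\mathbf{j}=(j_1,\dots,j_t)$ be a sequence of integers $j_i\ge 2$ such that $\sum_{i=1}^t j_i=k-1$. Then the coefficient of the monomial $\prod_{i=1}^t R_{j_i}$ in Kerov's polynomial $K_k$ is $$\frac{(k-1)k(k+1)}{24}\;|\mathrm{Perm}(\mathbf{j})|\;\prod_{i=1}^t (j_i-1).$$
   Context: $\mathrm{Perm}(\mathbf{j})$ is the set of sequences equal to $\mathbf{j}$ up to a permutation of its terms; thus $|\mathrm{Perm}(\mathbf{j})|=\frac{t!}{m_2!\cdots m_{k-1}!}$, where $m_l$ is the number of indices $i$ with $j_i=l$. Normalized character: for a Young diagram (partition) $\lambda\vdash n$ with $n\ge k$, $\Sigma_k(\lambda)=\frac{n(n-1)\cdots(n-k+1)\,\chi^\lambda(\sigma)}{\chi^\lambda(\mathrm{Id}_n)}$, where $\chi^\lambda$ is the character of the irreducible representation of the symmetric group $S(n)$ indexed by $\lambda$, and $\sigma=(1\,2\,\ldots\,k)\in S(k)\subset S(n)$ (elements of $S(k)$ fix $k+1,\dots,n$). Free cumulants: $R_i(\lambda)$, $i\ge 2$, are the free cumulants of the transition measure of $\lambda$. Explicitly, the content of the box in row $a$ and column $b$ is $b-a$; let $x_1,\dots,x_m$ be the contents of the boxes that can be added to $\lambda$ and $y_1,\dots,y_{m-1}$ the contents of the boxes that can be removed from $\lambda$ (so that a Young diagram is obtained). The transition measure is the probability measure on $\mathbb{R}$ with Cauchy transform $G_\lambda(z)=\prod_{i=1}^{m-1}(z-y_i)/\prod_{i=1}^{m}(z-x_i)$,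 and the $R_i(\lambda)$ are defined by the expansion of the compositional inverse $G_\lambda^{-1}(z)=\frac1z+\sum_{i\ge 1}R_i(\lambda)z^{i-1}$ (one has $R_1(\lambda)=0$). Kerov's polynomial: $K_k$ is the polynomial with integer coefficients in the variables $R_2,\dots,R_{k+1}$ (known to exist and to be unique) such that $\Sigma_k(\lambda)=K_k(R_2(\lambda),\dots,R_{k+1}(\lambda))$ for every Young diagram $\lambda$ of size at least $k$. *)

(* Defs.v *)
From HB Require Import structures.
From mathcomp Require Import all_boot all_order all_algebra all_fingroup.
From mathcomp Require Import all_solvable all_field all_character.
From mathcomp Require Import mpoly.
From mathcomp Require Import ring zify.

Set Implicit Arguments.
Unset Strict Implicit.
Unset Printing Implicit Defensive.

Import Order.TTheory GRing.Theory Num.Theory.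

Local Open Scope nat_scope.

Record young_diagram := YoungDiagram {
  rows :> seq nat;
  _ : sorted geq rows && (0 \notin rows)
}.

Definition yd_size (la : young_diagram) : nat := sumn la.

Section Contents.

Variable la : young_diagram.

(* Rows are numbered from 0; row [size la] is the first empty one. *)
Definition addable_rows : seq nat :=
  [seq a <- iota 0 (size la).+1 | sorted geq (incr_nth la a)].

Definition removable_rows : seq nat :=
  [seq a <- iota 0 (size la) | sorted geq (set_nth 0 la a (nth 0 la a).-1)].

Definition addable_contents : seq int :=
  [seq ((nth 0 la a)%:Z - a%:Z)%R | a <- addable_rows].

Definition removable_contents : seq int :=
  [seq ((nth 0 la a).-1%:Z - a%:Z)%R | a <- removable_rows].

Lemma size_addable_contents :
  size addable_contents = (size removable_contents).+1.
Proof.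
rewrite !size_map /addable_rows /removable_rows !size_filter.
have : sorted geq la && (0 \notin rows la) by case: la.
move: (rows la) => s /andP[/(sortedP 0) sor s0].
have gt0 i : i < size s -> 0 < nth 0 s i.
  by move=> li; rewrite lt0n; apply: contraNneq s0 => <-; apply: mem_nth.
have nxt i : nth 0 s i.+1 <= nth 0 s i.
  by have [/sor//|le] := ltnP i.+1 (size s); rewrite (nth_default _ le).
have szi a : a <= size s -> size (incr_nth s a) = maxn a.+1 (size s).
  by rewrite size_incr_nth; case: ltngtP => // *; lia.
rewrite -[(size s).+1]add1n iotaD count_cat /= addn0 add0n.
have -> : sorted geq (incr_nth s 0).
  apply/(sortedP 0) => i; rewrite szi // => li.
  rewrite /= !nth_incr_nth /=; have := nxt i.
  by case: i {li} => [|i] /=; lia.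
rewrite (iotaDl 1 0) count_map; congr _.+1.
apply: eq_in_count => a; rewrite mem_iota add0n /= => la_.
have ga := gt0 a la_.
apply/idP/idP => /= /(sortedP 0) H; apply/(sortedP 0) => i.
  rewrite size_set_nth => li; rewrite /= !nth_set_nth /=.
  have := nxt i.
  case: (i =P a) => [-> _|ia]; last by case: eqP => [<-|_] //; lia.
  rewrite eqn_leq ltnn /=.
  have [lt|ge] := ltnP a.+1 (size s); last by rewrite (nth_default _ ge).
  have := H a; rewrite /= !nth_incr_nth szi //.
  have -> : a.+1 < maxn a.+2 (size s) by lia.
  by move=> /(_ isT); rewrite add1n eqxx eqn_leq ltnn /=; lia.
rewrite szi ?add1n // => li; rewrite /= !nth_incr_nth.
have := nxt i.
case: (a.+1 =P i.+1) => [[<-]|] /=; last by lia.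
rewrite eqn_leq ltnn /= => _.
have [lt|ge] := ltnP a.+1 (size s); last by rewrite (nth_default _ ge).
have := H a; rewrite size_set_nth /= !nth_set_nth /= eqxx.
have -> : (a.+1 == a) = false by lia.
have -> : a.+1 < maxn a.+1 (size s) by lia.
by move=> /(_ isT); lia.
Qed.

End Contents.

Local Open Scope ring_scope.

Definition cauchy_transform (F : fieldType) (la : young_diagram) (z : F) : F :=
  (\prod_(y <- removable_contents la) (z - y%:~R)) /
  (\prod_(x <- addable_contents la) (z - x%:~R)).

Notation ratfun := {fraction {poly rat}}.

Definition ratfun_var : ratfun := tofrac 'X.

(* The rational function [f] is O(z ^ n) at z = 0. *)
Definition vanishes_to_order (n : nat) (f : ratfun) : Prop :=
  exists p q : {poly rat}, q.[0] != 0 /\ f = tofrac ('X^n * p) / tofrac q.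

(* 1/z + \sum_(1 <= i <= N) R_i z^(i-1) *)
Definition truncated_inverse (R : nat -> rat) (N : nat) : ratfun :=
  ratfun_var^-1 + tofrac (\poly_(i < N) R i.+1).

(* The formal identity G(1/z + \sum_(i >= 1) R_i z^(i-1)) = z. Since         *)
(* G'(u) ~ - 1/u^2 as u tends to infinity, cutting the series after R_N       *)
(* perturbs the left-hand side by O(z^(N+2)), while modifying R_N alone       *)
(* perturbs it by a term of order exactly N+1. R 0 is irrelevant.             *)
Definition is_free_cumulants (la : young_diagram) (R : nat -> rat) : Prop :=
  forall N : nat,
    vanishes_to_order N.+2
      (cauchy_transform la (truncated_inverse R N) - ratfun_var).

Section FreeCumulants.

Variable la : young_diagram.

Let lin (C : {poly rat}) (s : seq int) : {poly rat} :=
  \prod_(x <- s) (C - x%:~R%:P * 'X).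

Let defect (C : {poly rat}) : {poly rat} :=
  lin C (removable_contents la) - lin C (addable_contents la).

Let ser (R : nat -> rat) (N : nat) : {poly rat} :=
  1 + 'X * \poly_(i < N) R i.+1.

Let serS R N : ser R N.+1 = ser R N + (R N.+1)%:P * 'X^(N.+1).
Proof.
rewrite /ser !poly_def big_ord_recr /= mulrDr addrA -mul_polyC exprS.
by rewrite mulrCA.
Qed.

Let ser0 R N : (ser R N).[0] = 1.
Proof. by rewrite /ser hornerD hornerM hornerX mul0r addr0 hornerC. Qed.

Let lin0 (C : {poly rat}) s : C.[0] = 1 -> (lin C s).[0] = 1.
Proof.
move=> C0; rewrite horner_prod big1 // => x _.
by rewrite hornerD hornerN hornerM hornerX mulr0 subr0.
Qed.

Let split0 (p : {poly rat}) : p.[0] = 1 -> exists q, p = 1 + 'X * q.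
Proof.
move=> p0; have /factor_theorem [q qE] : root (p - 1) 0.
  by rewrite /root !hornerE p0 subrr.
by exists q; rewrite mulrC -['X]subr0 -polyC0 -qE addrC subrK.
Qed.

Let lin_pert (C : {poly rat}) s c n : C.[0] = 1 ->
  exists t, lin (C + c%:P * 'X^(n.+1)) s =
            lin C s + ((size s)%:R * c)%:P * 'X^(n.+1) + 'X^(n.+2) * t.
Proof.
move=> C0; elim: s => [|x s [t IH]]; rewrite /lin.
  by exists 0; rewrite !big_nil !mul0r mulr0 !addr0.
rewrite !big_cons -/(lin _ s) -/(lin _ s) IH.
have [d dE] := split0 C0; have [e eE] := split0 (lin0 s C0).
set A := lin C s in eE *; rewrite eE dE /= mulrS.
rewrite !polyCM polyCD polyC1 !exprS; set m := (size s)%:R%:P; set X := 'X; set Y := X ^+ n.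
exists ((d - x%:~R%:P) * m * c%:P + t + X * d * t - x%:~R%:P * X * t
  + c%:P * e + c%:P * m * c%:P * Y + c%:P * X * Y * t).
ring.
Qed.

Let defect_pert (C : {poly rat}) c n : C.[0] = 1 ->
  exists t, defect (C + c%:P * 'X^(n.+1)) =
            defect C - c%:P * 'X^(n.+1) + 'X^(n.+2) * t.
Proof.
move=> C0; rewrite /defect.
have [t ->] := lin_pert (removable_contents la) c n C0.
have [u ->] := lin_pert (addable_contents la) c n C0.
exists (t - u); rewrite size_addable_contents mulrS !polyCM polyCD polyC1.
ring.
Qed.

Let var_neq0 : ratfun_var != 0.
Proof. by rewrite tofrac_eq0 polyX_eq0. Qed.

Let prodE R N s : \prod_(x <- s) (truncated_inverse R N - x%:~R) =
  tofrac (lin (ser R N) s) / ratfun_var ^+ size s.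
Proof.
elim: s => [|x s IH]; first by rewrite /lin !big_nil tofrac1 invr1 mulr1.
rewrite /lin !big_cons IH -/(lin _ s) tofracM exprS invfM mulrACA.
congr (_ * _); apply: (mulIf var_neq0); rewrite mulfVK // mulrBl.
rewrite /truncated_inverse mulrDl mulVf // /ser.
rewrite tofracB tofracD tofrac1 !tofracM [_ * tofrac 'X]mulrC.
congr (_ + _ * _ - _ * _); rewrite -?rmorph_int //.
by rewrite /= !rmorph_int.
Qed.

Let fracE (F : fieldType) (p q w u : F) : q != 0 -> w != 0 -> u != 0 ->
  p / u / (q / (w * u)) - w = w * (p - q) / q.
Proof. by move=> q0 w0 u0; field; rewrite q0 w0 u0. Qed.

Let transformE R N : cauchy_transform la (truncated_inverse R N) - ratfun_var =
  tofrac ('X * defect (ser R N)) / tofrac (lin (ser R N) (addable_contents la)).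
Proof.
rewrite /cauchy_transform !prodE size_addable_contents.
set P := lin _ _; set Q := lin _ _.
have Q0 : tofrac Q != 0.
  rewrite tofrac_eq0; apply: contra_eq_neq (lin0 (addable_contents la) (ser0 R N)).
  by rewrite -/Q => ->; rewrite horner0 eq_sym oner_eq0.
have W0 := expf_neq0 (size (removable_contents la)) var_neq0.
rewrite exprS /defect -/P -/Q tofracM tofracB -/ratfun_var.
move: Q0 W0 var_neq0; set u := ratfun_var ^+ _; set w := ratfun_var.
move: (tofrac P) (tofrac Q) u w => p q u w q0 u0 w0.
exact: (@fracE ratfun p q w u q0 w0 u0).
Qed.

Let cross_mul (F : fieldType) (a b c d : F) : b != 0 -> d != 0 ->
  a / b = c / d -> a * d = c * b.
Proof. by move=> b0 d0 /eqP; rewrite eqr_div // => /eqP. Qed.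

Let defectP R : is_free_cumulants la R <->
  forall N, exists t, defect (ser R N) = 'X^(N.+1) * t.
Proof.
split=> H N; have := H N; rewrite transformE; last first.
  case=> t ->; exists t, (lin (ser R N) (addable_contents la)).
  by rewrite lin0 // oner_neq0 mulrA -exprS.
case=> p [q [q0]]; set Q := lin _ _ => E.
have Q1 : Q.[0] = 1 by apply: lin0; apply: ser0.
have nz (u : {poly rat}) : u.[0] != 0 -> tofrac u != 0.
  by move=> u0; rewrite tofrac_eq0; apply: contraNneq u0 => ->; rewrite horner0.
have Q0 : tofrac Q != 0 by apply: nz; rewrite Q1 oner_eq0.
have {}E : 'X * defect (ser R N) * q = 'X^(N.+2) * p * Q.
  apply/eqP; rewrite -tofrac_eq [X in X == _]tofracM [X in _ == X]tofracM.
  apply/eqP; move: Q0 (nz q q0) E.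
  move: (tofrac Q) (tofrac q) (tofrac ('X * _)) (tofrac ('X^_ * _)).
  move=> b d a c b0 d0; exact: (@cross_mul ratfun a b c d b0 d0).
have : 'X^(N.+1) %| defect (ser R N).
  rewrite -(@Gauss_dvdpl _ _ q); last first.
    by apply: coprimep_expl; rewrite coprimep_sym coprimepX.
  apply/dvdpP; exists (p * Q).
  have X0 : 'X != 0 :> {poly rat} by rewrite polyX_eq0.
  by apply: (mulfI X0); rewrite mulrA E !exprS; ring.
by case/dvdpP => t ->; exists t; rewrite mulrC.
Qed.

Lemma free_cumulants_exist : {R : nat -> rat | is_free_cumulants la R}.
Proof.
pose step n C := C + ((defect C)`_n.+1)%:P * 'X^(n.+1).
pose fix C n : {poly rat} := if n is m.+1 then step m (C m) else 1.
pose R n := (defect (C n.-1))`_n.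
exists R; apply/defectP.
have CE n : ser R n = C n.
  elim: n => [|n IH]; last by rewrite serS IH.
  by rewrite /ser poly_def big_ord0 mulr0 addr0.
elim=> [|N [t tE]].
  have /factor_theorem [q ->] : root (defect (ser R 0)) 0.
    by rewrite /root /defect !hornerE !lin0 ?ser0 // subrr.
  by exists q; rewrite polyC0 subr0 mulrC.
rewrite serS; have [u ->] := defect_pert (R N.+1) N (ser0 R N).
have RE : R N.+1 = t.[0].
  by rewrite /R /= -CE tE coefXnM ltnn subnn horner_coef0.
have /factor_theorem [v vE] : root (t - t.[0]%:P) 0.
  by rewrite /root !hornerE subrr.
exists (v + u); rewrite RE tE -(subrK t.[0]%:P t) vE !hornerE polyC0 subr0.
by rewrite !exprS; ring.
Qed.

Lemma free_cumulants_unique (R R' : nat -> rat) :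
  is_free_cumulants la R -> is_free_cumulants la R' ->
  forall i, (0 < i)%N -> R i = R' i.
Proof.
move=> /defectP H /defectP H'.
suff E n : ser R n = ser R' n.
  case=> // i _; have := E i.+1; rewrite !serS (E i) => /addrI.
  move=> /(congr1 (fun p : {poly rat} => p`_i.+1)).
  by rewrite !coefMXn ltnn subnn !coefC.
elim: n => [|n IH]; first by rewrite /ser !poly_def !big_ord0.
have [t] := H n.+1; have [t'] := H' n.+1; rewrite !serS IH.
have [u ->] := defect_pert (R n.+1) n (ser0 R' n).
have [u' ->] := defect_pert (R' n.+1) n (ser0 R' n).
move=> /(congr1 (fun p : {poly rat} => p`_n.+1)).
rewrite !coefD !coefN !coefMXn !coefXnM ltnn subnn !ltnSn !coefC !addr0 /=.
move=> e' /(congr1 (fun p : {poly rat} => p`_n.+1)).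
rewrite !coefD !coefN !coefMXn !coefXnM ltnn subnn !ltnSn !coefC !addr0 /=.
by move=> /esym/(etrans e')/addrI/oppr_inj ->.
Qed.

End FreeCumulants.

Definition free_cumulant (la : young_diagram) : nat -> rat :=
  sval (free_cumulants_exist la).

Section Character.

Variable la : young_diagram.

(* The boxes are labelled by 'I_(yd_size la), row after row, so that          *)
(* [reshape_index] and [reshape_offset] give the row and column of a label.   *)
Definition row_stabilizer : {set 'S_(yd_size la)} :=
  [set p : 'S_(yd_size la) |
     [forall i, reshape_index la (p i) == reshape_index la i]].

Definition column_stabilizer : {set 'S_(yd_size la)} :=
  [set q : 'S_(yd_size la) |
     [forall i, reshape_offset la (q i) == reshape_offset la i]].

(* Coordinates, in the regular module, of the Young symmetrizer               *)
(* \sum_p \sum_q sgn(q) p q.                                                  *)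
Definition young_symmetrizer : 'rV[algC]_#|[set: 'S_(yd_size la)]| :=
  \sum_(p in row_stabilizer) \sum_(q in column_stabilizer)
    (-1) ^+ odd_perm q *: delta_mx 0 (gring_index [set: 'S_(yd_size la)] (p * q)%g).

(* Representations act on row vectors from the right, hence a right ideal of  *)
(* the group algebra rather than a left one.                                  *)
Definition specht_repr :=
  submod_repr (cyclic_mx_module
    (regular_repr algC [set: 'S_(yd_size la)]%G) young_symmetrizer).

Definition young_character : 'CF([set: 'S_(yd_size la)]) := cfRepr specht_repr.

End Character.

(* The cycle (1 2 ... k), with points numbered from 0; the identity when the  *)
(* map below is not a permutation, which only happens if k > n.               *)
Definition long_cycle (n k : nat) : 'S_n :=
  insubd (1%g : 'S_n)
    [ffun i : 'I_n => if (i < k)%N then insubd i (i.+1 %% k)%N else i].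

Lemma long_cycleE (n k : nat) (i : 'I_n) : (k <= n)%N ->
  long_cycle n k i = (if (i < k)%N then i.+1 %% k else i)%N :> nat.
Proof.
move=> kn; pose f (i : 'I_n) : 'I_n :=
  if (i < k)%N then insubd i (i.+1 %% k)%N else i.
have fE (j : 'I_n) : f j = (if (j < k)%N then j.+1 %% k else j)%N :> nat.
  rewrite /f; case: ifP => // jk; rewrite val_insubd.
  by rewrite (leq_trans _ kn) // ltn_pmod //; lia.
have finj : injective f.
  move=> a b /(congr1 val) /=; rewrite !fE => e; apply: val_inj => /=.
  have md (j : 'I_n) : (j < k)%N -> (j.+1 %% k = if j.+1 == k then 0 else j.+1)%N.
    by case: eqP => [-> _|ne jk]; [rewrite modnn | rewrite modn_small; lia].
  move: e; case: ifP => ak; case: ifP => bk; rewrite ?md //;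
    repeat case: eqP; lia.
rewrite /long_cycle -pvalE /= insubdK ?ffunE -/(f i) ?fE //.
by apply/injectiveP => a b; rewrite !ffunE; apply: finj.
Qed.

Definition normalized_character (k : nat) (la : young_diagram) : algC :=
  (yd_size la ^_ k)%:R * young_character la (long_cycle (yd_size la) k)
  / young_character la 1%g.

(* The variable of index i : 'I_k stands for R_(i+2). *)
Definition is_kerov_polynomial (k : nat) (K : {mpoly int[k]}) : Prop :=
  forall la : young_diagram, (k <= yd_size la)%N ->
    normalized_character k la =
    mmap intr (fun i : 'I_k => ratr (free_cumulant la i.+2)) K.

(* The exponent vector of \prod_(j <- js) R_j. *)
Definition cumulant_monomial (k : nat) (js : seq nat) : 'X_{1..k} :=
  [multinom count_mem i.+2 js | i < k].

(* Main.v *)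
(* The character of a Young symmetrizer is proportional to the alternating    *)
(* sum psi of numbers of fixed colourings, by the equality case of the        *)
(* Cauchy-Schwarz inequality; this gives the Frobenius formula,               *)
(* i.e. -k Sigma_k is the coefficient of 1 / z in H(z) H(z - 1) ...           *)
(* H(z - k + 1), with H = 1 / G_lambda. Both that residue and the free        *)
(* cumulants are polynomial in the side lengths of a multirectangular         *)
(* diagram, so the identity holds for arbitrary complex side lengths. These   *)
(* can be chosen so that z^k H(z) is a polynomial and R_2, ..., R_(k+1) take  *)
(* any prescribed values. Replacing R_i by s^i R_i, the terms of weight k - 1 *)
(* are two orders in the shift beyond the leading term of                     *)
(* H(z) ... H(z - k + 1); Lagrange inversion turns them into                  *)
(* (k-1) k (k+1) / 24 times the coefficient of u^(k-1) in                     *)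
(* 1 / (1 - \sum_j (j - 1) R_j u^j), where a monomial occurs once for each    *)
(* rearrangement of its factors.                                              *)
Require Import Defs.
From mathcomp Require Import all_boot all_order all_algebra all_fingroup.
From mathcomp Require Import all_field all_character.
From mathcomp Require Import mpoly.
From mathcomp Require Import ring zify.

Set Implicit Arguments.
Unset Strict Implicit.
Unset Printing Implicit Defensive.

Import Order.TTheory GRing.Theory Num.Theory.

Local Open Scope ring_scope.

(** * Young symmetrizers *)

(** The first half turns the character into a residue. Put $H=1/G_\lambda$. The Young symmetrizer
    character and the Frobenius alternating sum [frob_char] are proportional
    ([young_character_frob]): their norms come from [sum_young_sym_class_sqr] and from
    [sum_frob_char_sqr] with [sum_frob_matrices], their scalar product from [young_sym_frob_char],
    and these three numbers give equality in Cauchy-Schwarz. The explicit sum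
    [normalized_characterE] follows, and [residue_normalized_character] reads it as the coefficient
    of $1/z$ in $H(z)\cdots H(z-k+1)$, which equals $-k\Sigma_k$.

    The second half forgets diagrams. By polynomial continuation ([kerov_defect_eq0]) the identity
    holds for formal side lengths, and [kerov_homogeneous] states it for arbitrary cumulants: with
    $C=1+\sum_jR_ju^j$, so that $C(u)/u$ inverts $G$, write $H(z)=z\,\eta(1/z)$. Rescaling separates
    the weights, and [kerov_subleading] expresses the part of weight $k-1$ by the coefficients of
    $t^{k-1}$ in $\frac12t^2\eta''\eta^{k-1}$ and in $(t\eta'-\eta)^2\eta^{k-2}$. [coef_euler]
    reduces the second to the first, and Lagrange inversion ([coef_second_derivative]) evaluates the
    first by the coefficient of $u^{k-1}$ in $1/D$, where $D=C-uC'=1-\sum_j(j-1)R_ju^j$. The sums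
    over the shifts $i<k$ combine to $(k-1)k(k+1)/24$ by [sum_squares_binomial]. Expanding $1/D$ as
    a geometric series, a monomial occurs once for each word that rearranges its indices, with
    factor $\prod(j_i-1)$ ([kerov_weighted], [kerov_coefficient]). *)

Section ColumnInjective.

Variables (I : finType) (row col : I -> nat).

Hypothesis box_inj : forall x y, row x = row y -> col x = col y -> x = y.

Hypothesis box_up :
  forall x r, (r <= row x)%N -> exists2 y, row y = r & col y = col x.

Variable f : I -> nat.

Hypothesis finj : forall x y, col x = col y -> f x = f y -> x = y.

Let sub_count (r c : nat) (g : I -> nat) :=
  #|[set x | (g x < r)%N && (col x == c)]|.

Let sub_count_row r c x : (r <= row x)%N -> col x = c -> sub_count r c row = r.
Proof.
move=> rx cx; have /fin_all_exists2[b rb cb] :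
  forall i : 'I_r, exists2 y, row y = i & col y = col x.
  by move=> i; apply: box_up; have := ltn_ord i; lia.
have binj : injective b.
  by move=> i j e; apply: val_inj; rewrite /= -(rb i) -(rb j) e.
rewrite /sub_count -[RHS]card_ord -(card_imset predT binj); apply: eq_card => y.
rewrite !inE; apply/andP/imsetP => [[lt /eqP e]|[i _ ->]]; last first.
  by rewrite rb cb cx ltn_ord eqxx.
by exists (Ordinal lt) => //; apply: box_inj; rewrite ?rb ?cb ?e.
Qed.

Let sub_count_full r c : (forall x, col x = c -> (row x < r)%N) ->
  sub_count r c row = #|[set x | col x == c]|.
Proof.
move=> H; apply: eq_card => x; rewrite !inE.
by case: eqP => [/H ->|]; rewrite ?andbF.
Qed.

Let sub_count_le r c : (sub_count r c f <= sub_count r c row)%N.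
Proof.
case: (pickP [pred x | (r <= row x)%N && (col x == c)]) => [x /andP[rx /eqP cx]|H].
  rewrite (sub_count_row rx cx) /sub_count.
  rewrite -[leqRHS](card_ord r).
  pose h (x : I) : option 'I_r := insub (f x).
  have hinj : {in [set x | (f x < r)%N && (col x == c)] &, injective h}.
    move=> y z; rewrite !inE => /andP[ly /eqP ey] /andP[lz /eqP ez].
    by rewrite /h !insubT => -[/finj]; apply; rewrite ey ez.
  rewrite -(card_in_imset hinj).
  have /subset_leq_card : h @: [set x | (f x < r)%N && (col x == c)] \subset
    [set Some i | i in 'I_r].
    apply/subsetP => _ /imsetP[y + ->]; rewrite inE => /andP[ly _].
    by rewrite /h insubT imset_f.
  move=> /leq_trans; apply; apply: leq_imset_card.
rewrite sub_count_full => [|x cx].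
  apply: subset_leq_card; apply/subsetP => x.
  by rewrite !inE => /andP[].
by rewrite ltnNge; apply/negP => rx; have := H x; rewrite /= rx cx eqxx.
Qed.

Let card_sub (g : I -> nat) r :
  #|[set x | (g x < r)%N]| =
  (\sum_(c < (\max_x col x).+1) sub_count r c g)%N.
Proof.
rewrite -sum1_card (partition_big (fun x => inord (col x) : 'I_(\max_x col x).+1) predT) //=.
apply: eq_bigr => c _; rewrite /sub_count -sum1_card; apply: eq_bigl => x.
rewrite !inE -val_eqE /= inordK // ltnS.
exact: (@leq_bigmax _ col x).
Qed.

(** Column by column: [f] takes at most [r] values below [r], while by [box_up] a column either has
    [r] boxes in the first [r] rows or lies entirely in them. This is the dominance inequality for
    fillings with distinct entries in each column. *)
Lemma column_injective_card r :
  (#|[set x | (f x < r)%N]| <= #|[set x | (row x < r)%N]|)%N.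
Proof. by rewrite !card_sub; apply: leq_sum => c _; apply: sub_count_le. Qed.

(** When the content is that of the shape, the dominance inequalities are equalities in every column
    separately. Hence the column of [x] has a box in row [f x], and [q] sends [x] there. *)
Lemma column_injective_perm :
  (forall r, #|[set x | f x == r]| = #|[set x | row x == r]|) ->
  exists q : {perm I}, (forall x, col (q x) = col x) /\ forall x, f x = row (q x).
Proof.
move=> cnt.
have cntS (g : I -> nat) r : #|[set x | (g x < r.+1)%N]| =
    (#|[set x | (g x < r)%N]| + #|[set x | g x == r]|)%N.
  rewrite -cardsUI [X in (_ + #|pred_of_set X|)%N](_ : _ = set0); last first.
    by apply/setP => x; rewrite !inE; case: ltngtP.
  rewrite cards0 addn0; apply: eq_card => x; rewrite !inE; lia.
have cntlt r : #|[set x | (f x < r)%N]| = #|[set x | (row x < r)%N]|.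
  elim: r => [|r IH]; last by rewrite !cntS IH cnt.
  by apply: eq_card => x; rewrite !inE.
have eqc r (c : 'I_(\max_x col x).+1) : sub_count r c f = sub_count r c row.
  have := cntlt r; rewrite !card_sub => /eqP.
  have /leqif_sum : forall c : 'I_(\max_x col x).+1, true ->
      (sub_count r c f <= sub_count r c row ?= iff (sub_count r c f == sub_count r c row))%N.
    by move=> i _; split; first exact: sub_count_le.
  by move=> [_ ->] /forallP/(_ c)/eqP.
have box x : exists2 y, row y = f x & col y = col x.
  case: (pickP [pred y | (f x <= row y)%N && (col y == col x)]) => [y /andP[ly /eqP cy]|H].
    by have [z rz cz] := box_up ly; exists z; rewrite ?rz ?cz.
  have cx : (col x < (\max_x col x).+1)%N by rewrite ltnS; apply: leq_bigmax.
  have := eqc (f x) (Ordinal cx); rewrite /= [RHS]sub_count_full; last first.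
    move=> y cy; rewrite ltnNge; apply/negP => ly.
    by have := H y; rewrite /= ly cy eqxx.
  have sub : [set y | (f y < f x)%N && (col y == col x)] \subset
             [set y | col y == col x].
    by apply/subsetP => y; rewrite !inE => /andP[].
  rewrite /sub_count => e.
  have /eqP : [set y | (f y < f x)%N && (col y == col x)] == [set y | col y == col x].
    by rewrite eqEcard sub e leqnn.
  by move=> /setP/(_ x); rewrite !inE eqxx ltnn.
have [q rq cq] := fin_all_exists2 box.
have qinj : injective q.
  by move=> x y e; apply: finj; rewrite -?(rq x) -?(rq y) -?(cq x) -?(cq y) e.
by exists (perm qinj); split=> x; rewrite permE.
Qed.

End ColumnInjective.

Section FiberStabilizer.

Variables (I : finType) (f : I -> nat).

Definition fiber_stab : {set {perm I}} :=
  [set p : {perm I} | [forall i, f (p i) == f i]].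

Lemma fiber_stabP (p : {perm I}) :
  reflect (forall i, f (p i) = f i) (p \in fiber_stab).
Proof. by rewrite inE; apply: (iffP forallP) => H i; apply/eqP; apply: H. Qed.

Lemma group_set_fiber_stab : group_set fiber_stab.
Proof.
apply/group_setP; split=> [|p q /fiber_stabP Hp /fiber_stabP Hq].
  by apply/fiber_stabP => i; rewrite perm1.
by apply/fiber_stabP => i; rewrite permM Hq Hp.
Qed.

Canonical fiber_stab_group := Group group_set_fiber_stab.

Lemma tperm_fiber_stab i j : f i = f j -> tperm i j \in fiber_stab.
Proof. by move=> e; apply/fiber_stabP => x; case: tpermP => // ->. Qed.

End FiberStabilizer.

Section YoungSymmetrizer.

Variables (R : numDomainType) (I : finType) (row col : I -> nat).

Let P := fiber_stab row.
Let Q := fiber_stab col.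

Definition young_sym_coef (s : {perm I}) : R :=
  \sum_(p in P) \sum_(q in Q) (-1) ^+ odd_perm q *+ (p * q == s)%g.

Local Notation e := young_sym_coef.

Hypothesis box_inj : forall x y, row x = row y -> col x = col y -> x = y.

Hypothesis box_up :
  forall x r, (r <= row x)%N -> exists2 y, row y = r & col y = col x.

Let A (g s : {perm I}) : R :=
  \sum_(p in P) \sum_(q in Q) (-1) ^+ odd_perm q *+ (p * g * q == s)%g.

Let A_row (p0 g s : {perm I}) : p0 \in P -> A (p0 * g) s = A g s.
Proof.
move=> Pp0; rewrite {2}/A (reindex_inj (mulIg p0)) /=.
apply: eq_big => [p|p _]; first by rewrite groupMr.
by apply: eq_bigr => q _; rewrite !mulgA.
Qed.

Let A_col (q0 g s : {perm I}) : q0 \in Q ->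
  A (g * q0) s = (-1) ^+ odd_perm q0 * A g s.
Proof.
move=> Qq0; rewrite {2}/A mulr_sumr; apply: eq_bigr => p _.
rewrite mulr_sumr [RHS](reindex_inj (mulgI q0)) /=.
apply: eq_big => [q|q _]; first by rewrite groupMl.
by rewrite odd_permM signr_addb mulrnAr mulrA -signr_addb addbb mul1r !mulgA.
Qed.

Let A1 (g : {perm I}) : A g 1 = e g.
Proof.
rewrite /A (reindex_inj invg_inj) /=; apply: eq_big => [p|p _].
  by rewrite groupV.
rewrite (reindex_inj invg_inj) /=; apply: eq_big => [q|q _]; first by rewrite groupV.
rewrite odd_permV; congr (_ *+ (nat_of_bool _)).
by rewrite -(inj_eq (mulgI p)) -(inj_eq (mulIg q)) mulg1 -!mulgA mulKVg mulVg mulg1 eq_sym.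
Qed.

Lemma young_sym_coef1 : e 1%g = 1.
Proof.
rewrite /e (bigD1 1%g) ?group1 //= (bigD1 1%g) ?group1 //=.
rewrite mulg1 eqxx odd_perm1 mulr1n !big1 ?addr0 // => [p /andP[Pp p1]|q /andP[Qq q1]].
  apply: big1 => q Qq; case: eqP => //= pq; case/negP: p1; apply/eqP/permP => i.
  rewrite perm1; apply: box_inj; first exact/fiber_stabP.
  have -> : p = q^-1%g by apply: (mulIg q); rewrite pq mulVg.
  by apply/(fiber_stabP col (q^-1)); rewrite groupV.
by rewrite mul1g (negPf q1).
Qed.

(** With $a$ the sum over [P] and $b$ the signed sum over [Q], this reads $agb=e(g)\,ab$ in the
    group algebra. If [g] sends two boxes of a row into one column, a transposition shows that both
    sides vanish; otherwise [column_injective_perm] factors [g] into an element of [P] and one of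
    [Q]. *)
Lemma young_sym_sandwich (g s : {perm I}) :
  \sum_(p in P) \sum_(q in Q) (-1) ^+ odd_perm q *+ (p * g * q == s)%g = e g * e s.
Proof.
rewrite -/(A g s).
case: (pickP [pred ij : I * I | [&& ij.1 != ij.2, row ij.1 == row ij.2 &
    col (g ij.1) == col (g ij.2)]]) => [[i j] /and3P[/= ij /eqP rij /eqP cij]|H].
  have A0 t : A g t = 0.
    apply/eqP; have := A_row g t (tperm_fiber_stab rij).
    have -> : (tperm i j * g = g * tperm (g i) (g j))%g by rewrite -tpermJ -conjgC.
    rewrite A_col ?tperm_fiber_stab // odd_tperm (inj_eq perm_inj) ij expr1 mulN1r.
    by move/eqP; rewrite eq_sym -addr_eq0 -mulr2n mulrn_eq0.
  by rewrite A0 -A1 A0 mul0r.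
have cinj x y : col x = col y -> row (g^-1 x)%g = row (g^-1 y)%g -> x = y.
  move=> cxy rxy; apply/eqP; apply: contraT => nxy.
  have := H (g^-1 x, g^-1 y)%g; rewrite /= !permKV cxy rxy !eqxx !andbT.
  by rewrite (inj_eq perm_inj) nxy.
have [|q [Hq rq]] := column_injective_perm box_inj box_up cinj.
  move=> r; rewrite -[RHS](card_imset _ (@perm_inj _ g)); apply: eq_card => x.
  rewrite !inE; apply/idP/imsetP => [rx|[y + ->]]; last by rewrite inE permK.
  by exists (g^-1 x)%g; rewrite ?inE ?permKV.
have Qq : q \in Q by apply/fiber_stabP.
have Pgq : (g * q)%g \in P.
  by apply/fiber_stabP => i; rewrite permM -rq permK.
have gE : g = (g * q * (1 * q^-1))%g by rewrite mul1g mulgK.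
have AE t : A g t = (-1) ^+ odd_perm q * A 1 t.
  by rewrite gE A_row // A_col ?groupV // odd_permV.
have A1E t : A 1 t = e t by apply: eq_bigr => p _; apply: eq_bigr => q' _; rewrite mulg1.
by rewrite -A1 !AE !A1E young_sym_coef1 mulr1.
Qed.

(** The scalar $c$ in $abab=c\,ab$: in the middle factor $ba$, sandwiched between $a$ and $b$, each
    term $qp$ contributes $\mathrm{sgn}(q)e(qp)$. *)
Definition young_sym_eigen : R :=
  \sum_(q in Q) \sum_(p in P) (-1) ^+ odd_perm q * e (q * p)%g.

Lemma young_sym_idem (s : {perm I}) :
  \sum_(y : {perm I}) e y * e (y^-1 * s)%g = young_sym_eigen * e s.
Proof.
pose T p q p' q' : R := (-1) ^+ odd_perm q * ((-1) ^+ odd_perm q' *+ (p * (q * p') * q' == s)%g).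
transitivity (\sum_(p in P) \sum_(q in Q) \sum_(p' in P) \sum_(q' in Q) T p q p' q').
  under eq_bigr => y _ do rewrite {1}/e mulr_suml.
  rewrite exchange_big /=; apply: eq_bigr => p _.
  under eq_bigr => y _ do rewrite mulr_suml.
  rewrite exchange_big /=; apply: eq_bigr => q _.
  rewrite (bigD1 (p * q)%g) //= eqxx mulr1n big1 ?addr0 => [|y yn]; last first.
    by rewrite eq_sym (negPf yn) mul0r.
  rewrite mulr_sumr; apply: eq_bigr => p' _; rewrite mulr_sumr; apply: eq_bigr => q' _.
  rewrite /T; congr (_ * (_ *+ (nat_of_bool _))).
  by rewrite -(inj_eq (mulgI (p * q)%g)) mulKVg !mulgA.
rewrite /young_sym_eigen mulr_suml exchange_big /=; apply: eq_bigr => q _.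
rewrite exchange_big mulr_suml /=; apply: eq_bigr => p' _.
rewrite -mulrA -young_sym_sandwich mulr_sumr; apply: eq_bigr => p _.
by rewrite mulr_sumr.
Qed.

End YoungSymmetrizer.

(** * Traces on right ideals generated by quasi-idempotents *)

Section QuasiIdempotent.

Variables (F : fieldType) (n : nat).

(** In the rank factorization of [L] into [col_base] and [row_base], the product in the other order
    has the same trace, and $L^2=0$ makes that product zero. *)
Lemma mxtrace_nilpotent (L : 'M[F]_n) : L *m L = 0 -> \tr L = 0.
Proof.
rewrite -{1 2 3}(mulmx_base L) => LL.
suff BA : row_base L *m col_base L = 0 by rewrite mxtrace_mulC BA mxtrace0.
apply: (row_free_inj (row_base_free L)); apply: (row_full_inj (col_base_full L)).
by rewrite mul0mx mulmx0 -LL !mulmxA.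
Qed.

(** [L] maps everything into its row space [U] and acts there as the scalar [c], so only the action
    of [A] on [U] contributes to the trace. *)
Lemma mxtrace_submod_quasi_idem (U L A : 'M[F]_n) (c : F) :
  L *m L = c *: L -> (L <= U)%MS -> (U <= L)%MS -> (U *m A <= U)%MS ->
  \tr (A *m L) = c * \tr (in_submod U (val_submod 1%:M *m A)).
Proof.
move=> LL LU UL UA.
have BA : (val_submod (1%:M : 'M_(\rank U)) *m A <= U)%MS.
  by apply: submx_trans UA; apply/submxMr/val_submodP.
have /submxP[D DE] := submx_trans BA UL.
have gen r (B : 'M_(r, n)) (J : 'M_(n, r)) (C : 'M_(r, n)) :
    L = L *m J *m B -> B *m A = C *m L -> \tr (A *m L) = c * \tr (B *m A *m J).
  move=> LE BAE; rewrite [in LHS]LE !mulmxA mxtrace_mulC !mulmxA BAE -(mulmxA C L L) LL.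
  by rewrite -scalemxAr -scalemxAl mxtraceZ.
rewrite [in RHS]in_submodE; apply: gen DE.
by rewrite -in_submodE -val_submodE in_submodK.
Qed.

End QuasiIdempotent.

Section GroupAlgebra.

Variables (F : fieldType) (gT : finGroupType).

Local Notation G := [set: gT]%G.

Variables (u : gT -> F) (c : F).

Hypothesis uu : forall s, \sum_y u y * u (y^-1 * s)%g = c * u s.

Let v : 'rV[F]_#|G| := \row_j u (enum_val j).

(** Left multiplication by $\sum_x u(x)x$. Its row space is the cyclic module generated by [v]. *)
Let L : 'M[F]_#|G| := \matrix_(i, j) u (enum_val j * (enum_val i)^-1)%g.

Let indexK : cancel (gring_index G) enum_val.
Proof. by move=> x; rewrite gring_indexK // inE. Qed.

Let big_enum_val (f : gT -> F) : \sum_(i < #|G|) f (enum_val i) = \sum_x f x.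
Proof.
rewrite [RHS](reindex (enum_val : 'I_#|G| -> gT)) //=.
by apply: onW_bij; exists (gring_index G); [apply: gring_valK | apply: indexK].
Qed.

Let mul_regular (w : gT -> F) x :
  (\row_(j < #|G|) w (enum_val j)) *m regular_mx F G x = \row_j w (enum_val j * x^-1)%g.
Proof.
apply/rowP => j; rewrite !mxE.
under eq_bigr => i _ do rewrite !mxE /= mulr_natr.
rewrite (big_enum_val (fun y => w y *+ (j == gring_index G (y * x)))).
rewrite (bigD1 (enum_val j * x^-1)%g) //= mulgKV gring_valK eqxx mulr1n.
rewrite big1 ?addr0 // => y ny; case: eqP => [e|]; last by rewrite mulr0n.
by case/eqP: ny; rewrite e indexK mulgK.
Qed.

Let row_L i : row i L = v *m regular_mx F G (enum_val i).
Proof. by rewrite mul_regular; apply/rowP => j; rewrite !mxE. Qed.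

Let LL : L *m L = c *: L.
Proof.
apply/matrixP => i j; rewrite !mxE -uu.
under eq_bigr => k _ do rewrite !mxE.
rewrite (big_enum_val (fun y => u (y * (enum_val i)^-1)%g * u (enum_val j * y^-1)%g)).
rewrite (reindex_inj invg_inj) (reindex_inj (mulgI (enum_val j)^-1%g)) /=.
apply: eq_bigr => y _; rewrite mulrC !invMg !invgK; congr (u _ * u _).
  by rewrite mulgA mulgV mul1g.
by rewrite -!mulgA.
Qed.

Let U := cyclic_mx (regular_repr F G) v.

Let LU : (L <= U)%MS.
Proof.
apply/row_subP => i; rewrite row_L.
have UM := cyclic_mx_module (regular_repr F G) v.
by have := mxmodule_trans UM (in_setT (enum_val i)) (cyclic_mx_id _ v).
Qed.

Let UL : (U <= L)%MS.
Proof.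
apply: cyclic_mx_sub.
  apply/mxmoduleP => x _; apply/row_subP => i; rewrite row_mul row_L -mulmxA.
  rewrite -(repr_mxM (regular_repr F G)) ?inE //= -(indexK (_ * x)%g) -row_L.
  exact: row_sub.
by have := row_sub (gring_index G 1%g) L; rewrite row_L indexK (repr_mx1 (regular_repr F G)) mulmx1.
Qed.

Let trL : \tr L = #|G|%:R * u 1%g.
Proof.
rewrite /mxtrace; under eq_bigr => i _ do rewrite mxE mulgV.
by rewrite sumr_const card_ord mulr_natl.
Qed.

(** For $c=0$ left multiplication by $u$ would have square zero and so trace zero, but its trace is
    $|G|u(1)$. *)
Lemma quasi_idem_neq0 : #|G|%:R * u 1%g != 0 -> c != 0.
Proof.
rewrite -trL; apply: contra_neq => c0; apply: mxtrace_nilpotent.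
by rewrite LL c0 scale0r.
Qed.

(** Both sides are the trace of $h\mapsto uhx$ on the group algebra; its diagonal entry at $h$ is
    the coefficient of $h$ in $uhx$. *)
Lemma mxtrace_cyclic_quasi_idem x :
  c * \tr (submod_mx (cyclic_mx_module (regular_repr F G) v) x) =
  \sum_h u (h * x^-1 * h^-1)%g.
Proof.
rewrite -(mxtrace_submod_quasi_idem LL LU UL); last first.
  by have /mxmoduleP := cyclic_mx_module (regular_repr F G) v; apply; rewrite inE.
rewrite -(big_enum_val (fun h => u (h * x^-1 * h^-1)%g)).
apply: eq_bigr => i _; rewrite mxE.
under eq_bigr => k _ do rewrite !mxE /=.
rewrite (bigD1 (gring_index G (enum_val i * x)%g)) //= eqxx mul1r indexK invMg mulgA.
by rewrite big1 ?addr0 // => k /negPf ->; rewrite mul0r.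
Qed.

End GroupAlgebra.

Section YoungCharacter.

Variable la : young_diagram.

Local Notation n := (yd_size la).

Definition box_row (i : 'I_n) : nat := reshape_index la i.

Definition box_col (i : 'I_n) : nat := reshape_offset la i.

Lemma box_rowcol_inj (x y : 'I_n) : box_row x = box_row y -> box_col x = box_col y -> x = y.
Proof.
rewrite /box_row /box_col => r c; apply: val_inj => /=.
by rewrite -(reshape_indexK la x) -(reshape_indexK la y) r c.
Qed.

Lemma yd_sorted i j : (i <= j)%N -> (nth 0%N la j <= nth 0%N la i)%N.
Proof.
have /andP[sl _] : sorted geq la && (0 \notin rows la)%N by case: la.
move=> ij; have [js|js] := ltnP j (size la); last by rewrite nth_default.
have tr : transitive geq by move=> a b d; rewrite /=; lia.
by apply: (sorted_leq_nth tr leqnn 0%N sl) => //; rewrite inE; apply: leq_ltn_trans js.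
Qed.

Lemma yd_gt0 i : (i < size la)%N -> (0 < nth 0%N la i)%N.
Proof.
move=> li; rewrite lt0n.
have /andP[_] : sorted geq la && (0 \notin rows la)%N by case: la.
by apply: contraNneq => <-; apply: mem_nth.
Qed.

Lemma box_rowcol_exists r c : (c < nth 0%N la r)%N ->
  exists2 i, box_row i = r & box_col i = c.
Proof.
move=> lt; exists (Ordinal (flatten_indexP lt)); rewrite /box_row /box_col /=.
  by rewrite flatten_indexKl.
by rewrite flatten_indexKr.
Qed.

Lemma box_rowP (i : 'I_n) : (box_row i < size la)%N.
Proof. exact/reshape_indexP/ltn_ord. Qed.

Lemma box_colP (i : 'I_n) : (box_col i < nth 0%N la (box_row i))%N.
Proof. exact/reshape_offsetP/ltn_ord. Qed.

Lemma box_row_up (x : 'I_n) r : (r <= box_row x)%N ->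
  exists2 y, box_row y = r & box_col y = box_col x.
Proof.
by move=> /yd_sorted rx; apply: box_rowcol_exists; apply: leq_trans rx; apply: box_colP.
Qed.

Lemma card_box_row r : #|[set x | box_row x == r]| = nth 0%N la r.
Proof.
pose b (c : 'I_(nth 0%N la r)) : 'I_n := Ordinal (flatten_indexP (ltn_ord c)).
have bc c : box_col (b c) = c by rewrite /box_col flatten_indexKr.
have br c : box_row (b c) = r by rewrite /box_row flatten_indexKl.
have binj : injective b by move=> c d e; apply: val_inj; rewrite /= -(bc c) e bc.
rewrite -[RHS]card_ord -(card_imset _ binj); apply: eq_card => x.
rewrite inE; apply/eqP/imsetP => [rx|[c _ ->]]; last exact: br.
have lc : (box_col x < nth 0%N la r)%N by rewrite -rx; apply: box_colP.
by exists (Ordinal lc) => //; apply: box_rowcol_inj; rewrite ?bc ?br.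
Qed.

Local Notation e := (young_sym_coef algC box_row box_col).

Definition young_eigen := young_sym_eigen algC box_row box_col.

Lemma young_sym_conv s : \sum_y e y * e (y^-1 * s)%g = young_eigen * e s.
Proof. exact: (young_sym_idem algC box_rowcol_inj box_row_up). Qed.

Lemma young_eigen_neq0 : young_eigen != 0.
Proof.
apply: (quasi_idem_neq0 young_sym_conv).
rewrite (young_sym_coef1 algC box_rowcol_inj) mulr1 pnatr_eq0 -lt0n.
by apply/card_gt0P; exists 1%g; rewrite inE.
Qed.

Lemma young_characterE g :
  young_character la g = (\sum_h e (h * g^-1 * h^-1)%g) / young_eigen.
Proof.
rewrite -(mxtrace_cyclic_quasi_idem young_sym_conv) mulrC mulKf ?young_eigen_neq0 //.
rewrite /young_character /specht_repr.
have -> : young_symmetrizer la = \row_j e (enum_val j).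
  apply/rowP => j; rewrite !mxE /young_symmetrizer summxE.
  apply: eq_bigr => p _; rewrite summxE; apply: eq_bigr => q _.
  rewrite !mxE eqxx /= mulr_natr; congr (_ *+ (nat_of_bool _)).
  by rewrite -(inj_eq enum_val_inj) gring_indexK ?inE // eq_sym.
by rewrite cfunE inE mulr1n.
Qed.

End YoungCharacter.

(** * The Frobenius character formula *)

Section Colorings.

Variable T : finType.

Implicit Types N : T -> nat.

Definition color_count n (F : {ffun 'I_n -> T}) (t : T) : nat := #|[set i | F i == t]|.

Definition colorings n N : {set {ffun 'I_n -> T}} :=
  [set F | [forall t, color_count F t == N t]].

Lemma coloringsP n N (F : {ffun 'I_n -> T}) :
  reflect (forall t, color_count F t = N t) (F \in colorings n N).
Proof. by rewrite inE; apply: (iffP forallP) => H i; apply/eqP; apply: H. Qed.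

Lemma color_count_perm n (F : {ffun 'I_n -> T}) (g : 'S_n) t :
  color_count [ffun i => F (g i)] t = color_count F t.
Proof.
rewrite /color_count -[RHS](card_preimset _ (@perm_inj _ g)).
by apply: eq_card => i; rewrite !inE ffunE.
Qed.

Lemma colorings_transitive n N (F F0 : {ffun 'I_n -> T}) :
  F \in colorings n N -> F0 \in colorings n N ->
  exists g : 'S_n, F = [ffun i => F0 (g i)].
Proof.
move=> /coloringsP HF /coloringsP HF0.
have cE (F' : {ffun 'I_n -> T}) t : count_mem t [tuple F' i | i < n] = color_count F' t.
  rewrite count_map /color_count cardE /enum_mem -enumT size_filter.
  by apply: eq_count => i; rewrite !inE.
have /tuple_permP[g gE] : perm_eq [tuple F i | i < n] [tuple F0 i | i < n].
  by apply/allP => t _; rewrite /= !cE HF HF0.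
exists g; apply/ffunP => i; rewrite ffunE.
have := congr1 (fun s => nth (F i) s i) gE.
by rewrite -!tnth_nth !tnth_mktuple.
Qed.

(** Deletes [k] points of one colour: one point in the multinomial count [card_colorings], a whole
    cycle in [frob_char_cycle]. *)
Lemma card_colorings_cons k n N j :
  #|[set F in colorings (k + n) N | [forall i : 'I_k, F (lshift n i) == j]]| =
  #|[set F : {ffun 'I_n -> T} | [forall t, (t == j) * k + color_count F t == N t]]|%N.
Proof.
pose ext (F : {ffun 'I_n -> T}) : {ffun 'I_(k + n) -> T} :=
  [ffun i => if split i is inr i' then F i' else j].
have extl F i : ext F (lshift n i) = j.
  by rewrite ffunE -[lshift n i]/(unsplit (inl i)) unsplitK.
have extr F i : ext F (rshift k i) = F i.
  by rewrite ffunE -[rshift k i]/(unsplit (inr i)) unsplitK.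
have extI : injective ext.
  by move=> F F' e; apply/ffunP => i; rewrite -!extr e.
have cE F t : color_count (ext F) t = ((t == j) * k + color_count F t)%N.
  rewrite /color_count -!sum1dep_card big_split_ord /=; congr (_ + _)%N.
    under eq_bigl => i do rewrite extl eq_sym.
    by case: (t == j); rewrite ?big_pred0_eq // sum1_card card_ord mul1n.
  by apply: eq_bigl => i; rewrite extr.
rewrite -(card_imset _ extI); apply: eq_card => F.
rewrite !inE; apply/andP/imsetP => [[/forallP HN /forallP Hj]|[F' + ->]]; last first.
  rewrite inE => /forallP H; split; apply/forallP => t; last by rewrite extl.
  by rewrite cE.
have FE : F = ext [ffun i => F (rshift k i)].
  apply/ffunP => i; rewrite -(splitK i); case: (split i) => i' /=.
    by rewrite extl; apply/eqP/Hj.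
  by rewrite extr ffunE.
exists [ffun i => F (rshift k i)] => //.
by rewrite inE; apply/forallP => t; rewrite -cE -FE.
Qed.

Lemma card_colorings n N : (\sum_t N t = n)%N ->
  (#|colorings n N| * \prod_t (N t)`! = n`!)%N.
Proof.
elim: n N => [|n IH] N sN.
  have N0 t : N t = 0%N.
    by move/eqP: sN; rewrite sum_nat_eq0 => /forallP/(_ t)/eqP.
  rewrite big1 => [|t _]; last by rewrite N0.
  rewrite muln1 (_ : colorings 0 N = setT) ?cardsT ?card_ffun ?card_ord ?expn0 //.
  apply/setP => F; rewrite inE inE; apply/forallP => t; rewrite N0.
  by rewrite /color_count -leqn0 -[leqRHS](card_ord 0) max_card.
have -> : #|colorings n.+1 N| =
    (\sum_j #|[set F in colorings (1 + n) N | [forall i : 'I_1, F (lshift n i) == j]]|)%N.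
  rewrite -sum1_card (partition_big (fun F : {ffun 'I_n.+1 -> T} => F ord0) predT) //=.
  apply: eq_bigr => j _; rewrite -sum1dep_card; apply: eq_bigl => F.
  congr (_ && _); apply/eqP/forallP => [<- i|/(_ ord0)/eqP <-].
    by rewrite ord1; apply/eqP; congr (F _); apply: val_inj.
  by congr (F _); apply: val_inj.
rewrite big_distrl /= factS -{1}sN big_distrl /=; apply: eq_bigr => j _.
rewrite card_colorings_cons.
have [Nj0|Njgt] := posnP (N j).
  rewrite Nj0 mul0n [X in (#|pred_of_set X| * _)%N](_ : _ = set0) ?cards0 //.
  apply/setP => F; rewrite !inE; apply/negP => /forallP/(_ j).
  by rewrite eqxx Nj0.
pose N' t := (N t - (t == j))%N.
have NE t : N t = ((t == j) + N' t)%N.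
  by rewrite /N'; case: eqP => [->|_] /=; lia.
rewrite -(IH N'); last first.
  apply/eqP; rewrite -(eqn_add2l 1) [in eqbRHS]add1n -sN.
  under [eqbRHS]eq_bigr => t _ do rewrite NE.
  by rewrite big_split /= -big_mkcond /= big_pred1_eq eqxx.
rewrite mulnCA -[X in #|pred_of_set X|](_ : colorings n N' = _).
  congr (_ * _)%N; rewrite (bigD1 j) //= [in RHS](bigD1 j) //= mulnA.
  congr (_ * _)%N; first by rewrite (NE j) eqxx add1n factS.
  by apply: eq_bigr => t /negPf tj; rewrite NE tj.
apply/setP => F; rewrite !inE; apply: eq_forallb => t.
by rewrite NE muln1 eqn_add2l.
Qed.

End Colorings.

Definition fixed_coloring n (T : finType) (g : 'S_n) (F : {ffun 'I_n -> T}) : bool :=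
  [forall i, F (g i) == F i].

(** Burnside's lemma for a single orbit: by [colorings_transitive], permutations act transitively on
    the colourings with given colour counts. *)
Lemma sum_card_fixed_colorings n (T : finType) (N : T -> nat) :
  (\sum_t N t = n)%N ->
  (\sum_(g : 'S_n) #|[set F in colorings n N | fixed_coloring g F]| = n`!)%N.
Proof.
move=> sN.
have /card_gt0P[F0 F0N] : (0 < #|colorings n N|)%N.
  by have := card_colorings sN; case: #|_| => //; rewrite mul0n => /esym/eqP; rewrite -leqn0 leqNgt fact_gt0.
under eq_bigr => g _ do rewrite -sum1dep_card big_mkcondr.
rewrite exchange_big /=.
have HF F : F \in colorings n N ->
    (\sum_(g : 'S_n) (if fixed_coloring g F then 1 else 0) =
     \sum_(g : 'S_n) (if F == [ffun i => F0 (g i)] then 1 else 0))%N.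
  move=> FN; have [h ->] := colorings_transitive FN F0N.
  rewrite [RHS](reindex_inj (mulIg h)); apply: eq_bigr => g _.
  congr (if _ then _ else _); apply/forallP/eqP => [H|/ffunP H i].
    by apply/ffunP => i; have /eqP := H i; rewrite !ffunE permM.
  by have := H i; rewrite !ffunE permM => ->.
rewrite (eq_bigr _ HF) exchange_big /= -[n in RHS]card_ord -cardsT -card_perm.
rewrite -sum1_card; apply: eq_big => [g|g _].
  by apply/esym; rewrite unfold_in; apply/subsetP => i; rewrite !inE.
rewrite (bigD1 [ffun i => F0 (g i)]) /=; last first.
  apply/coloringsP => t; rewrite color_count_perm; exact/coloringsP.
by rewrite eqxx big1 // => F /andP[_ /negPf ->].
Qed.

(** * Frobenius sums and their norm *)

Section FrobeniusCharacter.

Variables (R : comNzRingType) (n m : nat) (l : 'I_m -> nat).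

Definition frob_set (w : 'S_m) (g : 'S_n) : {set {ffun 'I_n -> 'I_m}} :=
  [set F | fixed_coloring g F && [forall r, color_count F r + w r == l r]%N].

(* The coefficient of \prod_r x_r ^ (l r) in the product of the power sums    *)
(* p_c(x), over the cycle lengths c of g, with the alternant                  *)
(* \det (x_r ^ j).                                                            *)
Definition frob_char (g : 'S_n) : R :=
  \sum_(w : 'S_m) (-1) ^+ odd_perm w * #|frob_set w g|%:R.

(** Contingency tables with margins $l-w$ and $l-w'$; the bound on the entries, which the margins
    imply, makes the type finite. *)
Definition frob_matrices (w w' : 'S_m) :
    {set {ffun 'I_m -> {ffun 'I_m -> 'I_(\sum_r l r).+1}}} :=
  [set N : {ffun 'I_m -> {ffun 'I_m -> 'I_(\sum_r l r).+1}} | [forall r, \sum_r' N r r' + w r == l r]%N &&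
           [forall r', \sum_r N r r' + w' r' == l r']%N].

Hypothesis sum_l : (\sum_r l r = n + \sum_(r < m) r)%N.

Let color_count_fst (F : {ffun 'I_n -> 'I_m * 'I_m}) r :
  color_count [ffun i => (F i).1] r = (\sum_r' color_count F (r, r'))%N.
Proof.
rewrite /color_count -sum1_card (partition_big (fun i => (F i).2) predT) //=.
apply: eq_bigr => r' _; rewrite -sum1_card; apply: eq_bigl => i.
by rewrite !inE ffunE -pair_eqE.
Qed.

Let color_count_snd (F : {ffun 'I_n -> 'I_m * 'I_m}) r' :
  color_count [ffun i => (F i).2] r' = (\sum_r color_count F (r, r'))%N.
Proof.
rewrite /color_count -sum1_card (partition_big (fun i => (F i).1) predT) //=.
apply: eq_bigr => r _; rewrite -sum1_card; apply: eq_bigl => i.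
by rewrite !inE ffunE -pair_eqE andbC.
Qed.

Let zip_set (w w' : 'S_m) (g : 'S_n) : {set {ffun 'I_n -> 'I_m * 'I_m}} :=
  [set F | fixed_coloring g F &&
    [forall r, \sum_r' color_count F (r, r') + w r == l r]%N &&
    [forall r', \sum_r color_count F (r, r') + w' r' == l r']%N].

Let card_zip w w' g : (#|frob_set w g| * #|frob_set w' g| = #|zip_set w w' g|)%N.
Proof.
rewrite -cardsX.
pose h (F : {ffun 'I_n -> 'I_m * 'I_m}) := ([ffun i => (F i).1], [ffun i => (F i).2]).
have hI : injective h.
  move=> F F' [/ffunP e1 /ffunP e2]; apply/ffunP => i.
  by have := e1 i; have := e2 i; rewrite !ffunE; case: (F i) (F' i) => ? ? [? ?] /= -> ->.
rewrite -(card_imset _ hI); apply: eq_card => -[F1 F2]; rewrite in_setX.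
have e1 (F : {ffun 'I_n -> 'I_m * 'I_m}) v : [forall r, \sum_r' color_count F (r, r') + v r == l r]%N
    = [forall r, color_count [ffun i => (F i).1] r + v r == l r]%N.
  by apply: eq_forallb => r; rewrite color_count_fst.
have e2 (F : {ffun 'I_n -> 'I_m * 'I_m}) v : [forall r', \sum_r color_count F (r, r') + v r' == l r']%N
    = [forall r, color_count [ffun i => (F i).2] r + v r == l r]%N.
  by apply: eq_forallb => r; rewrite color_count_snd.
apply/idP/imsetP => [|[F + [-> ->]]].
  rewrite !inE => /andP[/andP[/forallP g1 c1] /andP[/forallP g2 c2]].
  have E1 : F1 = [ffun i => ([ffun i => (F1 i, F2 i)] i).1] by apply/ffunP => i; rewrite !ffunE.
  have E2 : F2 = [ffun i => ([ffun i => (F1 i, F2 i)] i).2] by apply/ffunP => i; rewrite !ffunE.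
  exists [ffun i => (F1 i, F2 i)]; last by rewrite /h -E1 -E2.
  rewrite inE e1 e2 -E1 -E2 c1 c2 !andbT; apply/forallP => i.
  by rewrite !ffunE (eqP (g1 i)) (eqP (g2 i)).
rewrite inE e1 e2 => /andP[/andP[/forallP gF c1] c2]; rewrite !inE c1 c2 !andbT.
by apply/andP; split; apply/forallP => i; rewrite !ffunE (eqP (gF i)).
Qed.

Let sum_card_zip w w' :
  (\sum_(g : 'S_n) #|zip_set w w' g| = n`! * #|frob_matrices w w'|)%N.
Proof.
have le_n : (n <= \sum_r l r)%N by rewrite sum_l leq_addr.
pose cnt (F : {ffun 'I_n -> 'I_m * 'I_m}) : {ffun 'I_m -> {ffun 'I_m -> 'I_(\sum_r l r).+1}} :=
  [ffun r => [ffun r' => inord (color_count F (r, r'))]].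
have cntE F r r' : cnt F r r' = color_count F (r, r') :> nat.
  rewrite !ffunE inordK // ltnS (leq_trans _ le_n) //.
  by rewrite -[leqRHS]card_ord; apply: max_card.
rewrite mulnC -sum_nat_const.
transitivity (\sum_(N in frob_matrices w w') \sum_(g : 'S_n)
  #|[set F in colorings n (fun t : 'I_m * 'I_m => N t.1 t.2 : nat) | fixed_coloring g F]|)%N.
  rewrite exchange_big /=; apply: eq_bigr => g _.
  rewrite -sum1_card (partition_big cnt (mem (frob_matrices w w'))) /=.
    apply: eq_bigr => N; rewrite inE => /andP[/forallP N1 /forallP N2].
    rewrite -sum1_card; apply: eq_bigl => F; rewrite !inE.
    apply/andP/andP => [[/andP[/andP[gF _] _] /eqP <-]|[/forallP FN gF]].
      by split=> //; apply/forallP => -[r r']; rewrite cntE.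
    rewrite gF /=; split; last first.
      by apply/eqP/ffunP => r; apply/ffunP => r'; apply: val_inj; rewrite /= cntE; apply/eqP/(FN (r, r')).
    apply/andP; split; apply/forallP => r.
      by rewrite -(eqP (N1 r)) eqn_add2r; apply/eqP/eq_bigr => r' _; apply/eqP/(FN (r, r')).
    by rewrite -(eqP (N2 r)) eqn_add2r; apply/eqP/eq_bigr => r' _; apply/eqP/(FN (r', r)).
  move=> F; rewrite !inE => /andP[/andP[gF F1] F2].
  apply/andP; split; apply/forallP => r; under eq_bigr => r' _ do rewrite cntE.
    by move/forallP: F1; apply.
  by move/forallP: F2; apply.
apply: eq_bigr => N; rewrite inE => /andP[/forallP N1 _].
apply: sum_card_fixed_colorings.
rewrite -(pair_bigA _ (fun r r' => nat_of_ord (N r r'))) /=.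
apply/eqP; rewrite -(eqn_add2r (\sum_(r < m) r)) -sum_l.
have -> : (\sum_(r < m) r = \sum_(r < m) w r)%N by rewrite (reindex_inj (@perm_inj _ w)).
rewrite -big_split /=; apply/eqP/eq_bigr => r _.
exact/eqP/N1.
Qed.

(** A pair of fixed colourings is one fixed colouring by pairs, whose colour counts form a
    contingency table. For each table, Burnside's lemma gives $n!$ after summation over [g]. *)
Lemma sum_frob_char_sqr :
  \sum_(g : 'S_n) frob_char g * frob_char g = (n`!)%:R *
  \sum_(w : 'S_m) \sum_(w' : 'S_m)
    (-1) ^+ odd_perm w * (-1) ^+ odd_perm w' * #|frob_matrices w w'|%:R.
Proof.
under [LHS]eq_bigr => g _ do rewrite mulr_suml.
rewrite [LHS]exchange_big mulr_sumr /=; apply: eq_bigr => w _.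
under [LHS]eq_bigr => g _ do rewrite mulr_sumr.
rewrite [LHS]exchange_big mulr_sumr /=; apply: eq_bigr => w' _.
under [LHS]eq_bigr => g _ do rewrite mulrACA -natrM card_zip.
by rewrite -mulr_sumr -natr_sum sum_card_zip natrM mulrCA.
Qed.

End FrobeniusCharacter.

Section Geometric.

Variables (A : comNzRingType) (N : nat).

Definition geom (y : A) : {poly A} := \poly_(b < N.+1) y ^+ b.

Lemma geomE (y : A) : geom y * (1 - y%:P * 'X) = 1 - (y ^+ N.+1)%:P * 'X^(N.+1).
Proof.
rewrite /geom poly_def; elim: (N.+1) => [|k IH].
  by rewrite big_ord0 mul0r !expr0 mulr1 subrr.
rewrite big_ord_recr /= mulrDl IH -mul_polyC !exprS polyCM; ring.
Qed.

Lemma geom_prodE (I : Type) (r : seq I) (P : pred I) (y : I -> A) :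
  exists q, \prod_(i <- r | P i) geom (y i) * \prod_(i <- r | P i) (1 - (y i)%:P * 'X)
    = 1 + 'X^(N.+1) * q.
Proof.
rewrite -big_split /=; elim/big_rec: _ => [|i p _ [q ->]].
  by exists 0; rewrite mulr0 addr0.
rewrite geomE; set z := (y i ^+ _)%:P.
by exists (q - z - z * 'X^(N.+1) * q); ring.
Qed.

End Geometric.

Lemma coef_add_high (A : nzRingType) (p q : {poly A}) N i :
  (i < N)%N -> (p + 'X^N * q)`_i = p`_i.
Proof. by move=> iN; rewrite coefD coefXnM iN addr0. Qed.

Section JacobiTrudi.

Variables (A : comNzRingType) (m B : nat) (x : 'I_m -> A).

Let H : {poly A} := \prod_j geom B (x j).

Let E (j : 'I_m) : {poly A} := \prod_(i | i != j) (1 - (x i)%:P * 'X).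

Let HE j a : (a <= B)%N -> (E j * H)`_a = x j ^+ a.
Proof.
move=> aB; rewrite /H (bigD1 j) //= mulrCA.
have [q qE] := geom_prodE B (index_enum 'I_m) (fun i => i != j) x.
rewrite mulrC [E j * _]mulrC qE mulrDl mul1r -mulrA coef_add_high ?ltnS //.
by rewrite coef_poly ltnS aB.
Qed.

Let size_E j : (size (E j) <= m)%N.
Proof.
apply: leq_trans (size_prod_leq _ _) _.
rewrite leq_subLR; apply: (@leq_trans (\sum_(i < m | i != j) 2).+1).
  rewrite ltnS; apply: leq_sum => i _.
  apply: leq_trans (size_polyD _ _) _; rewrite geq_max size_poly1 /= size_polyN.
  by apply: leq_trans (size_polyMleq _ _) _; rewrite size_polyX size_polyC; case: (_ != _).
have := cardC1 j; rewrite card_ord sum_nat_const => e.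
have -> : #|(fun i : 'I_m => i != j)| = m.-1.
  by rewrite -e; apply: eq_card => i; rewrite !inE.
by have := ltn_ord j; lia.
Qed.

Definition complete_mx (l : 'I_m -> nat) : 'M[A]_m :=
  \matrix_(i, r) if (r <= l i)%N then H`_(l i - r) else 0.

Let complete_mxE (l : 'I_m -> nat) : (forall i, l i <= B)%N ->
  complete_mx l *m \matrix_(r, j) (E j)`_r = \matrix_(i, j) x j ^+ l i.
Proof.
move=> lB; apply/matrixP => i j; rewrite !mxE -(HE j (lB i)) coefM.
rewrite (big_ord_widen (m + (l i).+1) (fun r => (E j)`_r * H`_(l i - r))) ?leq_addl //.
under eq_bigr => r _ do rewrite !mxE.
rewrite (big_ord_widen (m + (l i).+1) (fun r => (if (r <= l i)%N then H`_(l i - r) else 0) * (E j)`_r)) ?leq_addr //.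
rewrite big_mkcond [RHS]big_mkcond; apply: eq_bigr => r _; rewrite ltnS.
case: ltnP => rm; case: leqP => rl; rewrite ?mul0r //; first by rewrite mulrC.
by rewrite [(E j)`_r]nth_default ?mul0r // (leq_trans (size_E j)).
Qed.

(** Jacobi-Trudi in bialternant form. The identity $\prod_{i\ne
    j}(1-x_it)\prod_i(1-x_it)^{-1}=(1-x_jt)^{-1}$ factors the matrix of powers through
    [complete_mx l]. The other factor has the Vandermonde determinant, because for the exponents
    $0,\dots,m-1$ the matrix [complete_mx] is unitriangular. *)
Lemma det_complete_mx (l : 'I_m -> nat) : (forall i, l i <= B)%N -> (m <= B.+1)%N ->
  \det (complete_mx l) * \det (\matrix_(i, j) x j ^+ i) = \det (\matrix_(i, j) x j ^+ l i).
Proof.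
move=> lB mB; rewrite -(complete_mxE lB) det_mulmx; congr (_ * _).
rewrite -(@complete_mxE val) => [|i]; last by rewrite -ltnS (leq_trans (ltn_ord i)).
rewrite det_mulmx det_trig => [|/=].
  rewrite big1 ?mul1r // => i _; rewrite mxE leqnn subnn -horner_coef0 horner_prod big1 // => j _.
  by rewrite horner_coef0 coef_poly expr0.
by apply/is_trig_mxP => i j ij; rewrite mxE leqNgt ij.
Qed.

End JacobiTrudi.

Section FrobeniusNorm.

Variables (m : nat) (l : 'I_m -> nat).

Local Notation B := (\sum_r l r)%N.

Local Notation A := {mpoly int[m]}.

Let x (j : 'I_m) : A := 'X_j.

Let mon (f : {ffun 'I_m -> 'I_B.+1}) : A := 'X_[[multinom (f j : nat) | j < m]].

Let complete_mx_mon i r : complete_mx B x l i r =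
  \sum_(f : {ffun 'I_m -> 'I_B.+1}) if (\sum_j f j + r == l i)%N then mon f else 0.
Proof.
rewrite mxE.
have -> : \prod_j geom B (x j) =
    \sum_(f : {ffun 'I_m -> 'I_B.+1}) mon f *: 'X^(\sum_j f j).
  under eq_bigr => j _ do rewrite /geom poly_def.
  rewrite bigA_distr_bigA /=; apply: eq_bigr => f _.
  under eq_bigr => j _ do rewrite -mul_polyC.
  rewrite big_split /= -rmorph_prod -mul_polyC /mon mpolyXE_id.
  congr (_%:P * _); first by apply: eq_bigr => j _; rewrite mnmE.
  by rewrite -expr_sum.
rewrite coef_sum; case: leqP => rl.
  apply: eq_bigr => f _; rewrite coefZ coefXn.
  have -> : (l i - r == \sum_j f j)%N = (\sum_j f j + r == l i)%N by apply/eqP/eqP; lia.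
  by case: eqP; rewrite ?mulr1 ?mulr0.
by rewrite big1 // => f _; case: eqP => // e; lia.
Qed.

Let coef_term (w w' : 'S_m) :
  ((\prod_i complete_mx B x l i (w i)) * \prod_j x j ^+ w' j)@_[multinom l j | j < m] =
  #|frob_matrices l w w'|%:R.
Proof.
under eq_bigr => i _ do rewrite complete_mx_mon.
rewrite bigA_distr_bigA /= mulr_suml (raddf_sum (mcoeff _)) /=.
rewrite -sum1_card natr_sum [RHS]big_mkcond /=; apply: eq_bigr => N _; rewrite inE.
case: (boolP [forall r, _]) => [/forallP H1|]; last first.
  rewrite negb_forall => /existsP[r /negPf Nr].
  by rewrite (bigD1 r) //= Nr !mul0r mcoeff0.
under eq_bigr => i _ do rewrite H1 /mon.
have -> : \prod_j x j ^+ w' j = 'X_[[multinom (w' j : nat) | j < m]].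
  by rewrite mpolyXE_id; apply: eq_bigr => j _; rewrite mnmE.
rewrite -(big_morph (fun u : 'X_{1..m} => 'X_[u] : A) (@mpolyXD _ _) (mpolyX0 _ _)).
rewrite -mpolyXD mcoeffX.
set b := [forall r', _]; suff -> : (\sum_(i | true) [multinom (N i j : nat) | j < m]
    + [multinom (w' j : nat) | j < m] == [multinom l j | j < m])%MM = b.
  by case: b.
apply/eqP/forallP => [/mnmP H j|H].
  by have := H j; rewrite mnmDE mnm_sumE !mnmE => <-; under [in eqbRHS]eq_bigr do rewrite mnmE.
apply/mnmP => j; rewrite mnmDE mnm_sumE !mnmE; under eq_bigr do rewrite mnmE.
exact/eqP.
Qed.

Hypothesis l_inj : injective l.

(** Compare the coefficients of $\prod_jx_j^{l_j}$ in [det_complete_mx]: the alternant gives 1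
    because the exponents are distinct, and the expansion of the other two determinants counts
    contingency tables with signs. *)
Lemma sum_frob_matrices (R : comNzRingType) : (m <= B.+1)%N ->
  \sum_(w : 'S_m) \sum_(w' : 'S_m)
    (-1) ^+ odd_perm w * (-1) ^+ odd_perm w' * #|frob_matrices l w w'|%:R = 1 :> R.
Proof.
move=> mB.
have l_le i : (l i <= B)%N by rewrite (bigD1 i) //= leq_addr.
have sgnC (b : bool) : (-1) ^+ b = ((-1) ^+ b)%:MP :> A by rewrite rmorph_sign.
have /(congr1 (mcoeff [multinom l j | j < m])) := det_complete_mx x l_le mB.
have -> : (\det (\matrix_(i, j) x j ^+ l i))@_[multinom l j | j < m] = 1.
  rewrite /determinant (raddf_sum (mcoeff _)) /= (bigD1 1%g) //=.
  have term (s : 'S_m) : \prod_i (\matrix_(i, j) x j ^+ l i) i (s i) =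
      'X_[[multinom l ((s^-1)%g j) | j < m]] :> A.
    rewrite mpolyXE_id [RHS](reindex_inj (@perm_inj _ s)) /=.
    by apply: eq_bigr => i _; rewrite mxE mnmE permK.
  rewrite [X in _ + X]big1 ?addr0 => [|s s1].
    rewrite term odd_perm1 expr0 mul1r mcoeffX; case: eqP => // -[].
    by apply/mnmP => j; rewrite !mnmE invg1 perm1.
  rewrite term sgnC mcoeffCM mcoeffX; case: eqP => [/mnmP e|]; last by rewrite mulr0.
  case/eqP: s1; apply/permP => j; rewrite perm1; apply: l_inj.
  by have := e (s j); rewrite !mnmE permK.
rewrite -[X in _ * X]det_tr /determinant big_distrlr (raddf_sum (mcoeff _)) /=.
move=> e; rewrite -[RHS](rmorph1 (intr : int -> R)) -e.
rewrite rmorph_sum; apply: eq_bigr => w _.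
rewrite (raddf_sum (mcoeff _)) rmorph_sum; apply: eq_bigr => w' _ /=.
under [X in _ * (_ * X)]eq_bigr => j _ do rewrite !mxE.
rewrite mulrACA !sgnC -rmorphM mcoeffCM coef_term.
by rewrite !rmorphM /= !rmorph_sign rmorph_nat.
Qed.

End FrobeniusNorm.

(** * The symmetrizer paired with itself and with the Frobenius sum *)

Section YoungSymmetrizerTrace.

Variables (R : numDomainType) (I : finType) (row col : I -> nat).

Local Notation P := (fiber_stab row).
Local Notation Q := (fiber_stab col).
Local Notation e := (young_sym_coef R row col).

Lemma sum_young_sym (f : {perm I} -> R) :
  \sum_s e s * f s =
  \sum_(p in P) \sum_(q in Q) (-1) ^+ odd_perm q * f (p * q)%g.
Proof.
under eq_bigr => s _ do rewrite mulr_suml.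
rewrite exchange_big /=; apply: eq_bigr => p _.
under eq_bigr => s _ do rewrite mulr_suml.
rewrite exchange_big /=; apply: eq_bigr => q _.
rewrite (bigD1 (p * q)%g) //= eqxx mulr1n big1 ?addr0 // => s ns.
by rewrite eq_sym (negPf ns) mul0r.
Qed.

Definition young_sym_class (g : {perm I}) : R := \sum_h e (h * g^-1 * h^-1)%g.

Lemma young_sym_classJ g h : young_sym_class (h * g * h^-1)%g = young_sym_class g.
Proof.
rewrite /young_sym_class (reindex_inj (mulIg h^-1%g)) /=; apply: eq_bigr => k _.
by rewrite !invMg invgK !mulgA !mulgKV.
Qed.

(** $(pq)^{-1}$ is conjugate to $p^{-1}q^{-1}$, a term of the symmetrizer with the same sign. *)
Lemma young_sym_classV g : young_sym_class g^-1 = young_sym_class g.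
Proof.
have E x : young_sym_class x =
  \sum_(p in P) \sum_(q in Q) \sum_h (-1) ^+ odd_perm q *+ (p * q == h * x^-1 * h^-1)%g.
  rewrite /young_sym_class exchange_big /=; apply: eq_bigr => p _.
  by rewrite exchange_big.
rewrite !E (reindex_inj invg_inj) /=; apply: eq_big => [p|p _]; first by rewrite groupV.
rewrite (reindex_inj invg_inj) /=; apply: eq_big => [q|q _]; first by rewrite groupV.
rewrite odd_permV (reindex_inj (mulgI q)) /=; apply: eq_bigr => h _.
congr (_ *+ (nat_of_bool _)).
have -> : (p^-1 * q^-1 = (q * (p * q) * q^-1)^-1)%g by rewrite mulgA mulgK invMg.
have -> : (q * h * g^-1^-1 * (q * h)^-1 = (q * (h * g^-1 * h^-1) * q^-1)^-1)%g.
  by rewrite !invMg !invgK !mulgA.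
by rewrite (inj_eq invg_inj) (inj_eq (mulIg _)) (inj_eq (mulgI _)).
Qed.

Lemma sum_young_sym_class (Y : {perm I} -> R) :
  (forall g h, Y (h * g * h^-1)%g = Y g) -> (forall g, Y g^-1%g = Y g) ->
  \sum_g young_sym_class g * Y g = #|{perm I}|%:R * \sum_s e s * Y s.
Proof.
move=> YJ YV; under eq_bigr => g _ do rewrite mulr_suml.
rewrite exchange_big /= -sum1_card natr_sum mulr_suml; apply: eq_bigr => h _.
rewrite mul1r (reindex_inj invg_inj) /= [RHS](reindex_inj (conjg_inj h^-1)%g) /=.
by apply: eq_bigr => g _; rewrite invgK conjgE invgK mulgA YJ YV.
Qed.

Hypothesis box_inj : forall x y, row x = row y -> col x = col y -> x = y.

Hypothesis box_up :
  forall x r, (r <= row x)%N -> exists2 y, row y = r & col y = col x.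

Local Notation c := (young_sym_eigen R row col).

(** Two uses of the sandwich identity: one splits off $e(h^{-1})$, the other, read backwards, turns
    what remains into $\sum_ye(y)e(hy^{-1})=c\,e(h)$. *)
Lemma sum_young_sym_conj h :
  \sum_s e s * e (h * s^-1 * h^-1)%g = c * e h * e h^-1%g.
Proof.
have sandwich := young_sym_sandwich R box_inj box_up.
have e1 := young_sym_coef1 R box_inj.
have E s t (z : {perm I}) : (forall p q p' q',
    (p' * q' == s p q)%g = (p * (q * z * p') * q' == t)%g) ->
  \sum_(p in P) \sum_(q in Q) (-1) ^+ odd_perm q * e (s p q) =
  \sum_(q in Q) \sum_(p' in P) (-1) ^+ odd_perm q * e (q * z * p')%g * e t.
  move=> st; rewrite exchange_big /=; apply: eq_bigr => q _.
  under eq_bigr => p _ do rewrite /young_sym_coef mulr_sumr.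
  rewrite exchange_big /=; apply: eq_bigr => p' _.
  rewrite -mulrA -sandwich mulr_sumr; apply: eq_bigr => p _; congr (_ * _).
  by apply: eq_bigr => q' _; rewrite st.
rewrite sum_young_sym (E (fun p q => h * (p * q)^-1 * h^-1)%g h^-1%g h^-1%g); last first.
  move=> p q p' q'; rewrite -(inj_eq (mulgI (p * q * h^-1)%g)).
  have -> : (p * q * h^-1 * (h * (p * q)^-1 * h^-1) = h^-1)%g.
    by move: (p * q)%g => x; rewrite !mulgA mulgVK mulgV mul1g.
  by rewrite !mulgA.
transitivity ((\sum_y e y * e (h * y^-1)%g) * e h^-1%g).
  rewrite sum_young_sym (E (fun p q => h * (p * q)^-1)%g 1%g h^-1%g).
    rewrite mulr_suml; apply: eq_bigr => q _; rewrite mulr_suml; apply: eq_bigr => p _.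
    by rewrite e1 mulr1.
  move=> p q p' q'; rewrite -(inj_eq (mulgI (p * q * h^-1)%g)).
  have -> : (p * q * h^-1 * (h * (p * q)^-1) = 1)%g by rewrite mulgA mulgVK mulgV.
  by rewrite !mulgA.
congr (_ * _); rewrite -(young_sym_idem R box_inj box_up).
rewrite [RHS](reindex_inj invg_inj) [RHS](reindex_inj (mulIg h^-1%g)) /=.
by apply: eq_bigr => y _; rewrite invgK mulgVK invMg invgK mulrC.
Qed.

Lemma sum_young_sym_class_sqr :
  \sum_g young_sym_class g * young_sym_class g = #|{perm I}|%:R * c ^+ 2.
Proof.
rewrite sum_young_sym_class; [|exact: young_sym_classJ|exact: young_sym_classV].
congr (_ * _); under eq_bigr => s _ do rewrite mulr_sumr.
rewrite exchange_big /=; under eq_bigr => h _ do rewrite sum_young_sym_conj -mulrA.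
rewrite -mulr_sumr expr2; congr (_ * _).
have := young_sym_idem R box_inj box_up 1%g.
rewrite (young_sym_coef1 R box_inj) mulr1 => <-.
by apply: eq_bigr => h _; rewrite mulg1.
Qed.

End YoungSymmetrizerTrace.

Lemma card_lt_ord n m (f : 'I_n -> 'I_m) r :
  #|[set i | (f i < r)%N]| = (\sum_(j < m | (j < r)%N) #|[set i | f i == j]|)%N.
Proof.
rewrite -sum1_card (partition_big f (fun j : 'I_m => (j < r)%N)) /= => [|i]; last by rewrite inE.
apply: eq_bigr => j jr; rewrite -sum1_card; apply: eq_bigl => i.
by rewrite !inE; case: eqP => [->|]; rewrite ?andbF ?jr.
Qed.

Section FrobeniusFormula.

Variable la : young_diagram.

Local Notation n := (yd_size la).
Local Notation m := (size la).
Local Notation row := (@box_row la).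
Local Notation col := (@box_col la).
Local Notation P := (fiber_stab row).
Local Notation Q := (fiber_stab col).
Local Notation e := (young_sym_coef algC row col).
Local Notation c := (young_eigen la).

Definition shifted_row (r : nat) : nat := (nth 0%N la r + (m - r.+1))%N.

Local Notation l := (fun r : 'I_m => shifted_row r).
Local Notation psi := (@frob_char algC n m l).

Lemma shifted_row_inj : injective l.
Proof.
move=> i j; rewrite /shifted_row => e; apply/eqP; apply: contraT => ij.
wlog lt : i j e ij / (i < j)%N.
  move=> H; have [] := ltngtP i j; [exact: H| |by move=> /val_inj/eqP; rewrite (negPf ij)].
  by apply: H; rewrite // eq_sym.
by have := yd_sorted la (ltnW lt); have := ltn_ord j; lia.
Qed.

Lemma sum_shifted_row : (\sum_(r < m) shifted_row r = n + \sum_(r < m) r)%N.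
Proof.
rewrite big_split /= [in RHS](reindex_inj rev_ord_inj) /=; congr (_ + _)%N.
by rewrite /yd_size sumnE (big_nth 0%N) big_mkord.
Qed.

Let color_set (w : 'S_m) : {set {ffun 'I_n -> 'I_m}} :=
  [set F | [forall r, color_count F r + w r == l r]%N].

Let fixed_sum (F : {ffun 'I_n -> 'I_m}) : algC :=
  \sum_(p in P) \sum_(q in Q) (-1) ^+ odd_perm q * (fixed_coloring (p * q)%g F)%:R.

Let sum_young_frob_set w :
  \sum_s e s * #|frob_set l w s|%:R = \sum_(F in color_set w) fixed_sum F.
Proof.
rewrite sum_young_sym [RHS]exchange_big /=; apply: eq_bigr => p _.
rewrite [RHS]exchange_big /=; apply: eq_bigr => q _.
rewrite -mulr_sumr -natr_sum -sum1_card big_mkcond [in RHS]big_mkcond /=.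
congr (_ * _%:R); apply: eq_bigr => F _; rewrite !inE.
by case: fixed_coloring; case: [forall _, _].
Qed.

(** Multiplying [q] by the transposition of the two boxes reverses the sign and preserves the fixing
    condition. *)
Let fixed_sum_eq0 (F : {ffun 'I_n -> 'I_m}) x y : x != y -> F x = F y -> col x = col y -> fixed_sum F = 0.
Proof.
move=> xy Fxy cxy; apply: big1 => p _; set S := \sum_(q in Q) _.
suff /eqP : S = - S by rewrite -addr_eq0 -mulr2n mulrn_eq0 => /eqP.
have Qt := tperm_fiber_stab cxy.
rewrite {1}/S (reindex_inj (mulIg (tperm x y))) -sumrN /=.
apply: eq_big => [q|q _]; first by rewrite groupMr.
rewrite odd_permM odd_tperm xy signr_addb expr1 mulrN1 mulNr; congr (- (_ * (nat_of_bool _)%:R)).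
apply: eq_forallb => i; rewrite mulgA permM.
by congr (_ == _); case: tpermP => [->|->|].
Qed.

Let column_injective (F : {ffun 'I_n -> 'I_m}) := forall x y, col x = col y -> F x = F y :> nat -> x = y.

Let column_injectiveP F : fixed_sum F != 0 -> column_injective F.
Proof.
move=> nz x y cxy /val_inj Fxy; apply/eqP; apply: contra_neqT nz => xy.
exact: fixed_sum_eq0 Fxy cxy.
Qed.

Let rowo (i : 'I_n) : 'I_m := Ordinal (box_rowP i).

Let card_rowo (r : 'I_m) : #|[set i | rowo i == r]| = nth 0%N la r.
Proof. by rewrite -card_box_row; apply: eq_card => i; rewrite !inE. Qed.

(** Dominance bounds the partial sums of [w] below by those of $m-1,m-2,\dots,0$, the largest
    possible for a permutation of $0,\dots,m-1$. *)
Let color_set_rev (w : 'S_m) F : F \in color_set w -> column_injective F ->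
  forall r : 'I_m, w r = rev_ord r.
Proof.
rewrite inE => /forallP Fw Fi.
have wE (i : 'I_m) : (color_count F i + w i = nth 0%N la i + (m - i.+1))%N by apply/eqP/Fw.
have part r : (\sum_(i < m | (i < r)%N) (m - i.+1) <= \sum_(i < m | (i < r)%N) w i)%N.
  have := column_injective_card (@box_rowcol_inj la) (@box_row_up la) Fi r.
  rewrite card_lt_ord (card_lt_ord rowo); under [leqRHS]eq_bigr do rewrite card_rowo.
  have : (\sum_(i < m | (i < r)%N) (color_count F i + w i) =
          \sum_(i < m | (i < r)%N) (nth 0%N la i + (m - i.+1)))%N.
    by apply: eq_bigr => i _.
  rewrite !big_split /= => E le.
  by rewrite -(leq_add2l (\sum_(i < m | (i < r)%N) nth 0%N la i)) -E leq_add2r.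
have H k : forall r : 'I_m, (r < k)%N -> w r = (m - r.+1)%N :> nat.
  elim: k => // k IH r; rewrite ltnS leq_eqVlt => /orP[/eqP rk|]; last exact: IH.
  have := part k.+1; rewrite (bigD1 r) /= ?rk // [leqRHS](bigD1 r) /= ?rk //.
  have -> : (\sum_(i < m | (i < k.+1) && (i != r)) w i =
             \sum_(i < m | (i < k.+1) && (i != r)) (m - i.+1))%N.
    apply: eq_bigr => i /andP[ik ir]; apply: IH.
    by rewrite -val_eqE /= rk in ir; lia.
  rewrite leq_add2r => ge; have wm := ltn_ord (w r); have rm := ltn_ord r.
  have [lt|lt|e] := ltngtP (w r) (m - r.+1)%N; [by lia| |by rewrite e rk].
  have jm : (m - (w r).+1 < m)%N by lia.
  have jk : (Ordinal jm < k)%N by rewrite /=; lia.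
  have wj : w (Ordinal jm) = w r by apply: val_inj; rewrite /= (IH _ jk) /=; lia.
  by have := perm_inj wj => /(congr1 val) /=; lia.
by move=> r; apply: val_inj; rewrite /= (H m r (ltn_ord r)).
Qed.

Let revp : 'S_m := perm rev_ord_inj.

(** By [column_injective_perm] the colourings that contribute are [row] composed with some [q0] in
    [Q]. Such a colouring is fixed by [p * q] when $q_0^{-1}pqq_0$ lies in [P], and the sum becomes
    the one that defines [c]. *)
Let sum_fixed_rev : \sum_(F in color_set revp) fixed_sum F = c.
Proof.
pose phi (q : 'S_n) : {ffun 'I_n -> 'I_m} := [ffun i => rowo (q i)].
have phi_inj : {in Q &, injective phi}.
  move=> q q' /fiber_stabP Hq /fiber_stabP Hq' /ffunP e; apply/permP => i.
  apply: box_rowcol_inj; last by rewrite Hq Hq'.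
  by have := e i; rewrite !ffunE => /(congr1 val).
have phiC q : phi q \in color_set revp.
  rewrite inE; apply/forallP => r; rewrite permE /= /shifted_row; apply/eqP; congr (_ + _)%N.
  rewrite -card_rowo -[RHS](card_preimset _ (@perm_inj _ q)).
  by apply: eq_card => i; rewrite !inE ffunE.
have -> : \sum_(F in color_set revp) fixed_sum F = \sum_(F in phi @: Q) fixed_sum F.
  rewrite big_mkcond [RHS]big_mkcond; apply: eq_bigr => F _.
  case: imsetP => [[q _ ->]|nF]; first by rewrite phiC.
  case: ifP => // FC; apply/eqP; apply: contra_notT nF => /column_injectiveP Fi.
  have [r|q [qc Fq]] := column_injective_perm (@box_rowcol_inj la) (@box_row_up la) Fi.
    case: (ltnP r m) => rm; last first.
      rewrite !eq_card0 // => i; rewrite !inE; apply/eqP => e.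
        by have := box_rowP i; rewrite e ltnNge rm.
      by have := ltn_ord (F i); rewrite e ltnNge rm.
    have := FC; rewrite inE => /forallP/(_ (Ordinal rm)).
    by rewrite permE /= /shifted_row eqn_add2r card_box_row => /eqP.
  exists q; first exact/fiber_stabP.
  by apply/ffunP => i; rewrite ffunE; apply: val_inj; rewrite /= Fq.
rewrite (big_imset _ phi_inj) /= /young_eigen /young_sym_eigen /fixed_sum.
have fixE q0 p q : fixed_coloring (p * q)%g (phi q0) = ((q0^-1 * p * q * q0)%g \in P).
  apply/forallP/fiber_stabP => H i.
    have /eqP := H (q0^-1 i)%g; rewrite !ffunE => /(congr1 val) /=.
    by rewrite permKV permM => e; rewrite !permM.
  have := H (q0 i); rewrite !permM permK => e; rewrite !ffunE; apply/eqP/val_inj.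
  exact: e.
transitivity (\sum_(q0 in Q) \sum_(p in P) \sum_(q in Q)
    (-1) ^+ odd_perm q0 * (-1) ^+ odd_perm q * ((q0 * p * q^-1)%g \in P)%:R : algC).
  rewrite (reindex_inj invg_inj) /=; apply: eq_big => [q0|q0 Qq0]; first by rewrite groupV.
  apply: eq_bigr => p _; rewrite (reindex_inj invg_inj) (reindex_inj (mulgI q0^-1%g)) /=.
  apply: eq_big => [q|q _]; first by rewrite groupV groupMl // groupV.
  rewrite fixE odd_permV odd_permM odd_permV signr_addb invMg !invgK.
  by rewrite !mulgA mulgK.
apply: eq_bigr => q _; apply: eq_bigr => p _; rewrite /young_sym_coef exchange_big mulr_sumr /=.
apply: eq_bigr => q' _; rewrite -mulrA; congr (_ * _).
case: (boolP (q * p * q'^-1 \in P)%g) => H.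
  rewrite (bigD1 (q * p * q'^-1)%g) //= mulgKV eqxx mulr1n mulr1 big1 ?addr0 // => p' /andP[_ np].
  by case: eqP => [e|]; [case/eqP: np; rewrite -e mulgK | rewrite mulr0n].
rewrite mulr0 big1 // => p' Pp'; case: eqP => [e|]; last by rewrite mulr0n.
by case/negP: H; rewrite -e mulgK.
Qed.

Lemma young_sym_frob_char : \sum_s e s * psi s = (-1) ^+ odd_perm revp * c.
Proof.
under eq_bigr => s _ do rewrite mulr_sumr.
rewrite exchange_big /= (bigD1 revp) //=.
under eq_bigr => s _ do rewrite mulrCA.
rewrite -mulr_sumr sum_young_frob_set sum_fixed_rev big1 ?addr0 // => w wn.
under eq_bigr => s _ do rewrite mulrCA.
rewrite -mulr_sumr sum_young_frob_set big1 ?mulr0 // => F Fw.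
apply/eqP; apply: contraNT wn => /column_injectiveP Fi.
by apply/eqP/permP => r; rewrite permE (color_set_rev Fw Fi).
Qed.

End FrobeniusFormula.

Section FrobeniusClass.

Variables (R : comNzRingType) (n m : nat) (l : 'I_m -> nat).

Lemma frob_charJ (g h : 'S_n) : frob_char R l (h * g * h^-1)%g = frob_char R l g.
Proof.
apply: eq_bigr => w _; congr (_ * _%:R).
pose f (F : {ffun 'I_n -> 'I_m}) : {ffun 'I_n -> 'I_m} := [ffun i => F (h^-1 i)%g].
have fI : injective f.
  by move=> F F' /ffunP e; apply/ffunP => i; have := e (h i); rewrite !ffunE permK.
rewrite -(card_imset _ fI); apply: eq_card => F; apply/imsetP/idP => [[F' + ->]|].
  rewrite !inE => /andP[/forallP H1 /forallP H2]; apply/andP; split; apply/forallP => i.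
    by have := H1 (h^-1 i)%g; rewrite !ffunE !permM permKV.
  by rewrite color_count_perm.
move=> HF; exists [ffun i => F (h i)]; last by apply/ffunP => i; rewrite !ffunE permKV.
move: HF; rewrite !inE => /andP[/forallP H1 /forallP H2]; apply/andP; split; apply/forallP => i.
  by have := H1 (h i); rewrite !ffunE !permM permKV.
by rewrite color_count_perm.
Qed.

Lemma frob_charV (g : 'S_n) : frob_char R l g^-1 = frob_char R l g.
Proof.
apply: eq_bigr => w _; congr (_ * _%:R); apply: eq_card => F; rewrite !inE.
congr (_ && _); apply/forallP/forallP => H i.
  by have := H (g i); rewrite permK eq_sym.
by have := H (g^-1 i)%g; rewrite permKV eq_sym.
Qed.

End FrobeniusClass.

(** * Explicit values of the Frobenius sum *)

Lemma det_monic_Vandermonde (R : comNzRingType) m (p : 'I_m -> {poly R}) (x : 'I_m -> R) :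
  (forall j, p j \is monic) -> (forall j, size (p j) = j.+1) ->
  \det (\matrix_(i, j) (p j).[x i]) = \prod_(i < m) \prod_(j < m | (i < j)%N) (x j - x i).
Proof.
move=> pm ps.
have -> : \matrix_(i, j) (p j).[x i] =
    (Vandermonde m (\row_i x i))^T *m \matrix_(a, j) (p j)`_a.
  apply/matrixP => i j; rewrite !mxE (horner_coef_wide _ (n := m)) ?ps //.
  by apply: eq_bigr => a _; rewrite !mxE mulrC.
rewrite det_mulmx det_tr det_Vandermonde -[X in _ * X]det_tr det_trig.
  rewrite [X in _ * X]big1 ?mulr1 => [|j _]; last first.
    by rewrite !mxE; have /monicP := pm j; rewrite lead_coefE ps.
  by apply: eq_bigr => i _; apply: eq_bigr => j _; rewrite !mxE.
by apply/is_trig_mxP => i j ij; rewrite !mxE nth_default // ps.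
Qed.

Lemma det_ffact (R : comNzRingType) m (l : 'I_m -> nat) :
  \det (\matrix_(i, j) (l i ^_ j)%:R) =
  \prod_(i < m) \prod_(j < m | (i < j)%N) ((l j)%:R - (l i)%:R) :> R.
Proof.
pose p (j : 'I_m) : {poly R} := \prod_(a < j) ('X - (a%:R)%:P).
rewrite -(det_monic_Vandermonde (p := p)) => [|j|j]; last first.
- by rewrite size_prod_XsubC -[index_enum _]enumT size_enum_ord.
- exact: monic_prod_XsubC.
congr (\det _); apply/matrixP => i j; rewrite !mxE horner_prod.
elim: (nat_of_ord j) => [|b IH]; first by rewrite big_ord0 ffactn0.
rewrite big_ord_recr /= -IH ffactnSr natrM !hornerE.
have [bl|lb] := leqP b (l i); first by rewrite natrB.
by rewrite ffact_small // !mul0r.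
Qed.

Lemma prod_sub_update (F : fieldType) m (x z : 'I_m -> F) (j : 'I_m) :
  injective x -> (forall i, i != j -> z i = x i) ->
  (\prod_(a < m) \prod_(b < m | (a < b)%N) (z b - z a)) /
  (\prod_(a < m) \prod_(b < m | (a < b)%N) (x b - x a)) =
  \prod_(i < m | i != j) ((z j - x i) / (x j - x i)).
Proof.
move=> xI zx; rewrite -prodf_div.
pose r i := (z j - x i) / (x j - x i).
have nz a b : a != b -> x a - x b != 0 by rewrite subr_eq0 (inj_eq xI).
have ltn_neq (a b : 'I_m) : (a < b)%N -> a != b by rewrite -val_eqE /=; lia.
transitivity (\prod_(a < m) \prod_(b < m | (a < b)%N)
    ((if a == j then r b else 1) * (if b == j then r a else 1))).
  apply: eq_bigr => a _; rewrite -prodf_div; apply: eq_bigr => b ab.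
  have nab := ltn_neq _ _ ab.
  have [aj|aj] := eqVneq a j; have [bj|bj] := eqVneq b j.
  - by rewrite aj bj eqxx in nab.
  - by rewrite aj zx // mulr1 /r -[z j - _]opprB -[x j - _]opprB invrN mulrNN.
  - by rewrite bj (zx a) // mul1r.
  - by rewrite !zx // mulr1 divff // nz // eq_sym.
under eq_bigr => a _ do rewrite big_split /=.
rewrite big_split /=.
rewrite (bigD1 j) //= [X in _ * X * _]big1 => [|a /negPf aj]; last by rewrite aj big1.
rewrite eqxx mulr1 [X in _ * X](eq_bigr (fun a : 'I_m => if (a < j)%N then r a else 1)).
  rewrite -big_mkcond [RHS](bigID (fun a : 'I_m => (a < j)%N)) /= mulrC; congr (_ * _).
    by apply: eq_bigl => a; rewrite -val_eqE /=; lia.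
  by apply: eq_bigl => a; rewrite -val_eqE /=; lia.
move=> a _; rewrite -big_mkcondr; case: ifP => aj; last first.
  by rewrite big_pred0 // => b; case: eqP => [->|]; rewrite ?andbF ?aj.
by rewrite (big_pred1 j) // => b /=; case: eqP => [->|]; rewrite ?andbF ?aj.
Qed.

Section FrobeniusValues.

Variables (m : nat).

Implicit Types (l : 'I_m -> nat).

Let delta l : algC := \prod_(i < m) \prod_(j < m | (i < j)%N) ((l j)%:R - (l i)%:R).

(** The degree formula: the counts are multinomial, so multiplying by $\prod_rl_r!$ turns the
    alternating sum into the determinant of falling factorials in [det_ffact]. *)
Lemma frob_char1 n l : (\sum_r l r = n + \sum_(r < m) r)%N ->
  frob_char algC l (1%g : 'S_n) * \prod_r ((l r)`!)%:R = (n`!)%:R * delta l.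
Proof.
move=> sl; rewrite /delta -det_ffact /determinant mulr_suml mulr_sumr.
apply: eq_bigr => w _; rewrite mulrCA -mulrA; congr (_ * _).
under [in RHS]eq_bigr do rewrite mxE.
rewrite -!natr_prod -!natrM; congr (_%:R).
have [/forallP wl|] := boolP [forall r, w r <= l r]%N; last first.
  rewrite negb_forall => /existsP[r]; rewrite -ltnNge => wl.
  rewrite [in RHS](bigD1 r) //= ffact_small // mul0n muln0.
  rewrite (_ : frob_set l w 1 = set0) ?cards0 ?mul0n //; apply/setP => F.
  by rewrite !inE; apply/negP => /andP[_ /forallP/(_ r)/eqP e]; move: wl; rewrite -e ltnNge leq_addl.
have sN : (\sum_r (l r - w r) = n)%N.
  apply/eqP; rewrite -(eqn_add2r (\sum_(r < m) r)) -sl.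
  have -> : (\sum_(r < m) r = \sum_r w r)%N by rewrite (reindex_inj (@perm_inj _ w)).
  by rewrite -big_split /=; apply/eqP/eq_bigr => r _; rewrite subnK.
rewrite -(card_colorings sN) mulnAC -mulnA -big_split /=; congr (_ * _)%N.
  apply: eq_card => F; rewrite !inE.
  have -> : fixed_coloring 1 F by apply/forallP => i; rewrite perm1.
  by apply: eq_forallb => r; rewrite -[RHS](eqn_add2r (w r)) subnK.
by apply: eq_bigr => r _; rewrite ffact_fact.
Qed.

(** A colouring fixed by the cycle has one colour [j] on its [k.+1] points and is arbitrary
    elsewhere; deleting these points lowers $l_j$ by [k.+1]. *)
Lemma frob_char_cycle k n l (g : 'S_(k.+1 + n)) :
  (forall i, g i = (if i < k.+1 then i.+1 %% k.+1 else i)%N :> nat) ->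
  frob_char algC l g =
  \sum_(j | (k < l j)%N) frob_char algC (fun r => l r - (r == j) * k.+1)%N (1%g : 'S_n).
Proof.
move=> gE; rewrite exchange_big /=; apply: eq_bigr => w _.
rewrite -mulr_sumr -natr_sum; congr (_ * _%:R).
rewrite -sum1_card (partition_big (fun F : {ffun 'I_(k.+1 + n) -> 'I_m} => F ord0) predT) //=.
rewrite [RHS]big_mkcond; apply: eq_bigr => j _.
have block F : fixed_coloring g F && (F ord0 == j) = [forall i : 'I_k.+1, F (lshift n i) == j].
  apply/andP/forallP => [[/forallP gF /eqP F0] [i ik]|H].
    elim: i ik => [|i IH] ik.
      by rewrite -F0; apply/eqP; congr (F _); apply: val_inj.
    rewrite -(eqP (IH (ltnW ik))) -(eqP (gF (lshift n (Ordinal (ltnW ik))))).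
    by apply/eqP; congr (F _); apply: val_inj; rewrite /= gE /= (ltnW ik) modn_small.
  have Fj (i : 'I_(k.+1 + n)) : (i < k.+1)%N -> F i = j.
    by move=> ik; rewrite -(eqP (H (Ordinal ik))); congr (F _); apply: val_inj.
  split; last by rewrite Fj.
  apply/forallP => i; have [ik|ik] := ltnP i k.+1.
    by rewrite !Fj // gE ik ltn_pmod.
  by apply/eqP; congr (F _); apply: val_inj; rewrite /= gE ltnNge ik.
have [/forallP wl|] := boolP [forall r, w r <= l r]%N; last first.
  rewrite negb_forall => /existsP[r]; rewrite -ltnNge => wl.
  rewrite big_pred0 => [|F]; last first.
    by rewrite !inE; apply/negP => /andP[/andP[_ /forallP/(_ r)/eqP e]]; move: wl; rewrite -e ltnNge leq_addl.
  case: ifP => // _; rewrite eq_card0 // => F; rewrite !inE.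
  apply/negP => /andP[_ /forallP/(_ r)/eqP e]; move: wl; rewrite ltnNge => /negP; apply.
  by apply: leq_trans (leq_subr ((r == j) * k.+1) _); rewrite -e leq_addl.
transitivity #|[set F : {ffun 'I_n -> 'I_m} |
    [forall t, (t == j) * k.+1 + color_count F t == l t - w t]]|%N.
  rewrite -card_colorings_cons -sum1_card; apply: eq_bigl => F.
  rewrite !inE -block andbCA andbA; congr (_ && _ && _).
  by apply: eq_forallb => r; rewrite -[RHS](eqn_add2r (w r)) subnK.
case: ifP => kl.
  apply: eq_card => F; rewrite !inE.
  have -> : fixed_coloring 1 F by apply/forallP => i; rewrite perm1.
  apply: eq_forallb => r; apply/eqP/eqP; have := wl r; case: eqP => [->|_]; rewrite ?mul1n ?mul0n ?subn0; set x := color_count F _; set y := nat_of_ord _; lia.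
by rewrite eq_card0 // => F; rewrite !inE; apply/negP => /forallP/(_ j); rewrite eqxx; lia.
Qed.

End FrobeniusValues.

Section NormalizedCharacter.

Variable la : young_diagram.

Local Notation n := (yd_size la).
Local Notation m := (size la).
Local Notation e := (young_sym_coef algC (@box_row la) (@box_col la)).
Local Notation X := (young_sym_class algC (@box_row la) (@box_col la)).
Local Notation c := (young_eigen la).
Local Notation l := (fun r : 'I_m => shifted_row la r).
Local Notation psi := (@frob_char algC n m l).

Let sum_psi_sqr : \sum_g psi g * psi g = (n`!)%:R.
Proof.
rewrite (sum_frob_char_sqr algC (sum_shifted_row la)).
rewrite (sum_frob_matrices (@shifted_row_inj la)) ?mulr1 //.
rewrite sum_shifted_row -addnS; apply: leq_trans (leq_addl _ _).
by case: (size la) => // k; rewrite big_ord_recr /= ltnS leq_addl.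
Qed.

Let young_sym_real s : e s \is Num.real.
Proof. by apply: rpred_sum => p _; apply: rpred_sum => q _; rewrite rpredMn ?rpredX ?rpredN1. Qed.

(* X and c * psi have the same norm, and their scalar product is, up to sign, *)
(* the square of that norm.                                                   *)
Lemma young_character_frob : exists2 s : algC, s != 0 &
  forall g, young_character la g = s * psi g.
Proof.
have [s s2 [sr sE]] : exists2 s : algC, s ^+ 2 = 1 & s \is Num.real /\ \sum_g e g * psi g = s * c.
  exists ((-1) ^+ odd_perm (perm (@rev_ord_inj m))); first by rewrite sqrr_sign.
  by rewrite rpredX ?rpredN1 //; split=> //; apply: young_sym_frob_char.
exists s; first by apply: contra_eq_neq s2 => ->; rewrite expr0n /= eq_sym oner_eq0.
(* The square expands to $n!c^2-2s^2n!c^2+n!c^2$, and $s^2=1$. All values being real, each summand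
   is then zero. *)
have D0 : \sum_g (X g - s * c * psi g) ^+ 2 = 0.
  have expand (x y : 'S_n -> algC) c0 : \sum_g (x g - s * c0 * y g) ^+ 2 =
      \sum_g x g * x g - 2 * s * c0 * (\sum_g x g * y g) + c0 ^+ 2 * \sum_g y g * y g.
    rewrite !mulr_sumr -sumrB -big_split /=; apply: eq_bigr => g _.
    have -> : c0 ^+ 2 = s ^+ 2 * c0 ^+ 2 by rewrite s2 mul1r.
    by ring.
  rewrite expand.
  rewrite (sum_young_sym_class_sqr algC (@box_rowcol_inj la) (@box_row_up la)).
  rewrite sum_young_sym_class; [|exact: frob_charJ|exact: frob_charV].
  rewrite sE sum_psi_sqr card_Sn.
  rewrite -/c; move: c => c0; rewrite (_ : _ - _ + _ = (n`!)%:R * c0 ^+ 2 * (1 - s ^+ 2) *+ 2); last by ring.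
  by rewrite s2 subrr mulr0 mul0rn.
have psi_real g : psi g \is Num.real.
  by apply: rpred_sum => w _; rewrite rpredM ?rpred_nat ?rpredX ?rpredN1.
have c_real : c \is Num.real.
  apply: rpred_sum => q _; apply: rpred_sum => p _.
  by rewrite rpredM ?rpredX ?rpredN1 ?young_sym_real.
have X_real g : X g \is Num.real by apply: rpred_sum => h _; apply: young_sym_real.
move=> g; rewrite young_characterE; apply: (canLR (mulfK (young_eigen_neq0 la))).
rewrite mulrAC; apply/eqP; rewrite -subr_eq0 -sqrf_eq0.
have ge0 h : true -> 0 <= (X h - s * c * psi h) ^+ 2.
  by move=> _; rewrite real_exprn_even_ge0 // rpredB // !rpredM.
by have := psumr_eq0P ge0 D0 => ->.
Qed.

Let delta (x : 'I_m -> algC) : algC := \prod_(i < m) \prod_(j < m | (i < j)%N) (x j - x i).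

(** Frobenius' formula for a cycle. The proportionality factor cancels; by [frob_char_cycle] and
    [frob_char1] each term is a ratio of Vandermonde products in which only $l_j$ is lowered by [k].
    Terms with $l_j<k$ vanish through the falling factorial. *)
Lemma normalized_characterE k : (0 < k <= n)%N ->
  normalized_character k la =
  \sum_(j < m) (shifted_row la j ^_ k)%:R *
    \prod_(i < m | i != j) (((shifted_row la j)%:R - k%:R - (shifted_row la i)%:R) /
      ((shifted_row la j)%:R - (shifted_row la i)%:R)).
Proof.
case: k => // k /andP[_ kn].
have [s s0 chiE] := young_character_frob.
have xI : injective (fun r : 'I_m => (l r)%:R : algC).
  by move=> i j /eqP; rewrite eqr_nat => /eqP/shifted_row_inj.
have d0 : delta (fun r => (l r)%:R) != 0.
  apply/prodf_neq0 => i _; apply/prodf_neq0 => j ij.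
  by rewrite subr_eq0 (inj_eq xI) -val_eqE /=; lia.
have fact_neq0 a : (a`!)%:R != 0 :> algC by rewrite pnatr_eq0 -lt0n fact_gt0.
have L0 : \prod_r ((l r)`!)%:R != 0 :> algC by apply/prodf_neq0 => r _.
have psi1 : psi 1%g = (n`!)%:R * delta (fun r => (l r)%:R) / \prod_r ((l r)`!)%:R.
  by rewrite -(frob_char1 (sum_shifted_row la)) mulfK.
have sumD : (n = k.+1 + (n - k.+1))%N by rewrite subnKC.
have psik : psi (long_cycle n k.+1) = \sum_(j < m | (k < l j)%N)
    ((n - k.+1)`!)%:R * delta (fun r => (l r - (r == j) * k.+1)%N%:R) /
    \prod_r ((l r - (r == j) * k.+1)`!)%:R.
  have gE i := long_cycleE i kn.
  have sl := sum_shifted_row la.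
  move: (n - k.+1)%N sumD (long_cycle n k.+1) gE sl => n'; move: (yd_size la) => n0.
  move=> -> g gE sl; rewrite (frob_char_cycle _ gE); apply: eq_bigr => j kj.
  rewrite -frob_char1 ?mulfK //; first by apply/prodf_neq0 => r _.
  apply/eqP; rewrite -(eqn_add2l k.+1) addnA -sl.
  rewrite (bigD1 j) //= [in eqbRHS](bigD1 j) //= eqxx mul1n addnA subnKC // eqn_add2l.
  by apply/eqP/eq_bigr => r /negPf ->; rewrite subn0.
rewrite /normalized_character !chiE psik psi1.
rewrite [X in X / _]mulrCA -mulf_div divff // mul1r.
rewrite [RHS](bigID (fun j : 'I_m => (k < l j)%N)) /= [X in _ + X]big1 ?addr0; last first.
  by move=> j; rewrite -leqNgt => lj; rewrite ffact_small ?mul0r.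
rewrite mulr_sumr mulr_suml; apply: eq_bigr => j kj.
have zE (i : 'I_m) : i != j -> (l i - (i == j) * k.+1)%N%:R = (l i)%:R :> algC.
  by move=> /negPf ->; rewrite subn0.
have := prod_sub_update xI zE; rewrite -!/(delta _) eqxx mul1n natrB // => <-.
have -> : \prod_r ((l r)`!)%:R = (l j ^_ k.+1)%:R * \prod_r ((l r - (r == j) * k.+1)`!)%:R :> algC.
  rewrite (bigD1 j) //= [in RHS](bigD1 j) //= eqxx mul1n mulrA -natrM ffact_fact //.
  by congr (_ * _); apply: eq_bigr => r /negPf ->; rewrite subn0.
have {}L0 : \prod_r ((l r - (r == j) * k.+1)`!)%:R != 0 :> algC by apply/prodf_neq0 => r _.
have f0 : (l j ^_ k.+1)%:R != 0 :> algC by rewrite pnatr_eq0 -lt0n ffact_gt0.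
rewrite -(ffact_fact kn) natrM.
have a0 : (n ^_ k.+1)%:R != 0 :> algC by rewrite pnatr_eq0 -lt0n ffact_gt0.
have b0 := fact_neq0 (n - k.+1)%N.
move: (delta _) (delta _) (\prod_r _) d0 L0 f0 a0 b0.
move: (n ^_ _)%:R (n - _)`!%:R (_ ^_ _)%:R => a b f d' d L d0 L0 f0 a0 b0.
by field; rewrite d0 L0 f0 a0 b0.
Qed.

End NormalizedCharacter.

(** * The normalized character as a residue *)

Section Congruence.

Variable A : comNzRingType.

Implicit Types p q s : {poly A}.

Definition eqX N p q : Prop := exists r, p = q + 'X^N * r.

Lemma eqX_refl N p : eqX N p p.
Proof. by exists 0; rewrite mulr0 addr0. Qed.

Lemma eqX_sym N p q : eqX N p q -> eqX N q p.
Proof. by case=> r ->; exists (- r); rewrite mulrN addrK. Qed.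

Lemma eqX_trans N p q s : eqX N p q -> eqX N q s -> eqX N p s.
Proof. by case=> r -> [r' ->]; exists (r' + r); rewrite mulrDr addrA. Qed.

Lemma eqXD N p q p' q' : eqX N p q -> eqX N p' q' -> eqX N (p + p') (q + q').
Proof. by case=> r -> [r' ->]; exists (r + r'); ring. Qed.

Lemma eqXM N p q p' q' : eqX N p q -> eqX N p' q' -> eqX N (p * p') (q * q').
Proof. by case=> r -> [r' ->]; exists (q * r' + r * q' + 'X^N * r * r'); ring. Qed.

Lemma eqXMl N s p q : eqX N p q -> eqX N (s * p) (s * q).
Proof. by apply: eqXM; apply: eqX_refl. Qed.

Lemma eqXMr N s p q : eqX N p q -> eqX N (p * s) (q * s).
Proof. by move=> /eqXM; apply; apply: eqX_refl. Qed.

Lemma eqX_exp N p q n : eqX N p q -> eqX N (p ^+ n) (q ^+ n).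
Proof.
by move=> H; elim: n => [|n IH]; rewrite ?expr0 ?exprS; [apply: eqX_refl | apply: eqXM].
Qed.

Lemma eqX_sum N (I : Type) (r : seq I) (P : pred I) (f g : I -> {poly A}) :
  (forall i, P i -> eqX N (f i) (g i)) ->
  eqX N (\sum_(i <- r | P i) f i) (\sum_(i <- r | P i) g i).
Proof. by move=> H; apply: (big_ind2 (eqX N)) => //; [apply: eqX_refl | apply: eqXD]. Qed.

Lemma eqX_prod1 N (I : Type) (r : seq I) (P : pred I) (f : I -> {poly A}) :
  (forall i, P i -> eqX N (f i) 1) -> eqX N (\prod_(i <- r | P i) f i) 1.
Proof.
move=> H; apply: (big_ind (fun p => eqX N p 1)) => //; first exact: eqX_refl.
by move=> p q Hp Hq; have := eqXM Hp Hq; rewrite mulr1.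
Qed.

Lemma eqX_leq N M p q : (M <= N)%N -> eqX N p q -> eqX M p q.
Proof.
move=> MN [r ->]; exists ('X^(N - M) * r).
by rewrite mulrA -exprD subnKC.
Qed.

Lemma eqX_shift N M p q : eqX N p q -> eqX (M + N) ('X^M * p) ('X^M * q).
Proof. by case=> r ->; exists r; rewrite exprD; ring. Qed.

Lemma eqX_coef N p q i : eqX N p q -> (i < N)%N -> p`_i = q`_i.
Proof. by case=> r ->; apply: coef_add_high. Qed.

Lemma coef_eqX N p q : (forall i, (i < N)%N -> p`_i = q`_i) -> eqX N p q.
Proof.
move=> H; exists (drop_poly N (p - q)).
rewrite -[LHS](subrK q) addrC; congr (_ + _).
rewrite -[LHS](poly_take_drop N) [X in X + _](_ : _ = 0) ?add0r 1?mulrC //.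
by apply/polyP => i; rewrite coef_take_poly coef0; case: ifP => // /H e; rewrite coefB e subrr.
Qed.

Lemma eqX_deriv N p q : eqX N.+1 p q -> eqX N p^`() q^`().
Proof.
case=> r ->; exists (r *+ N.+1 + 'X * r^`()).
by rewrite derivD derivM derivXn /= exprSr -mulr_natr; ring.
Qed.

Lemma eqX_inv N p : p`_0 = 1 -> exists2 v : {poly A}, v`_0 = 1 & eqX N (v * p) 1.
Proof.
move=> p0; pose s := drop_poly 1 (1 - p).
have sE : 1 - p = 'X * s.
  rewrite -[LHS](poly_take_drop 1) mulrC expr1 [X in X + _](_ : _ = 0) ?add0r //.
  by apply/polyP => -[|i]; rewrite coef_take_poly coef0 //= coefB p0 coef1 subrr.
exists (\sum_(i < N.+1) ('X * s) ^+ i).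
  rewrite big_ord_recl expr0 coefD coef1 coef_sum big1 ?addr0 // => i _.
  by rewrite exprS -mulrA coefXM.
have -> : p = - ('X * s - 1) by rewrite -sE; ring.
rewrite mulrN mulrC -subrX1 exprMn exprS.
by exists (- ('X * s ^+ N.+1)); ring.
Qed.

Lemma eqX_cancel N s p q : s`_0 = 1 -> eqX N (s * p) (s * q) -> eqX N p q.
Proof.
move=> s0 H; have [v _ vs] := eqX_inv N s0.
have vsE r : eqX N (v * (s * r)) r by rewrite mulrA -[X in eqX _ _ X]mul1r; apply: eqXMr.
apply: eqX_trans (eqX_sym (vsE p)) _; apply: eqX_trans (vsE q); exact: eqXMl.
Qed.

Lemma coef0_prod (I : Type) (r : seq I) (P : pred I) (f : I -> {poly A}) :
  (forall i, P i -> (f i)`_0 = 1) -> (\prod_(i <- r | P i) f i)`_0 = 1.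
Proof.
move=> H; rewrite -horner_coef0 horner_prod big1 // => i Pi.
by rewrite horner_coef0 H.
Qed.

Lemma coef0_lin (y : A) : (1 - y%:P * 'X)`_0 = 1.
Proof. by rewrite coefB coefMX coef1 subr0. Qed.

Lemma geom_eqX N y : eqX N.+1 (geom N y * (1 - y%:P * 'X)) 1.
Proof. by exists (- (y ^+ N.+1)%:P); rewrite geomE; ring. Qed.

End Congruence.

Section ShiftedProduct.

Variable A : comNzRingType.

Implicit Types (X Y : seq A).

Definition shifted_lin k X : {poly A} :=
  \prod_(i < k) \prod_(x <- X) (1 - (x + i%:R)%:P * 'X).

(* With H(z) = \prod_X (z - x) / \prod_Y (z - y) and |X| = |Y| + 1, this is   *)
(* the residue at infinity, i.e. the coefficient of 1 / z, of                 *)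
(* H(z) H(z - 1) ... H(z - k + 1).                                            *)
Definition shifted_residue k X Y : A :=
  (shifted_lin k X * \prod_(i < k) \prod_(y <- Y) geom k.+1 (y + i%:R))`_k.+1.

Lemma shifted_lin0 k X : (shifted_lin k X)`_0 = 1.
Proof. by apply: coef0_prod => i _; apply: coef0_prod => x _; apply: coef0_lin. Qed.

Lemma shifted_lin_cat k X Y : shifted_lin k (X ++ Y) = shifted_lin k X * shifted_lin k Y.
Proof. by rewrite -big_split; apply: eq_bigr => i _; rewrite big_cat. Qed.

Lemma shifted_lin_perm k X Y : perm_eq X Y -> shifted_lin k X = shifted_lin k Y.
Proof. by move=> XY; apply: eq_bigr => i _; apply: perm_big. Qed.

(** The truncated geometric series invert [shifted_lin k Y] modulo $X^{k+2}$, so every truncated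
    quotient [T] has the same coefficient. *)
Lemma shifted_residueE k X Y (T : {poly A}) :
  eqX k.+2 (shifted_lin k Y * T) (shifted_lin k X) -> shifted_residue k X Y = T`_k.+1.
Proof.
move=> H; apply: (eqX_coef _ (ltnSn _)); apply: (eqX_cancel (shifted_lin0 k Y)).
apply: eqX_trans _ (eqX_sym H); rewrite mulrCA -[X in eqX _ _ X]mulr1; apply: eqXMl.
rewrite mulrC -big_split /=.
apply: eqX_prod1 => i _; rewrite -big_split /=.
by apply: eqX_prod1 => y _; apply: geom_eqX.
Qed.

Lemma shifted_residue_spec k X Y : exists2 T : {poly A}, shifted_residue k X Y = T`_k.+1 &
  eqX k.+2 (shifted_lin k Y * T) (shifted_lin k X).
Proof.
have [v _ vE] := eqX_inv k.+2 (shifted_lin0 k Y).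
have H : eqX k.+2 (shifted_lin k Y * (v * shifted_lin k X)) (shifted_lin k X).
  by rewrite mulrA mulrC (mulrC _ v) -[X in eqX _ _ X]mulr1; apply: eqXMl.
by exists (v * shifted_lin k X) => //; apply: shifted_residueE.
Qed.

Lemma shifted_residue_equiv k X Y X' Y' : perm_eq (X ++ Y') (X' ++ Y) ->
  shifted_residue k X Y = shifted_residue k X' Y'.
Proof.
move=> /(shifted_lin_perm k); rewrite !shifted_lin_cat => e.
have [T -> HT] := shifted_residue_spec k X' Y'.
apply: shifted_residueE; apply: (eqX_cancel (shifted_lin0 k Y')).
by rewrite mulrCA [X in eqX _ _ X]mulrC e mulrC; apply: eqXMr.
Qed.

End ShiftedProduct.

(** * Lagrange interpolation and partial fractions *)

Section Lagrange.

Variables (F : fieldType) (m : nat) (y : 'I_m.+1 -> F).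

Hypothesis y_inj : injective y.

Lemma prod_sub_neq0 j : \prod_(i | i != j) (y j - y i) != 0.
Proof. by apply/prodf_neq0 => i ij; rewrite subr_eq0 (inj_eq y_inj) eq_sym. Qed.

Lemma sum_lagrange (x : F) :
  \sum_j (\prod_(i | i != j) (y j - y i))^-1 * \prod_(i | i != j) (x - y i) = 1.
Proof.
pose d j := \prod_(i | i != j) (y j - y i).
pose p : {poly F} := \sum_j (d j)^-1 *: \prod_(i | i != j) ('X - (y i)%:P) - 1.
suff p0 : p = 0.
  have := congr1 (fun q => q.[x]) p0; rewrite /p hornerD hornerN hornerC horner0 => /eqP.
  rewrite subr_eq0 => /eqP e; rewrite -[RHS]e horner_sum; apply: eq_bigr => j _.
  by rewrite hornerZ horner_prod; congr (_ * _); apply: eq_bigr => i _; rewrite hornerXsubC.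
apply: (@roots_geq_poly_eq0 _ p [seq y j | j : 'I_m.+1]).
- apply/allP => _ /mapP[j _ ->]; rewrite /root /p hornerD hornerN hornerC horner_sum.
  rewrite subr_eq0 (bigD1 j) //= hornerZ horner_prod.
  under eq_bigr do rewrite hornerXsubC.
  rewrite mulVf ?prod_sub_neq0 // -subr_eq0 addrAC subrr add0r big1 // => i ij.
  rewrite hornerZ horner_prod (bigD1 j) /= ?hornerXsubC ?subrr ?mul0r ?mulr0 //.
  by rewrite eq_sym.
- by rewrite map_inj_uniq ?enum_uniq.
rewrite size_map size_enum_ord; apply: leq_trans (size_polyD _ _) _.
rewrite size_polyN size_poly1 geq_max andbT.
apply: leq_trans (size_sum _ _ _) _; apply/bigmax_leqP => j _.
apply: leq_trans (size_scale_leq _ _) _.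
rewrite -big_filter size_prod_XsubC size_filter -sum1_count sum1_card ltnS.
have := cardC1 j; rewrite card_ord /= => e; rewrite -[leqRHS]e.
by apply: subset_leq_card; apply/subsetP => i.
Qed.

End Lagrange.

(** [sum_lagrange] at the point $1/X$, multiplied by $X^m$. *)
Lemma sum_lagrange_rev (F : fieldType) m (y : 'I_m.+1 -> F) : injective y ->
  \sum_j (\prod_(i | i != j) (y j - y i))^-1%:P * \prod_(i | i != j) (1 - (y i)%:P * 'X) = 'X^m.
Proof.
move=> yI; pose f (a : F) : {fraction {poly F}} := tofrac a%:P.
have fI : injective f by move=> a b /eqP; rewrite tofrac_eq => /eqP/polyC_inj.
have t0 : tofrac 'X != 0 :> {fraction {poly F}} by rewrite tofrac_eq0 polyX_eq0.
have := sum_lagrange (inj_comp fI yI) (tofrac 'X)^-1.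
move=> /(congr1 (fun z => (tofrac 'X) ^+ m * z)); rewrite mulr1 mulr_sumr -tofracXn => e.
apply/eqP; rewrite -tofrac_eq -e rmorph_sum /=. apply/eqP.
apply: eq_bigr => j _.
have fV c : c != 0 -> f c^-1 = (f c)^-1.
  move=> c0; have fc0 : f c != 0 by rewrite tofrac_eq0 polyC_eq0.
  by apply: (mulfI fc0); rewrite mulfV // -tofracM -polyCM mulfV // tofrac1.
rewrite tofracM mulrCA; congr (_ * _).
  rewrite -[LHS]/(f _) fV ?prod_sub_neq0 // /f !rmorph_prod; congr (_^-1).
  by apply: eq_bigr => i _; rewrite /= polyCB tofracB.
have -> : 'X^m = \prod_(i < m.+1 | i != j) 'X :> {poly F}.
  rewrite prodr_const; congr ('X ^+ _).
  have := cardC1 j; rewrite card_ord /= => e1; rewrite -[LHS]e1.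
  by apply: eq_card => i; rewrite !inE.
rewrite !rmorph_prod -big_split /=; apply: eq_bigr => i _.
by rewrite tofracB tofracM tofrac1 mulrBr mulfV // mulrC.
Qed.

Section PartialFractions.

Variables (F : fieldType) (m k : nat) (y : 'I_m.+1 -> F) (Z : seq F).

Hypothesis y_inj : injective y.

Hypothesis size_Z : size Z = (m.+1 + k)%N.

(** If $p=\prod_z(1-zX)$, the coefficient is $\sum_ip_ix^{|s|-i}$, the value at [x] of the reversed
    polynomial. *)
Let coef_geom_prod N (s : seq F) (x : F) : (size s <= N)%N ->
  ((\prod_(z <- s) (1 - z%:P * 'X)) * geom N x)`_(size s) = \prod_(z <- s) (x - z).
Proof.
elim: s => [|z s IH] sN; first by rewrite !big_nil mul1r coef_poly.
rewrite !big_cons -IH ?(ltnW sN) //= -mulrA; set p := \prod_(_ <- _) _.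
rewrite mulrBl mul1r coefB -mulrA coefCM coefXM /= mulrBl; congr (_ - _).
have sp : (size p <= (size s).+1)%N.
  rewrite {}/p; elim: (s) => [|a u IHu]; first by rewrite big_nil size_poly1.
  rewrite big_cons; apply: leq_trans (size_polyMleq _ _) _.
  have : (size (1 - a%:P * 'X)%R <= 2)%N.
    apply: leq_trans (size_polyD _ _) _; rewrite geq_max size_poly1 /= size_polyN.
    by apply: leq_trans (size_polyMleq _ _) _; rewrite size_polyX size_polyC; case: (_ != _).
  by move: IHu => /=; lia.
have : (p * (geom N x * (1 - x%:P * 'X)))`_(size s).+1 = 0.
  rewrite geomE mulrBr mulr1 coefB [p`_ _]nth_default // mulrCA coefCM coefMXn.
  by rewrite ltnS sN mulr0 subr0.
rewrite mulrBr mulr1 mulrBr coefB.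
have -> : p * (geom N x * (x%:P * 'X)) = x%:P * (p * geom N x * 'X) by ring.
by rewrite coefCM coefMX /= => /eqP; rewrite subr_eq0 => /eqP ->.
Qed.

(** With $X=1/t$: the coefficient of $1/t$ at infinity in $\prod_z(t-z)/\prod_j(t-y_j)$ is the sum
    of the residues at the simple poles $y_j$. The decomposition of $X^mT$ comes from
    [sum_lagrange_rev]. *)
Lemma partial_fractions_succ (T : {poly F}) :
  eqX k.+2 (\prod_j (1 - (y j)%:P * 'X) * T) (\prod_(z <- Z) (1 - z%:P * 'X)) ->
  T`_k.+1 = \sum_j (\prod_(z <- Z) (y j - z)) / \prod_(i | i != j) (y j - y i).
Proof.
pose N := (m.+1 + k)%N => HT.
pose G := \sum_j (\prod_(i | i != j) (y j - y i))^-1%:P * (\prod_(z <- Z) (1 - z%:P * 'X) * geom N (y j)).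
have HG : eqX (m + k.+2) G ('X^m * T).
  apply: (@eqX_cancel _ _ (\prod_j (1 - (y j)%:P * 'X))).
    by apply: coef0_prod => i _; apply: coef0_lin.
  apply: (@eqX_trans _ _ _ ('X^m * \prod_(z <- Z) (1 - z%:P * 'X))); last first.
    by apply: eqX_sym; rewrite mulrCA; apply: eqX_shift.
  rewrite -(sum_lagrange_rev y_inj) mulr_suml mulr_sumr; apply: eqX_sum => j _.
  rewrite (bigD1 j) //=; set D := (_^-1)%:P; set Q := \prod_(i < m.+1 | _) _; set W := \prod_(z <- Z) _.
  have -> : (1 - (y j)%:P * 'X) * Q * (D * (W * geom N (y j))) =
    D * Q * W * (geom N (y j) * (1 - (y j)%:P * 'X)) by ring.
  rewrite -[X in eqX _ _ X]mulr1; apply: eqXMl.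
  by rewrite addnS -addSn addnS; apply: geom_eqX.
have := eqX_coef HG (i := (m + k.+1)%N); rewrite ltn_add2l ltnSn => /(_ isT).
rewrite [_ * T]mulrC coefMXn ltnNge leq_addr /= addKn => <-.
rewrite coef_sum; apply: eq_bigr => j _.
by rewrite coefCM mulrC addnS -addSn -size_Z coef_geom_prod // size_Z.
Qed.

End PartialFractions.

Lemma partial_fractions (F : fieldType) (m k : nat) (y : 'I_m -> F) (Z : seq F) (T : {poly F}) :
  injective y -> (0 < m)%N -> size Z = (m + k)%N ->
  eqX k.+2 (\prod_j (1 - (y j)%:P * 'X) * T) (\prod_(z <- Z) (1 - z%:P * 'X)) ->
  T`_k.+1 = \sum_j (\prod_(z <- Z) (y j - z)) / \prod_(i | i != j) (y j - y i).
Proof. by case: m y => // m y yI _ sZ H; apply: (partial_fractions_succ yI sZ H). Qed.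

Lemma big_iota (R : Type) (idx : R) (op : R -> R -> R) n (F : nat -> R) :
  \big[op/idx]_(i <- iota 0 n) F i = \big[op/idx]_(i < n) F i.
Proof. by rewrite -(big_mkord xpredT) /index_iota subn0. Qed.

Section Telescoping.

Variable A : comNzRingType.

Lemma shifted_lin_telescope k (Y : seq A) :
  \prod_(y <- Y) (1 - y%:P * 'X) * shifted_lin k [seq y + 1 | y <- Y] =
  shifted_lin k Y * \prod_(y <- Y) (1 - (y + k%:R)%:P * 'X).
Proof.
elim: k => [|k IH].
  rewrite /shifted_lin !big_ord0 mul1r mulr1.
  by apply: eq_bigr => y _; rewrite addr0.
rewrite /shifted_lin !big_ord_recr /= mulrA IH -!mulrA; congr (_ * (_ * _)).
by rewrite big_map; apply: eq_bigr => y _; rewrite /= -natr1 addrAC addrA.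
Qed.

Lemma shifted_lin1 k (x : A) : shifted_lin k [:: x] =
  \prod_(z <- [seq x + i%:R | i <- iota 0 k]) (1 - z%:P * 'X).
Proof.
rewrite big_map big_iota.
by apply: eq_bigr => i _; rewrite big_seq1.
Qed.

End Telescoping.

(** All rows contribute here, with or without a corner; in the quotient the surplus factors cancel
    by [addable_removable_perm]. *)
Definition row_ends (la : young_diagram) : seq int :=
  [seq (nth 0%N la a)%:Z - a%:Z | a <- iota 0 (size la).+1].

Definition row_lasts (la : young_diagram) : seq int :=
  [seq (nth 0%N la a)%:Z - a.+1%:Z | a <- iota 0 (size la)].

(** With $y_j=\lambda_j-j-1$, the row ends are the $y_j+1$ and $-m$, so the shifted product
    telescopes and only the simple poles $y_j$ remain. The residue there is $-k$ times the term [j]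
    of [normalized_characterE], where $-k=y_j-(y_j+k)$. *)
Lemma residue_normalized_character k (la : young_diagram) : (0 < k <= yd_size la)%N ->
  shifted_residue k (map intr (row_ends la)) (map intr (row_lasts la)) =
  - k%:R * normalized_character k la :> algC.
Proof.
move=> kn; rewrite normalized_characterE //.
have m_gt0 : (0 < size la)%N.
  by move: kn; rewrite /yd_size; case: (rows la) => //= /andP[]; case: k.
set X := map _ _; set Y := map _ _.
pose y (a : nat) : algC := (nth 0%N la a)%:R - a.+1%:R.
have YE : Y = [seq y a | a <- iota 0 (size la)].
  by rewrite /Y -map_comp; apply: eq_map => a; rewrite /= rmorphB /= -!pmulrn.
have XE : X = [seq y + 1 | y <- Y] ++ [:: - (size la)%:R].
  rewrite /X YE /row_ends -[(size la).+1]addn1 iotaD !map_cat -!map_comp /= add0n.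
  congr (_ ++ [:: _]).
    by apply: eq_map => a; rewrite /y /= rmorphB /= -!pmulrn -natr1; ring.
  by rewrite nth_default // rmorphB /= -!pmulrn sub0r.
clearbody X Y; have [T -> HT] := shifted_residue_spec k X Y.
pose Z := [seq - (size la)%:R + i%:R | i <- iota 0 k] ++ [seq y + k%:R | y <- Y].
have {}HT : eqX k.+2 (\prod_(y <- Y) (1 - y%:P * 'X) * T) (\prod_(z <- Z) (1 - z%:P * 'X)).
  apply: (eqX_cancel (shifted_lin0 k Y)); rewrite mulrCA.
  apply: eqX_trans (eqXMl _ HT) _.
  rewrite XE shifted_lin_cat mulrA shifted_lin_telescope /Z big_cat /= shifted_lin1 !big_map.
  by rewrite -mulrA; apply: eqXMl; rewrite mulrC; apply: eqX_refl.
have shE (a : nat) : (a < size la)%N -> (shifted_row la a)%:R = y a + (size la)%:R :> algC.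
  by move=> am; rewrite /shifted_row natrD natrB // /y; ring.
have size_Z : size Z = (size la + k)%N.
  by rewrite size_cat !size_map YE size_map !size_iota addnC.
have prodZ x : \prod_(z <- Z) (x - z) =
    (\prod_(i < k) (x + (size la)%:R - i%:R)) * \prod_(a < size la) (x - (y a + k%:R)).
  rewrite big_cat !big_map YE big_map !big_iota /=; congr (_ * _).
  by apply: eq_bigr => i _; ring.
move: HT; rewrite YE big_map big_iota.
have yI : injective (fun a : 'I_(size la) => y a).
  move=> i j e; apply: (@shifted_row_inj la); apply/eqP; rewrite -(eqr_nat algC).
  by rewrite !shE // e.
move=> /(partial_fractions yI m_gt0 size_Z) ->.
rewrite mulr_sumr; apply: eq_bigr => j _; rewrite prodZ (bigD1 j) //=.
have -> : y j - (y j + k%:R) = - k%:R by ring.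
have -> : \prod_(i < k) (y j + (size la)%:R - i%:R) = (shifted_row la j ^_ k)%:R.
  rewrite -shE //; move: (shifted_row la j) => u; elim: k {kn T X Y XE YE Z size_Z prodZ} => [|k IH].
    by rewrite big_ord0 ffactn0.
  rewrite big_ord_recr /= IH ffactnSr natrM.
  by have [ku|uk] := leqP k u; [rewrite natrB | rewrite ffact_small // !mul0r].
rewrite mulrCA -!mulrA; congr (_ * (_ * _)); rewrite -prodf_div; apply: eq_bigr => i _.
by rewrite !shE //; congr (_ / _); ring.
Qed.

Section Interlacing.

Variable la : young_diagram.

Local Notation m := (size la).
Local Notation lam := (nth 0%N la).

Let lam_gt0 a : (a < m)%N -> (0 < lam a)%N := @yd_gt0 la a.

Let lam_dec a : (lam a.+1 <= lam a)%N.
Proof. exact/yd_sorted. Qed.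

Let size_incr a : (a <= m)%N -> size (incr_nth la a) = maxn a.+1 m.
Proof. by move=> am; rewrite size_incr_nth; case: ltngtP => // *; lia. Qed.

Let addable0 : sorted geq (incr_nth la 0).
Proof.
apply/(sortedP 0%N) => i _; rewrite /= !nth_incr_nth /=.
by have := lam_dec i; case: i => [|i] /=; lia.
Qed.

Let addableS a : (a < m)%N -> sorted geq (incr_nth la a.+1) = (lam a.+1 < lam a)%N.
Proof.
move=> am; apply/(sortedP 0%N)/idP => [/(_ a)|lt i _].
  rewrite size_incr // => /(_ _); rewrite /= !nth_incr_nth eqxx add1n.
  by rewrite gtn_eqF //; apply; lia.
rewrite /= !nth_incr_nth; have := lam_dec i.
case: (a.+1 =P i.+1) => [[<-]|_]; first by rewrite gtn_eqF //=; lia.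
by case: (a.+1 =P i) => [<-|_]; rewrite /=; lia.
Qed.

Let removableE a : (a < m)%N ->
  sorted geq (set_nth 0%N la a (lam a).-1) = (lam a.+1 < lam a)%N.
Proof.
move=> am; have ga := lam_gt0 am; apply/(sortedP 0%N)/idP => [H|lt i _].
  have [lt|ge] := ltnP a.+1 m; last by rewrite (nth_default _ ge).
  have := H a; rewrite size_set_nth /= !nth_set_nth /= eqxx gtn_eqF //.
  by move=> /(_ _); rewrite leq_max lt orbT => /(_ isT); lia.
rewrite /= !nth_set_nth /=; have := lam_dec i.
case: (i =P a) => [-> _|ia].
  by rewrite gtn_eqF //; lia.
by case: eqP => [<-|_] //; lia.
Qed.

(** If rows [a] and [a.+1] have equal length, the end of row [a.+1] cancels the last content of row
    [a]; otherwise row [a] is removable and row [a.+1] addable. *)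
Lemma addable_removable_perm :
  perm_eq (addable_contents la ++ row_lasts la) (removable_contents la ++ row_ends la).
Proof.
pose f a : int := (lam a)%:Z - a%:Z.
pose g a : int := (lam a)%:Z - a.+1%:Z.
pose Q a := (lam a.+1 < lam a)%N.
have remE : removable_contents la = [seq g a | a <- iota 0 m & Q a].
  rewrite /removable_contents /removable_rows.
  have -> : [seq a <- iota 0 m | sorted geq (set_nth 0%N la a (lam a).-1)] = [seq a <- iota 0 m | Q a].
    by apply: eq_in_filter => a; rewrite mem_iota /= add0n => /removableE.
  apply/eq_in_map => a; rewrite mem_filter mem_iota add0n => /and3P[_ _ /lam_gt0].
  by rewrite /g; case: (lam a) => // u _; rewrite /= !intS; ring.
have addE : addable_contents la = f 0%N :: [seq f a.+1 | a <- iota 0 m & Q a].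
  rewrite /addable_contents /addable_rows -[m.+1]add1n iotaD filter_cat map_cat /= addable0 /=.
  congr (_ :: _); rewrite (iotaDl 1 0) filter_map -map_comp.
  congr map; apply: eq_in_filter => a; rewrite mem_iota /= add0n => am.
  exact: addableS.
have endsE : row_ends la = f 0%N :: [seq f a.+1 | a <- iota 0 m].
  rewrite /row_ends -[m.+1]add1n iotaD map_cat /=; congr (_ :: _).
  by rewrite (iotaDl 1 0) -map_comp.
have fg : [seq f a.+1 | a <- iota 0 m & predC Q a] = [seq g a | a <- iota 0 m & predC Q a].
  apply/eq_in_map => a; rewrite mem_filter /= -leqNgt => /andP[le _].
  by rewrite /f /g; congr (_%:Z - _); apply/eqP; rewrite eqn_leq le lam_dec.
rewrite addE remE endsE /row_lasts -/(map g _).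
have pF := perm_map (fun a => f a.+1) (permEl (perm_filterC Q (iota 0 m))).
have pG := perm_map g (permEl (perm_filterC Q (iota 0 m))).
rewrite !map_cat in pF pG; rewrite fg in pF.
set F := map _ (filter Q _) in pF *; set G := map g (filter Q _) in pG *.
set H := map g _ in pF pG; set Fa := map _ _ in pF *; set Ga := map g _ in pG *.
apply: (@perm_trans _ ((f 0%N :: F) ++ (G ++ H))); first by rewrite perm_cat2l perm_sym.
rewrite perm_catCA; apply: (@perm_trans _ (G ++ (f 0%N :: (F ++ H)))) => //.
by rewrite perm_cat2l perm_cons.
Qed.

End Interlacing.

(** * Free cumulants *)

Section CumulantSeries.

Variable A : comNzRingType.

Implicit Types (C D : {poly A}) (X Y : seq A).

Definition lin_prod C X : {poly A} := \prod_(x <- X) (C - x%:P * 'X).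

(* The truncations of the solution C = 1 + O(u) of                            *)
(* \prod_Y (C - y u) = \prod_X (C - x u) when |X| = |Y| + 1, i.e. of          *)
(* G(C(u) / u) = u for G(z) = \prod_Y (z - y) / \prod_X (z - x).              *)
Fixpoint cumulant_series X Y n : {poly A} :=
  if n is n'.+1 then
    let C := cumulant_series X Y n' in
    C + ((lin_prod C Y - lin_prod C X)`_n)%:P * 'X^n
  else 1.

Definition series_cumulant X Y n : A := (cumulant_series X Y n)`_n.

Lemma lin_prod_cat C X Y : lin_prod C (X ++ Y) = lin_prod C X * lin_prod C Y.
Proof. exact: big_cat. Qed.

Lemma lin_prod_perm C X Y : perm_eq X Y -> lin_prod C X = lin_prod C Y.
Proof. exact: perm_big. Qed.

Lemma coef0_lin_prod C X : C`_0 = 1 -> (lin_prod C X)`_0 = 1.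
Proof.
by move=> C0; apply: coef0_prod => x _; rewrite coefB C0 coefCM coefX mulr0 subr0.
Qed.

Lemma cumulant_series0 X Y n : (cumulant_series X Y n)`_0 = 1.
Proof.
by elim: n => [|n IH]; rewrite /= ?coef1 // coefD IH coefCM coefXn mulr0 addr0.
Qed.

Lemma coef0_split C : C`_0 = 1 -> exists u, C = 1 + 'X * u.
Proof.
move=> C0; have [|u ->] := @coef_eqX A 1 C 1; last by exists u; rewrite expr1.
by case=> // _; rewrite C0 coef1.
Qed.

(** All factors have constant term 1, so at order [n.+1] their perturbations just add up. *)
Lemma lin_prod_perturb C D X n c : C`_0 = 1 -> eqX n.+2 D (C + c%:P * 'X^(n.+1)) ->
  eqX n.+2 (lin_prod D X) (lin_prod C X + ((size X)%:R * c)%:P * 'X^(n.+1)).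
Proof.
move=> C0 DC; elim: X => [|x X IH].
  by rewrite /lin_prod !big_nil !mul0r addr0; apply: eqX_refl.
rewrite /lin_prod !big_cons -/(lin_prod _ _) -/(lin_prod _ _).
apply: eqX_trans (eqXM (eqXD DC (eqX_refl _ (- (x%:P * 'X)))) IH) _.
have [u uE] := coef0_split C0; have [v vE] := coef0_split (coef0_lin_prod X C0).
rewrite vE uE /= mulrS !polyCM polyCD polyC1; set k := (size X)%:R%:P.
exists (v * c%:P + (u - x%:P) * k * c%:P + k * c%:P * c%:P * 'X^n).
by rewrite !exprS; ring.
Qed.

(** As [X] has one element more than [Y], adding $cu^{n+1}$ to the series changes the difference of
    the two products by $-cu^{n+1}$ at that order; the recursion takes for [c] the coefficient to be
    removed. *)
Lemma cumulant_seriesP X Y n : size X = (size Y).+1 ->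
  eqX n.+1 (lin_prod (cumulant_series X Y n) Y) (lin_prod (cumulant_series X Y n) X).
Proof.
move=> sXY; elim: n => [|n IH] /=.
  by apply: coef_eqX => -[|//] _; rewrite !coef0_lin_prod ?coef1.
set C := cumulant_series X Y n in IH *; have C0 : C`_0 = 1 := cumulant_series0 X Y n.
set c := (lin_prod C Y - lin_prod C X)`_n.+1; have P Z := lin_prod_perturb Z C0 (eqX_refl n.+2 (C + c%:P * 'X^(n.+1))).
apply: eqX_trans (P Y) _; apply: eqX_trans _ (eqX_sym (P X)).
apply: coef_eqX => i; rewrite ltnS leq_eqVlt => /orP[/eqP ->|lt]; last first.
  by rewrite !coefD !coefCM !coefXn ltn_eqF // !mulr0 !addr0; apply: eqX_coef lt.
rewrite !coefD !coefCM !coefXn eqxx !mulr1 sXY /c coefB -natr1; ring.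
Qed.

Lemma cumulant_series_unique X Y n C : size X = (size Y).+1 -> C`_0 = 1 ->
  eqX n.+1 (lin_prod C Y) (lin_prod C X) -> eqX n.+1 C (cumulant_series X Y n).
Proof.
move=> sXY C0 HC; pose D := cumulant_series X Y n.
have D0 : D`_0 = 1 := cumulant_series0 X Y n.
have HD : eqX n.+1 (lin_prod D Y) (lin_prod D X) := cumulant_seriesP n sXY.
suff H i : (i <= n)%N -> eqX i.+1 C D by exact: H.
elim: i => [|i IH] lt.
  by apply: coef_eqX => -[|//] _; rewrite C0 D0.
have {}IH := IH (ltnW lt); pose c := C`_i.+1 - D`_i.+1.
have HcD : eqX i.+2 C (D + c%:P * 'X^(i.+1)).
  apply: coef_eqX => j; rewrite ltnS leq_eqVlt coefD coefCM coefXn => /orP[/eqP ->|ji].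
    by rewrite eqxx mulr1 /c addrC subrK.
  by rewrite ltn_eqF // mulr0 addr0; apply: eqX_coef ji.
have PX := eqX_coef (lin_prod_perturb X D0 HcD) (ltnSn _).
have PY := eqX_coef (lin_prod_perturb Y D0 HcD) (ltnSn _).
have := eqX_coef HC (lt : (i.+1 < n.+1)%N); rewrite PX PY.
rewrite !coefD !coefCM !coefXn eqxx !mulr1 (eqX_coef HD (lt : (i.+1 < n.+1)%N)) => /addrI.
rewrite sXY -natr1 mulrDl mul1r -{1}[_ * c]addr0 => /addrI c0.
by move: HcD; rewrite -c0 mul0r addr0.
Qed.

Lemma series_cumulant_unique X Y n C : size X = (size Y).+1 -> C`_0 = 1 ->
  eqX n.+1 (lin_prod C Y) (lin_prod C X) -> series_cumulant X Y n = C`_n.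
Proof. by move=> sXY C0 /(cumulant_series_unique sXY C0) /(eqX_coef) ->. Qed.

Lemma series_cumulant_equiv X Y X' Y' n : size X = (size Y).+1 ->
  perm_eq (X ++ Y') (X' ++ Y) -> series_cumulant X Y n = series_cumulant X' Y' n.
Proof.
move=> sXY XY; have sXY' : size X' = (size Y').+1.
  have := perm_size XY; rewrite !size_cat sXY addSnnS addnC => /eqP.
  by rewrite eqn_add2r => /eqP.
apply/esym/series_cumulant_unique => //; first exact: cumulant_series0.
set C := cumulant_series X Y n; have C0 : C`_0 = 1 := cumulant_series0 X Y n.
apply: (eqX_cancel (coef0_lin_prod X C0)); have := lin_prod_perm C XY; rewrite !lin_prod_cat => ->.
by rewrite mulrC; apply: eqXMr; apply: cumulant_seriesP.
Qed.

End CumulantSeries.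

Section Naturality.

Variables (A B : comNzRingType) (f : {rmorphism A -> B}).

Lemma map_lin_prod C X : map_poly f (lin_prod C X) = lin_prod (map_poly f C) (map f X).
Proof.
rewrite /lin_prod rmorph_prod big_map; apply: eq_bigr => x _.
by rewrite rmorphB rmorphM /= map_polyC map_polyX.
Qed.

Lemma map_cumulant_series X Y n :
  map_poly f (cumulant_series X Y n) = cumulant_series (map f X) (map f Y) n.
Proof.
elim: n => [|n IH] /=; first by rewrite rmorph1.
by rewrite rmorphD rmorphM /= map_polyC map_polyXn /= -IH -!map_lin_prod -rmorphB coef_map.
Qed.

Lemma rmorph_series_cumulant X Y n :
  f (series_cumulant X Y n) = series_cumulant (map f X) (map f Y) n.
Proof. by rewrite /series_cumulant -map_cumulant_series coef_map. Qed.

Lemma rmorph_shifted_residue k X Y :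
  f (shifted_residue k X Y) = shifted_residue k (map f X) (map f Y).
Proof.
rewrite /shifted_residue -coef_map rmorphM /= /shifted_lin !rmorph_prod.
apply: (congr1 (fun p : {poly B} => p`_k.+1)); congr (_ * _).
  apply: eq_bigr => i _; rewrite rmorph_prod big_map; apply: eq_bigr => x _.
  by rewrite rmorphB rmorphM rmorph1 /= map_polyC map_polyX /= rmorphD rmorph_nat.
apply: eq_bigr => i _; rewrite rmorph_prod big_map; apply: eq_bigr => y _ /=.
apply/polyP => j; rewrite coef_map !coef_poly /=; case: ifP => _; last exact: rmorph0.
by rewrite rmorphXn /= rmorphD rmorph_nat.
Qed.

End Naturality.

(** Clearing denominators in [is_free_cumulants] gives the equation of [cumulant_series] for
    $1+\sum_{i\le n}R_iu^i$, and the solution is unique. *)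
Lemma series_cumulant_free (la : young_diagram) n : (0 < n)%N ->
  free_cumulant la n =
  series_cumulant (map intr (addable_contents la)) (map intr (removable_contents la)) n.
Proof.
move=> n_gt0; set X := map _ _; set Y := map _ _; set R := free_cumulant la.
have sXY : size X = (size Y).+1 by rewrite [LHS]size_map size_addable_contents [in RHS]size_map.
pose C : {poly rat} := 1 + 'X * \poly_(i < n) R i.+1.
have C0 : C`_0 = 1 by rewrite coefD coef1 coefXM addr0.
rewrite (series_cumulant_unique sXY C0) => [|].
  by rewrite coefD coef1 coefXM coef_poly; case: n n_gt0 {C C0} => //= n _; rewrite ltnSn add0r.
pose w := ratfun_var; have w0 : w != 0 by rewrite tofrac_eq0 polyX_eq0.
have linE s : \prod_(x <- s) (truncated_inverse R n - x%:~R) =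
    tofrac (lin_prod C (map intr s)) / w ^+ size s.
  elim: s => [|x s IH]; first by rewrite /lin_prod !big_nil tofrac1 invr1 mulr1.
  rewrite /lin_prod /= !big_cons IH -/(lin_prod _ _) tofracM exprS invfM mulrACA.
  congr (_ * _); apply: (mulIf w0); rewrite mulfVK // mulrBl mulrDl mulVf //.
  rewrite tofracB tofracD tofrac1 !tofracM [_ * tofrac 'X]mulrC.
  by congr (_ + _ * _ - _ * _); rewrite /= !rmorph_int.
have [p [q [q0]]] := svalP (free_cumulants_exist la) n.
rewrite -/(free_cumulant la) -/R /cauchy_transform !linE.
have -> : size (removable_contents la) = size Y by rewrite [RHS]size_map.
have -> : size (addable_contents la) = (size Y).+1 by rewrite -sXY [RHS]size_map.
rewrite -/X -/Y.
have Q0 : tofrac (lin_prod C X) != 0.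
  by rewrite tofrac_eq0; apply: contra_eq_neq (coef0_lin_prod X C0) => ->; rewrite coef0 eq_sym oner_eq0.
have wY := expf_neq0 (size Y) w0.
have q1 : tofrac q != 0 by rewrite tofrac_eq0; apply: contraNneq q0 => ->; rewrite horner0.
have fracE (F : fieldType) (a b u v : F) : b != 0 -> v != 0 -> u != 0 ->
    a / u / (b / (v * u)) - v = v * (a - b) / b.
  by move=> b0 v0 u0; field; rewrite v0 u0 b0.
have crossE (F : fieldType) (a b d v g h : F) : b != 0 -> d != 0 -> v != 0 ->
    v * a / b = v * g * h / d -> a * d = g * h * b.
  move=> b0 d0 v0 /(congr1 (fun z => z * b * d / v)) E.
  have -> : a * d = v * a / b * b * d / v by field; rewrite b0 v0.
  by rewrite E; field; rewrite d0 v0.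
have -> : tofrac (lin_prod C Y) / w ^+ size Y / (tofrac (lin_prod C X) / w ^+ (size Y).+1) - w =
    w * (tofrac (lin_prod C Y) - tofrac (lin_prod C X)) / tofrac (lin_prod C X).
  rewrite exprS.
  exact: (@fracE ratfun (tofrac (lin_prod C Y)) (tofrac (lin_prod C X)) (w ^+ size Y) w Q0 w0 wY).
have -> : tofrac ('X^(n.+2) * p) = w * tofrac 'X^(n.+1) * tofrac p.
  by rewrite exprS !tofracM.
move=> E; have {}E : tofrac ((lin_prod C Y - lin_prod C X) * q) = tofrac ('X^(n.+1) * p * lin_prod C X).
  rewrite [LHS]tofracM tofracB [RHS]tofracM [tofrac (_ * p)]tofracM.
  exact: (@crossE ratfun (tofrac (lin_prod C Y) - tofrac (lin_prod C X)) (tofrac (lin_prod C X))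
    (tofrac q) w (tofrac 'X^(n.+1)) (tofrac p) Q0 q1 w0 E).
move/eqP: E; rewrite tofrac_eq => /eqP E.
rewrite horner_coef0 in q0.
have s0 : (((q`_0)^-1)%:P * q)`_0 = 1 by rewrite coefCM mulVf.
apply: (eqX_cancel s0); exists (((q`_0)^-1)%:P * (p * lin_prod C X)).
have -> : lin_prod C Y = lin_prod C X + (lin_prod C Y - lin_prod C X) by ring.
rewrite mulrDr -[_ * _ * (_ - _)]mulrA [q * (_ - _)]mulrC E; ring.
Qed.

(** * Multirectangular diagrams *)

Section Blocks.

Variable A : comNzRingType.

(* A multirectangular diagram: [s] lists, from the top, for each maximal      *)
(* block of equal rows, the number p of rows and the difference d with the    *)
(* length of the rows of the next block; P rows precede the first block.      *)
Fixpoint block_ends (P : A) (s : seq (A * A)) : seq A :=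
  if s is (p, d) :: s' then \sum_(pd <- s) pd.2 - P :: block_ends (P + p) s'
  else [:: - P].

Fixpoint block_lasts (P : A) (s : seq (A * A)) : seq A :=
  if s is (p, d) :: s' then \sum_(pd <- s) pd.2 - (P + p) :: block_lasts (P + p) s'
  else [::].

(** It vanishes when Kerov's identity holds, the residue being $-k\Sigma_k$. Commuting with ring
    morphisms ([rmorph_kerov_defect]), it can be treated as a polynomial in the side lengths. *)
Definition kerov_defect k (K : {mpoly int[k]}) (s : seq (A * A)) : A :=
  let X := block_ends 0 s in let Y := block_lasts 0 s in
  k%:R * mmap intr (fun i : 'I_k => series_cumulant X Y i.+2) K + shifted_residue k X Y.

End Blocks.

Definition map_pair (A B : Type) (f : A -> B) (u : A * A) : B * B := (f u.1, f u.2).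

Section BlocksNaturality.

Variables (A B : comNzRingType) (f : {rmorphism A -> B}).

Lemma map_block_ends P s : map f (block_ends P s) = block_ends (f P) (map (map_pair f) s).
Proof.
elim: s P => [|[p d] s IH] P /=; first by rewrite rmorphN.
rewrite IH rmorphB [f (P + p)]rmorphD rmorph_sum; congr (_ - _ :: _).
by rewrite -[_ :: map _ s]/(map (map_pair f) ((p, d) :: s)) big_map.
Qed.

Lemma map_block_lasts P s : map f (block_lasts P s) = block_lasts (f P) (map (map_pair f) s).
Proof.
elim: s P => [|[p d] s IH] P //=.
rewrite IH rmorphB [f (P + p)]rmorphD rmorph_sum; congr (_ - _ :: _).
by rewrite -[_ :: map _ s]/(map (map_pair f) ((p, d) :: s)) big_map.
Qed.

Lemma rmorph_kerov_defect k (K : {mpoly int[k]}) s :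
  f (kerov_defect K s) = kerov_defect K (map (map_pair f) s).
Proof.
rewrite /kerov_defect rmorphD rmorphM rmorph_nat rmorph_shifted_residue.
rewrite map_block_ends map_block_lasts rmorph0; congr (_ * _ + _).
rewrite /mmap rmorph_sum; apply: eq_bigr => u _.
rewrite rmorphM rmorph_int /mmap1 rmorph_prod; congr (_ * _); apply: eq_bigr => i _.
by rewrite rmorphXn /= rmorph_series_cumulant map_block_ends map_block_lasts rmorph0.
Qed.

End BlocksNaturality.

Section BlockDiagram.

Implicit Type t : seq (nat * nat).

Definition positive_blocks t : bool := all (fun pd => (0 < pd.1) && (0 < pd.2))%N t.

Fixpoint block_rows t : seq nat :=
  if t is (p, d) :: t' then nseq p (\sum_(pd <- t) pd.2)%N ++ block_rows t' else [::].

Lemma block_rowsP t : positive_blocks t ->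
  sorted geq (block_rows t) && (0 \notin block_rows t)%N.
Proof.
suff H : positive_blocks t -> sorted geq (block_rows t) /\
    all (fun r => 0 < r <= \sum_(pd <- t) pd.2)%N (block_rows t).
  move=> /H[-> /allP r0] /=; apply/negP => /r0; by rewrite ltnn.
elim: t => [|[p d] t IH] //= /andP[/andP[p0 d0] /IH[sr ar]].
rewrite !big_cons /=; set q := \sum_(pd <- t) pd.2 in ar *; split.
  have tr : transitive geq by move=> x y z /=; lia.
  rewrite sorted_pairwise // pairwise_cat -!sorted_pairwise // sr andbT.
  apply/andP; split.
    apply/allrelP => x y /nseqP[-> _] /(allP ar) /andP[_ yq] /=.
    by rewrite (leq_trans yq) // leq_addl.
  by elim: p {p0} => // -[|p] //= ->; rewrite leqnn.
rewrite all_cat; apply/andP; split.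
  by apply/allP => x /nseqP[-> _]; rewrite leqnn addn_gt0 d0.
apply/allP => x /(allP ar) /andP[-> xq] /=; exact: leq_trans (leq_addl _ _).
Qed.

Lemma size_block_rows t : positive_blocks t -> (size t <= sumn (block_rows t))%N.
Proof.
elim: t => [|[p d] t IH] //= /andP[/andP[/= p0 d0] /IH le].
rewrite sumn_cat sumn_nseq big_cons /=; nia.
Qed.

Definition block_diagram t (tP : positive_blocks t) : young_diagram :=
  YoungDiagram (block_rowsP tP).

Let ends P (r : seq nat) : seq int := [seq (nth 0%N r a)%:Z - (P + a)%N%:Z | a <- iota 0 (size r).+1].

Let lasts P (r : seq nat) : seq int := [seq (nth 0%N r a)%:Z - (P + a.+1)%N%:Z | a <- iota 0 (size r)].

Let ints t : seq (int * int) := map (map_pair Posz) t.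

(** Within a block, the end of each row but the first cancels the last content of the row above
    it. *)
Let perm_blocks P t : perm_eq (ends P (block_rows t) ++ block_lasts P%:Z (ints t))
  (block_ends P%:Z (ints t) ++ lasts P (block_rows t)).
Proof.
elim: t P => [|[p d] t IH] P /=.
  by rewrite /ends /lasts /= addn0 sub0r.
set q := (\sum_(pd <- (p, d) :: t) pd.2)%N.
have -> : \sum_(pd <- map_pair Posz (p, d) :: ints t) pd.2 = q%:Z.
  rewrite /q -[_ :: ints t]/(map (map_pair Posz) ((p, d) :: t)) big_map.
  by rewrite (big_morph Posz PoszD (erefl _)).
have := IH (P + p)%N; rewrite PoszD.
set r := block_rows t; set E := block_ends _ _; set L := block_lasts _ _ => {}IH.
have iotaS n : iota p n = map (addn p) (iota 0 n) by rewrite -iotaDl addn0.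
have endsE : ends P (nseq p q ++ r) = [seq q%:Z - (P + a)%N%:Z | a <- iota 0 p] ++ ends (P + p) r.
  rewrite /ends size_cat size_nseq -addnS iotaD map_cat add0n; congr (_ ++ _).
    by apply/eq_in_map => a; rewrite mem_iota add0n => /= ap; rewrite nth_cat size_nseq ap nth_nseq ap.
  rewrite iotaS -map_comp; apply: eq_map => a /=.
  by rewrite nth_cat size_nseq ltnNge leq_addr /= addKn addnA.
have lastsE : lasts P (nseq p q ++ r) = [seq q%:Z - (P + a.+1)%N%:Z | a <- iota 0 p] ++ lasts (P + p) r.
  rewrite /lasts size_cat size_nseq iotaD map_cat add0n; congr (_ ++ _).
    by apply/eq_in_map => a; rewrite mem_iota add0n => /= ap; rewrite nth_cat size_nseq ap nth_nseq ap.
  rewrite iotaS -map_comp; apply: eq_map => a /=.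
  by rewrite nth_cat size_nseq ltnNge leq_addr /= addKn -addnS addnA.
change (perm_eq (ends P (nseq p q ++ r) ++ (q%:Z - (P%:Z + p%:Z)) :: L)
  ((q%:Z - P%:Z) :: E ++ lasts P (nseq p q ++ r))).
rewrite endsE lastsE.
have tele : rcons [seq q%:Z - (P + a)%N%:Z | a <- iota 0 p] (q%:Z - (P%:Z + p%:Z)) =
    (q%:Z - P%:Z) :: [seq q%:Z - (P + a.+1)%N%:Z | a <- iota 0 p].
  rewrite -PoszD -(map_rcons (fun a => q%:Z - (P + a)%N%:Z)).
  have -> : rcons (iota 0 p) p = 0%N :: iota 1 p by rewrite -cats1 -(iotaD 0 p 1) addn1.
  by rewrite /= addn0; congr (_ :: _); rewrite (iotaDl 1 0) -map_comp.
move: tele; set U := map _ _; set V := map _ _ => tele.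
apply/seq.permP => a; move/seq.permP/(_ a): IH; move/(congr1 (count a)): tele.
rewrite -cats1 !count_cat /= !count_cat; lia.
Qed.

Lemma block_diagram_perm t (tP : positive_blocks t) :
  let la := block_diagram tP in
  perm_eq (row_ends la ++ block_lasts 0 (ints t)) (block_ends 0 (ints t) ++ row_lasts la).
Proof. exact: perm_blocks 0%N t. Qed.

End BlockDiagram.

Lemma poly_eq0_nat (p : {poly algC}) : (forall n, p.[n.+1%:R] = 0) -> p = 0.
Proof.
move=> H; apply: (@roots_geq_poly_eq0 _ p [seq i.+1%:R | i <- iota 0 (size p)]).
- by apply/allP => _ /mapP[i _ ->]; rewrite /root H.
- by rewrite map_inj_uniq ?iota_uniq // => i j /eqP; rewrite eqr_nat => /eqP[].
by rewrite size_map size_iota.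
Qed.

Section KerovIdentity.

Variables (k : nat) (K : {mpoly int[k]}).

Hypothesis k_gt0 : (0 < k)%N.

Hypothesis kerovK : is_kerov_polynomial K.

Let nats (t : seq (nat * nat)) : seq (algC * algC) := map (map_pair (fun n => n%:R)) t.

Let kerov_defect_nat t : positive_blocks t -> size t = k -> kerov_defect K (nats t) = 0.
Proof.
move=> tP st; pose la := block_diagram tP.
have kn : (0 < k <= yd_size la)%N by rewrite k_gt0 -st; apply: size_block_rows.
pose s : seq (int * int) := map (map_pair Posz) t.
have natsE : nats t = map (map_pair intr) s.
  by rewrite /nats /s -map_comp; apply: eq_map => -[p d]; rewrite /map_pair /= !pmulrn.
pose X : seq algC := map intr (block_ends 0 s); pose Y : seq algC := map intr (block_lasts 0 s).
have XE : block_ends 0 (nats t) = X by rewrite /X map_block_ends natsE rmorph0.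
have YE : block_lasts 0 (nats t) = Y by rewrite /Y map_block_lasts natsE rmorph0.
have p1 := addable_removable_perm la; have p2 := block_diagram_perm tP.
rewrite -/la -/s in p2.
have p3 : perm_eq (addable_contents la ++ block_lasts 0 s) (block_ends 0 s ++ removable_contents la).
  apply/seq.permP => a; move/seq.permP/(_ a): p1; move/seq.permP/(_ a): p2.
  by rewrite !count_cat; lia.
rewrite /kerov_defect XE YE.
have -> : shifted_residue k X Y = - k%:R * normalized_character k la.
  rewrite -residue_normalized_character //; apply/esym/shifted_residue_equiv.
  by rewrite -!map_cat; apply: perm_map.
rewrite (kerovK (la := la)); last by case/andP: kn.
rewrite mulNr; apply/eqP; rewrite subr_eq0; apply/eqP; congr (_ * _).
rewrite /mmap; apply: eq_bigr => u _; congr (_ * _); apply: mmap1_eq => i.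
rewrite series_cumulant_free // rmorph_series_cumulant.
have ratr_map (r : seq int) : map (ratr : rat -> algC) (map intr r) = map intr r.
  by rewrite -map_comp; apply: eq_map => x; rewrite /= ratr_int.
rewrite !ratr_map; apply/esym/series_cumulant_equiv.
  by rewrite [LHS]size_map size_addable_contents [in RHS]size_map.
by rewrite -!map_cat; apply: perm_map.
Qed.

Let continue_coord (s1 s2 : seq (algC * algC)) (u : {poly algC} -> {poly algC} * {poly algC}) :
  (forall n, kerov_defect K (s1 ++ map_pair (horner_eval n.+1%:R) (u 'X) :: s2) = 0) ->
  forall x, kerov_defect K (s1 ++ map_pair (horner_eval x) (u 'X) :: s2) = 0.
Proof.
move=> H.
pose lift := map (map_pair (polyC : algC -> {poly algC})).
pose Q := kerov_defect K (lift s1 ++ u 'X :: lift s2).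
have QE x : Q.[x] = kerov_defect K (s1 ++ map_pair (horner_eval x) (u 'X) :: s2).
  rewrite -[LHS]/(horner_eval x Q) rmorph_kerov_defect map_cat /= /lift -!map_comp.
  have liftK r : map (map_pair (horner_eval x) \o map_pair (polyC : algC -> {poly algC})) r = r.
    by rewrite -[RHS]map_id; apply: eq_map => -[a b]; rewrite /map_pair /= /horner_eval !hornerC.
  by rewrite !liftK.
have Q0 : Q = 0 by apply: poly_eq0_nat => n; rewrite QE.
by move=> x; rewrite -QE Q0 horner0.
Qed.

(** For positive integers, [k] blocks form a diagram with at least [k] boxes. A polynomial that
    vanishes at all positive integers is zero, so the side lengths become complex one at a time. *)
Lemma kerov_defect_eq0 (s : seq (algC * algC)) : size s = k -> kerov_defect K s = 0.
Proof.
suff H (s1 : seq (algC * algC)) t : positive_blocks t -> (size s1 + size t)%N = k ->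
    kerov_defect K (s1 ++ nats t) = 0.
  by move=> sk; rewrite -[s]cats0; apply: (H s [::]); rewrite ?addn0.
elim/last_ind: s1 t => [|s1 [p d] IH] t tP; first exact: kerov_defect_nat.
rewrite size_rcons => st; rewrite cat_rcons.
have IHn (a b : nat) : kerov_defect K (s1 ++ (a.+1%:R, b.+1%:R) :: nats t) = 0.
  by apply: (IH ((a.+1, b.+1) :: t)) => //=; lia.
have IHp (x : algC) b : kerov_defect K (s1 ++ (x, b.+1%:R) :: nats t) = 0.
  have := @continue_coord s1 (nats t) (fun X => (X, (b.+1%:R)%:P)) _ x.
  rewrite /map_pair /= /horner_eval hornerX hornerC; apply => a.
  by rewrite hornerX hornerC.
have := @continue_coord s1 (nats t) (fun X => (p%:P, X)) _ d.
rewrite /map_pair /= /horner_eval hornerX hornerC; apply => b.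
by rewrite hornerX hornerC.
Qed.

End KerovIdentity.

(** * Realizing arbitrary cumulants *)

Section ZeroLasts.

Variable A : comNzRingType.

(** Formal side lengths with all [block_lasts] zero. For [P] zero the [block_ends] are [xs] and
    minus its sum, so with [k] entries $z^kH(z)$ is an arbitrary monic polynomial of degree $k+1$
    with root sum zero. *)
Fixpoint flat_blocks (P : A) (xs : seq A) : seq (A * A) :=
  if xs is x :: xs' then
    (x, P + x - (if xs' is y :: _ then P + x + y else 0)) :: flat_blocks (P + x) xs'
  else [::].

Lemma sum_flat_blocks P x xs : \sum_(pd <- flat_blocks P (x :: xs)) pd.2 = P + x.
Proof.
elim: xs x P => [|y xs IH] x P; first by rewrite big_seq1 /= subr0.
rewrite -[flat_blocks _ _]/((x, P + x - (P + x + y)) :: flat_blocks (P + x) (y :: xs)).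
by rewrite big_cons IH /= subrK.
Qed.

Lemma size_flat_blocks P xs : size (flat_blocks P xs) = size xs.
Proof. by elim: xs P => [|x xs IH] P //=; rewrite IH. Qed.

Lemma block_ends_flat P xs :
  block_ends P (flat_blocks P xs) = rcons xs (- (P + \sum_(x <- xs) x)).
Proof.
elim: xs P => [|x xs IH] P; first by rewrite /= big_nil addr0.
have := sum_flat_blocks P x xs; rewrite /= => ->; rewrite IH big_cons addrA.
by have -> : P + x - P = x by ring.
Qed.

Lemma block_lasts_flat P xs : block_lasts P (flat_blocks P xs) = nseq (size xs) 0.
Proof.
elim: xs P => [|x xs IH] P //.
by have := sum_flat_blocks P x xs; rewrite /= => ->; rewrite IH subrr.
Qed.

Lemma sum_poly_substitution (V T : {poly A}) N : V`_0 = 1 ->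
  exists a : nat -> A, eqX N.+1 (\sum_(j < N.+1) (a j)%:P * ('X * V) ^+ j) T.
Proof.
move=> V0; elim: N => [|N [a Ha]].
  exists (fun=> T`_0); apply: coef_eqX => -[|//] _.
  by rewrite big_ord_recl big_ord0 addr0 expr0 mulr1 coefC.
pose S := \sum_(j < N.+1) (a j)%:P * ('X * V) ^+ j.
exists (fun j => if j == N.+1 then T`_N.+1 - S`_N.+1 else a j).
rewrite big_ord_recr /= eqxx.
under eq_bigr => j _ do rewrite ltn_eqF ?ltnS ?leq_ord //.
rewrite -/S; apply: coef_eqX => i; rewrite ltnS leq_eqVlt => /orP[/eqP ->|lt].
  rewrite coefD coefCM exprMn coefXnM ltnn subnn -!horner_coef0 horner_exp horner_coef0 V0 expr1n mulr1.
  by rewrite addrC subrK.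
rewrite coefD coefCM exprMn coefXnM lt mulr0 addr0.
exact: eqX_coef Ha lt.
Qed.

Lemma homogenize_prod (R : comNzRingType) (f : {rmorphism A -> R}) (c t : R) (r : seq A) :
  \prod_(z <- r) (c - f z * t) =
  \sum_(j < (size r).+1) f (\prod_(z <- r) ('X - z%:P))`_j * c ^+ j * t ^+ (size r - j).
Proof.
elim: r => [|z r IH].
  by rewrite !big_nil big_ord_recl big_ord0 coef1 rmorph1 !expr0 !mulr1 addr0.
rewrite big_cons IH big_cons; set q := \prod_(z <- r) _; set n := size r.
have sq : size q = n.+1 by rewrite /q size_prod_XsubC.
transitivity (\sum_(j < n.+2) (f ('X * q)`_j * c ^+ j * t ^+ (n.+1 - j)) -
   \sum_(j < n.+2) f (z * q`_j) * c ^+ j * t ^+ (n.+1 - j)); last first.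
  rewrite -sumrB; apply: eq_bigr => j _.
  by rewrite mulrBl coefB coefCM rmorphB !mulrBl.
rewrite mulrBl; congr (_ - _).
  rewrite [RHS]big_ord_recl coefXM /= rmorph0 !mul0r add0r mulr_sumr; apply: eq_bigr => j _.
  by rewrite coefXM /= subSS exprS; ring.
rewrite [RHS]big_ord_recr /= [q`_n.+1]nth_default ?sq // mulr0 rmorph0 !mul0r addr0 mulr_sumr.
apply: eq_bigr => j _; rewrite rmorphM subSn ?leq_ord // exprS; ring.
Qed.

End ZeroLasts.

(** With $V=1/C$ and $t=uV$, the $a_j$ are the coefficients of $\eta$ such that $\eta(t)=V$. As
    $z=C(u)/u=1/t$, this says $H(z)=1/u=z\,\eta(1/z)$. *)
Lemma exists_poly_substitution (A : comNzRingType) k (C : {poly A}) :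
  C`_0 = 1 -> C`_1 = 0 ->
  exists (V : {poly A}) (a : nat -> A), [/\ V`_0 = 1, eqX k.+2 (V * C) 1, a 0%N = 1, a 1%N = 0 &
    eqX k.+2 (\sum_(j < k.+2) (a j)%:P * ('X * V) ^+ j) V].
Proof.
move=> C0 C1; have [V V0 VC] := eqX_inv k.+2 C0.
have [a Ha] := sum_poly_substitution V k.+1 V0.
exists V, a; split=> //.
  have := eqX_coef Ha (ltn0Sn k.+1); rewrite V0 => <-.
  rewrite coef_sum big_ord_recl big1 => [|j _]; first by rewrite expr0 mulr1 coefC addr0.
  by rewrite coefCM exprMn coefXnM mulr0.
have V1 : V`_1 = 0.
  have /eqX_coef/(_ (isT : (1 < k.+2)%N)) := VC.
  by rewrite coefM big_ord_recl big_ord_recl big_ord0 /= C1 mulr0 add0r addr0 /bump /= C0 mulr1 coef1.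
have /eqX_coef/(_ (isT : (1 < k.+2)%N)) := Ha.
rewrite V1 coef_sum big_ord_recl big_ord_recl big1 => [|j _].
  by rewrite expr0 mulr1 coefC add0r addr0 expr1 coefCM coefXM /= V0 mulr1.
by rewrite coefCM exprMn coefXnM /= mulr0.
Qed.

Section KerovHomogeneous.

Variables (k : nat) (K : {mpoly int[k]}).

Hypothesis k_gt0 : (0 < k)%N.

Hypothesis kerovK : is_kerov_polynomial K.

(** The roots of $\sum_ja_jz^{k+1-j}$, of sum $-a_1=0$, are the [block_ends] of a [flat_blocks]. The
    hypothesis on [C] then says $\prod_x(C-xu)=C^k$, the cumulant equation for [k] lasts equal to
    zero. *)
Lemma kerov_homogeneous (a : nat -> algC) (C : {poly algC}) :
  a 0%N = 1 -> a 1%N = 0 -> C`_0 = 1 ->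
  eqX k.+2 (\sum_(j < k.+2) (a j)%:P * 'X^j * C ^+ (k.+1 - j)) (C ^+ k) ->
  k%:R * mmap intr (fun i : 'I_k => C`_i.+2) K =
  - (\prod_(i < k) ((\sum_(j < k.+2) (a j)%:P * 'X^j * (1 - (i%:R)%:P * 'X) ^+ (k.+1 - j))
     * geom k.+1 i%:R ^+ k))`_k.+1.
Proof.
move=> a0 a1 C0 HC; pose p : {poly algC} := \poly_(j < k.+2) a (k.+1 - j)%N.
have szp : size p = k.+2 by rewrite size_poly_eq //= subnn a0 oner_eq0.
have pm : p \is monic by rewrite monicE lead_coefE szp coef_poly ltnSn subnn a0.
have [r pE] := closed_field_poly_normal p; rewrite (monicP pm) scale1r in pE.
have sr : size r = k.+1 by have := szp; rewrite pE size_prod_XsubC => -[].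
have linE (c t : {poly algC}) : \prod_(z <- r) (c - z%:P * t) =
    \sum_(j < k.+2) (a j)%:P * t ^+ j * c ^+ (k.+1 - j).
  rewrite (homogenize_prod (polyC : {rmorphism algC -> {poly algC}})) -pE sr.
  rewrite [RHS](reindex_inj rev_ord_inj) /=; apply: eq_bigr => j _.
  by rewrite subSS coef_poly ltn_ord (subKn (leq_ord j)) mulrAC.
have sum_r : \sum_(z <- r) z = 0.
  have : p`_k = 0 by rewrite coef_poly leqnSn subSnn a1.
  rewrite pE; have -> : k = (size r).-1 by rewrite sr.
  by rewrite coefPn_prod_XsubC ?sr // => /eqP; rewrite oppr_eq0 => /eqP.
case/lastP: r => [//|xs z] in pE sr linE sum_r *.
have sxs : size xs = k by move: sr; rewrite size_rcons => -[].
have zE : z = - (0 + \sum_(x <- xs) x).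
  by move/eqP: sum_r; rewrite -cats1 big_cat big_seq1 /= addrC addr_eq0 add0r => /eqP.
have := kerov_defect_eq0 k_gt0 kerovK (s := flat_blocks 0 xs).
rewrite size_flat_blocks => /(_ sxs); rewrite /kerov_defect /=.
rewrite block_ends_flat block_lasts_flat sxs -zE.
set X := rcons xs z; set Y := nseq k 0; move=> /eqP; rewrite addr_eq0 => /eqP.
have prod_nseq (B : comNzRingType) (g : algC -> B) : \prod_(y <- Y) g y = g 0 ^+ k.
  by rewrite big_nseq; elim: (k) => //= n ->; rewrite exprS.
have cumE (i : 'I_k) : series_cumulant X Y i.+2 = C`_i.+2.
  apply: series_cumulant_unique => //; first by rewrite size_rcons size_nseq sxs.
  have le : (i.+3 <= k.+2)%N by rewrite !ltnS.
  apply: (eqX_leq le); apply: eqX_sym; rewrite /lin_prod linE prod_nseq.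
  by rewrite mul0r subr0.
have -> : mmap intr (fun i : 'I_k => series_cumulant X Y i.+2) K =
    mmap intr (fun i : 'I_k => C`_i.+2) K.
  by apply: eq_bigr => u _; congr (_ * _); apply: mmap1_eq => i; apply: cumE.
move=> ->; congr (- _); rewrite /shifted_residue /shifted_lin -big_split /=.
apply: (congr1 (fun q : {poly algC} => q`_k.+1)); apply: eq_bigr => i _.
rewrite prod_nseq add0r -linE; congr (_ * _); apply: eq_bigr => x _.
by rewrite polyCD; ring.
Qed.

End KerovHomogeneous.

(** * The terms of weight k - 1 *)

Section SecondOrder.

Variable B : comNzRingType.

(** At order 2 one takes [h2] from one factor or [h1] from two, and $\sum_{i<j}ij=\sum_jj\binom
    j2$. *)
Lemma eqX3_prod (g : nat -> {poly B}) (h0 h1 h2 : B) n :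
  (forall i, eqX 3 (g i) (h0%:P + (i%:R * h1)%:P * 'X + (i%:R ^+ 2 * h2)%:P * 'X^2)) ->
  eqX 3 (\prod_(i < n.+2) g i) ((h0 ^+ n.+2)%:P + ('C(n.+2, 2)%:R * h1 * h0 ^+ n.+1)%:P * 'X +
    ((\sum_(i < n.+2) i ^ 2)%N%:R * h2 * h0 ^+ n.+1
     + (\sum_(i < n.+2) i * 'C(i, 2))%N%:R * h1 ^+ 2 * h0 ^+ n)%:P * 'X^2).
Proof.
move=> Hg; elim: n => [|n IH].
  rewrite !big_ord_recl !big_ord0 mulr1; apply: eqX_trans (eqXM (Hg _) (Hg _)) _.
  rewrite /= /bump /= !(mul0n, mul1n, add0n, addn0) !mul0r !expr0n !mul0r !addr0 binn /=.
  by rewrite !(mul1r, mul0r, expr1n, expr1, expr0, add0r, addr0, mulr1, polyC0, polyCM, expr2); exists 0; ring.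
rewrite big_ord_recr /=; apply: eqX_trans (eqXM IH (Hg _)) _.
have -> : (\sum_(i < n.+3) i ^ 2 = \sum_(i < n.+2) i ^ 2 + n.+2 ^ 2)%N by rewrite big_ord_recr.
have -> : (\sum_(i < n.+3) i * 'C(i, 2) = \sum_(i < n.+2) i * 'C(i, 2) + n.+2 * 'C(n.+2, 2))%N.
  by rewrite big_ord_recr.
have -> : 'C(n.+3, 2)%:R = 'C(n.+2, 2)%:R + n.+2%:R :> B by rewrite (binS n.+2) bin1 natrD.
rewrite natrD [(_ + _ * _)%:R]natrD natrX natrM.
move: ((\sum_(i < n.+2) i ^ 2)%N%:R) ((\sum_(i < n.+2) i * 'C(i, 2))%N%:R) 'C(n.+2, 2)%:R n.+2%:R.
move=> s e c i; rewrite !exprS expr0 !mulr1.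
rewrite !(polyCM, polyCD) -![_ ^+ n]/(h0 ^+ n); move: (h0 ^+ n)%:P h0%:P h1%:P h2%:P c%:P i%:P s%:P e%:P.
move=> H H0 H1 H2 Cc Ci Cs Ce.
exists (Cc * H1 * (H0 * H) * (Ci * Ci * H2) + (Cs * H2 * (H0 * H) + Ce * (H1 * H1) * H) * (Ci * H1)
  + (Cs * H2 * (H0 * H) + Ce * (H1 * H1) * H) * (Ci * Ci * H2) * 'X).
ring.
Qed.

Lemma eqX3_geom N (y : B) : (1 < N)%N -> eqX 3 (geom N y) (1 + y%:P * 'X + (y ^+ 2)%:P * 'X^2).
Proof.
move=> N1; apply: coef_eqX => i i3; rewrite coef_poly !coefD !coefCM coef1 coefX coefXn.
have -> : (i < N.+1)%N by lia.
by case: i i3 => [|[|[|]]] // _; rewrite ?expr0 ?expr1 !(mulr0, mulr1, addr0, add0r).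
Qed.

Lemma eqX3_inv_power N (y : B) j : (1 < N)%N ->
  eqX 3 (geom N y ^+ j) (1 + (j%:R * y)%:P * 'X + ('C(j.+1, 2)%:R * y ^+ 2)%:P * 'X^2).
Proof.
move=> N1; elim: j => [|j IH].
  by rewrite expr0 bin_small // !mulr0n !mul0r !addr0; apply: eqX_refl.
rewrite exprS; apply: eqX_trans (eqXM (eqX3_geom y N1) IH) _.
have -> : 'C(j.+2, 2)%:R = 'C(j.+1, 2)%:R + (j%:R + 1) :> B by rewrite binS bin1 natrD natr1.
rewrite -[j.+1%:R]natr1; move: (j%:R) ('C(_, _)%:R) => J b.
rewrite !expr2 !(polyCM, polyCD) polyC1; move: J%:P b%:P y%:P => {}J {}b Y.
exists (Y * (b * (Y * Y)) + Y * Y * (J * Y) + Y * Y * (b * (Y * Y)) * 'X); ring.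
Qed.

(** The left side is $\sum_jb_j(1-yX)^{1-j}$, expanded by the binomial series. *)
Lemma eqX3_factor k (b : nat -> B) (y : B) : (0 < k)%N ->
  eqX 3 ((\sum_(j < k.+2) (b j)%:P * (1 - y%:P * 'X) ^+ (k.+1 - j)) * geom k.+1 y ^+ k)
    ((\sum_(j < k.+2) b j)%:P + (y * \sum_(j < k.+2) (j%:R - 1) * b j)%:P * 'X
     + (y ^+ 2 * \sum_(j < k.+2) 'C(j, 2)%:R * b j)%:P * 'X^2).
Proof.
move=> k0; have k1 : (1 < k.+1)%N by [].
have inv : eqX 3 ((1 - y%:P * 'X) * geom k.+1 y) 1.
  by rewrite mulrC; apply: eqX_leq (geom_eqX _ _).
rewrite mulr_suml !mulr_sumr !rmorph_sum /= !mulr_suml -!big_split /=; apply: eqX_sum => j _.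
have -> : (b j)%:P + (y * ((j%:R - 1) * b j))%:P * 'X + (y ^+ 2 * ('C(j, 2)%:R * b j))%:P * 'X^2
   = (b j)%:P * (1 + ((j%:R - 1) * y)%:P * 'X + ('C(j, 2)%:R * y ^+ 2)%:P * 'X^2).
  by rewrite !polyCM; ring.
rewrite -mulrA; apply: eqXMl; case: j => -[|j] /= jk.
  rewrite subn0 exprS -mulrA -exprMn mul0r polyC0 mul0r addr0 sub0r mulN1r polyCN mulNr.
  by rewrite -[X in eqX _ _ X]mulr1; apply: eqXMl; rewrite -[X in eqX _ _ X](expr1n _ k); apply: eqX_exp.
rewrite subSS -natr1 addrK.
apply: eqX_trans _ (eqX3_inv_power y j k1).
have -> : geom k.+1 y ^+ k = geom k.+1 y ^+ (k - j) * geom k.+1 y ^+ j.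
  by rewrite -exprD subnK.
rewrite mulrA -exprMn -[X in eqX _ _ X]mul1r; apply: eqXMr.
by rewrite -[X in eqX _ _ X](expr1n _ (k - j)); apply: eqX_exp.
Qed.

End SecondOrder.

Section Scaling.

Variable A : comNzRingType.

Implicit Types (p q : {poly A}) (s : A).

Lemma coef_comp_scale p s i : (p \Po (s *: 'X))`_i = s ^+ i * p`_i.
Proof.
rewrite comp_polyE coef_sum; have [lt|ge] := ltnP i (size p).
  rewrite (bigD1 (Ordinal lt)) //= exprZn !coefZ coefXn eqxx mulr1 big1 ?addr0 1?mulrC // => j ne.
  by rewrite exprZn !coefZ coefXn eq_sym -val_eqE in ne *; rewrite (negPf ne) !mulr0.
rewrite big1 => [|j _]; first by rewrite nth_default // mulr0.
by rewrite exprZn !coefZ coefXn gtn_eqF ?mulr0 //; apply: leq_trans ge.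
Qed.

Lemma eqX_comp_scale N p q s : eqX N p q -> eqX N (p \Po (s *: 'X)) (q \Po (s *: 'X)).
Proof.
case=> r ->; exists ((s ^+ N)%:P * (r \Po (s *: 'X))).
rewrite comp_polyD comp_polyM comp_Xn_poly exprZn -(mul_polyC (s ^+ N)); ring.
Qed.

Lemma geom_comp_scale N y s : geom N y \Po (s *: 'X) = geom N (s * y).
Proof.
apply/polyP => i; rewrite coef_comp_scale !coef_poly; case: ifP => _; last by rewrite mulr0.
by rewrite exprMn.
Qed.

End Scaling.

Definition cumulant_weight k (m : 'X_{1..k}) : nat := \sum_(i < k) i.+2 * m i.

Section SubleadingTerm.

Variables (n : nat) (K : {mpoly int[n.+2]}).

Local Notation k := n.+2.

Hypothesis kerovK : is_kerov_polynomial K.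

Variables (a : nat -> algC) (C V : {poly algC}).

Hypotheses (a0 : a 0%N = 1) (a1 : a 1%N = 0) (C0 : C`_0 = 1).

Hypothesis VC : eqX k.+2 (V * C) 1.

Hypothesis aV : eqX k.+2 (\sum_(j < k.+2) (a j)%:P * ('X * V) ^+ j) V.

Let R (i : 'I_k) := C`_i.+2.

Let rel : eqX k.+2 (\sum_(j < k.+2) (a j)%:P * 'X^j * C ^+ (k.+1 - j)) (C ^+ k).
Proof.
have VCe j : eqX k.+2 (V ^+ j * C ^+ j) 1.
  by rewrite -exprMn -[X in eqX _ _ X](expr1n _ j); apply: eqX_exp.
apply: (@eqX_trans _ _ _ (V * C ^+ k.+1)); last first.
  by rewrite exprS mulrA -[X in eqX _ _ X]mul1r; apply: eqXMr.
apply: eqX_trans _ (eqXMr (C ^+ k.+1) aV).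
have E N (c u v D D' : {poly algC}) : eqX N (v * D) D' -> eqX N (c * (u * v) * D) (c * u * D').
  move=> H; have -> : c * (u * v) * D = c * u * (v * D) by ring.
  exact: eqXMl.
rewrite mulr_suml; apply: eqX_sum => j _; apply: eqX_sym; rewrite exprMn; apply: E.
have -> : C ^+ k.+1 = C ^+ j * C ^+ (k.+1 - j) by rewrite -exprD subnKC ?leq_ord.
rewrite mulrA -[X in eqX _ _ X]mul1r.
exact: eqXMr.
Qed.

Let prod_eps (e : algC) : {poly algC} :=
  \prod_(i < k) ((\sum_(j < k.+2) (a j)%:P * 'X^j * (1 - (i%:R * e)%:P * 'X) ^+ (k.+1 - j))
     * geom k.+1 (i%:R * e) ^+ k).

Let term (m : 'X_{1..k}) : algC := (K@_m)%:~R * \prod_i R i ^+ m i.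

(** Apply [kerov_homogeneous] to $s^ja_j$ and $C(su)$ with $s=1/\varepsilon$: a monomial of [K] is
    multiplied by [s] to its weight, while on the right the substitution $u\mapsto su$ trades the
    scaling for shifts by $i\varepsilon$. *)
Let kerov_scaled (e : algC) : e != 0 ->
  k%:R * \sum_(m <- msupp K) term m * e^-1 ^+ cumulant_weight m =
  - (e^-1 ^+ k.+1 * (prod_eps e)`_k.+1).
Proof.
move=> e0; pose s := e^-1; pose sub (p : {poly algC}) := p \Po (s *: 'X).
have se : s * e = 1 by rewrite mulVf.
have subX : sub 'X = s%:P * 'X by rewrite /sub comp_polyX mul_polyC.
have subM p q : sub (p * q) = sub p * sub q by apply: comp_polyM.
have subXn p j : sub (p ^+ j) = sub p ^+ j by apply: rmorphXn.
have subC c : sub c%:P = c%:P by apply: comp_polyC.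
have sub_sum (I : Type) (r : seq I) (P : pred I) (f : I -> {poly algC}) : sub (\sum_(i <- r | P i) f i) = \sum_(i <- r | P i) sub (f i).
  by apply: rmorph_sum.
have sub_lin c : sub (1 - c%:P * 'X) = 1 - (c * s)%:P * 'X.
  by rewrite /sub comp_polyB -/sub -!/(sub _) subM subX -polyC1 !subC polyCM mulrA.
have ie (i : nat) : s * (i%:R * e) = i%:R by rewrite mulrCA se mulr1.
have ie' (i : nat) : i%:R * e * s = i%:R by rewrite -mulrA [e * s]mulrC se mulr1.
have HC : eqX k.+2 (\sum_(j < k.+2) (a j * s ^+ j)%:P * 'X^j * (sub C) ^+ (k.+1 - j)) (sub C ^+ k).
  have := eqX_comp_scale s rel; rewrite -!/(sub _) subXn sub_sum.
  under eq_bigr => j _ do rewrite !subM !subXn subC subX exprMn -polyC_exp mulrA -polyCM.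
  by [].
have as0 : a 0%N * s ^+ 0 = 1 by rewrite a0 mulr1.
have as1 : a 1%N * s ^+ 1 = 0 by rewrite a1 mul0r.
have sC0 : (sub C)`_0 = 1 by rewrite coef_comp_scale expr0 mul1r.
have := kerov_homogeneous (a := fun j => a j * s ^+ j) (isT : (0 < k)%N) kerovK as0 as1 sC0 HC.
have -> : mmap intr (fun i : 'I_k => (sub C)`_i.+2) K =
    \sum_(m <- msupp K) term m * s ^+ cumulant_weight m.
  apply: eq_bigr => m _; rewrite /term -mulrA; congr (_ * _).
  rewrite /mmap1 /cumulant_weight expr_sum -big_split /=.
  by apply: eq_bigr => i _; rewrite coef_comp_scale exprMn -exprM mulrC.
move=> ->; congr (- _); rewrite -coef_comp_scale -/(sub _) /prod_eps.
rewrite [in RHS]/sub rmorph_prod /=; apply: (congr1 (fun p : {poly algC} => p`_k.+1)).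
apply: eq_bigr => i _; rewrite -/(sub _) subM subXn [sub (geom _ _)]geom_comp_scale ie.
congr (_ * _); rewrite sub_sum; apply: eq_bigr => j _.
by rewrite !subM !subXn subC subX sub_lin ie' exprMn -polyC_exp mulrA -polyCM.
Qed.

Let b (j : nat) : {poly algC} := (a j)%:P * 'X^j.

Let y (i : nat) : {poly algC} := i%:R * 'X.

(** The factors of [prod_eps] with $\varepsilon$ formal: it is the outer variable, and $u$ is the
    inner one. *)
Let factor (i : nat) : {poly {poly algC}} :=
  (\sum_(j < k.+2) (b j)%:P * (1 - (y i)%:P * 'X) ^+ (k.+1 - j)) * geom k.+1 (y i) ^+ k.

Let prod_epsE e : prod_eps e = (\prod_(i < k) factor i).[e%:P].
Proof.
rewrite horner_prod; apply: eq_bigr => i _; rewrite hornerM horner_exp horner_sum.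
congr (_ * _ ^+ _).
  apply: eq_bigr => j _; rewrite hornerM hornerC horner_exp /b; congr (_ * _ ^+ _).
  by rewrite hornerD hornerN hornerM hornerX !hornerC /y polyCM polyC_natr; ring.
rewrite /geom horner_poly poly_def; apply: eq_bigr => u _.
by rewrite -mul_polyC polyC_exp polyCM polyC_natr /y -!exprMn; congr (_ ^+ _); ring.
Qed.

Let coef_poly_eps : {poly algC} :=
  \poly_(u < size (\prod_(i < k) factor i)) ((\prod_(i < k) factor i)`_u)`_k.+1.

Let coef_prod_eps e : (prod_eps e)`_k.+1 = coef_poly_eps.[e].
Proof.
rewrite prod_epsE horner_coef coef_sum horner_poly; apply: eq_bigr => u _.
by rewrite -polyC_exp coefMC.
Qed.

Let h0 : {poly algC} := \sum_(j < k.+2) b j.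
Let h1 : {poly algC} := \sum_(j < k.+2) (j%:R - 1) * b j.
Let h2 : {poly algC} := \sum_(j < k.+2) 'C(j, 2)%:R * b j.

(** In [kerov_scaled], weight $k-1$ belongs to $\varepsilon^2$ in the coefficient of $u^{k+1}$.
    Since $\varepsilon$ occurs only in $i\varepsilon u$, the second order brings out $u^2$ and
    leaves the coefficient of $u^{k-1}$. *)
Lemma kerov_subleading :
  k%:R * \sum_(m <- msupp K | cumulant_weight m == n.+1) (K@_m)%:~R * \prod_(i < k) C`_i.+2 ^+ m i =
  - ((\sum_(i < k) i ^ 2)%N%:R * (h2 * h0 ^+ n.+1)`_n.+1
     + (\sum_(i < k) i * 'C(i, 2))%N%:R * (h1 ^+ 2 * h0 ^+ n)`_n.+1).
Proof.
pose M := (\sum_(m <- msupp K) cumulant_weight m)%N.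
have wM m : m \in msupp K -> (cumulant_weight m <= M)%N.
  by move=> mK; rewrite /M (big_rem m) //= leq_addr.
(* Multiplication by $\varepsilon^{M+k+1}$ clears the negative powers, and agreement at all positive
   integers makes it an identity of polynomials in $\varepsilon$. *)
have E : k%:R *: (\sum_(m <- msupp K) (term m)%:P * 'X^(M + k.+1 - cumulant_weight m)) =
    - ('X^M * coef_poly_eps).
  apply/eqP; rewrite -subr_eq0; apply/eqP/poly_eq0_nat => N; set e := N.+1%:R.
  have e0 : e != 0 by rewrite pnatr_eq0.
  rewrite hornerD !hornerN hornerZ horner_sum hornerM hornerXn opprK.
  have -> : \sum_(m <- msupp K) ((term m)%:P * 'X^(M + k.+1 - cumulant_weight m)).[e] =
      e ^+ (M + k.+1) * \sum_(m <- msupp K) term m * e^-1 ^+ cumulant_weight m.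
    rewrite mulr_sumr; apply: eq_big_seq => m mK.
    rewrite hornerM hornerC hornerXn mulrCA; congr (_ * _).
    apply: (mulIf (expf_neq0 (cumulant_weight m) e0)).
    by rewrite -exprD subnK ?(leq_trans (wM m mK)) ?leq_addr // -mulrA exprVn mulVf ?mulr1 ?expf_neq0.
  rewrite mulrCA (kerov_scaled e0) coef_prod_eps exprD exprVn mulrN -mulrA.
  by rewrite (mulVKf (expf_neq0 k.+1 e0)) addNr.
have hg i : eqX 3 (factor i) (h0%:P + (i%:R * ('X * h1))%:P * 'X + (i%:R ^+ 2 * ('X^2 * h2))%:P * 'X^2).
  have := eqX3_factor b (y i) (isT : (0 < k)%N); rewrite -/(factor i) /y.
  by rewrite -/h0 -/h1 -/h2 exprMn -!mulrA.
have P2 : (\prod_(i < k) factor i)`_2 = 'X^2 * ((\sum_(i < k) i ^ 2)%N%:R * (h2 * h0 ^+ n.+1)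
    + (\sum_(i < k) i * 'C(i, 2))%N%:R * (h1 ^+ 2 * h0 ^+ n)).
  rewrite (eqX_coef (eqX3_prod n hg)) // !coefD !coefCM coefC coefX coefXn /= mulr0 mulr1 !add0r.
  by rewrite exprMn; ring.
have := congr1 (fun p : {poly algC} => p`_(M + 2)) E.
rewrite coefZ coef_sum coefN coefXnM ltnNge leq_addr /= addKn.
have -> : coef_poly_eps`_2 = ((\prod_(i < k) factor i)`_2)`_k.+1.
  rewrite coef_poly; case: ltnP => // ge.
  by rewrite (nth_default 0 ge) coef0.
rewrite P2 coefXnM /= !subSS subn0 coefD -!polyC_natr !coefCM => <-.
congr (_ * _); rewrite big_mkcond /=; apply: eq_big_seq => m mK.
rewrite coefCM coefXn; have le := wM m mK.
have -> : (M + 2 == M + k.+1 - cumulant_weight m)%N = (cumulant_weight m == n.+1) by lia.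
by case: eqP; rewrite ?mulr1 ?mulr0.
Qed.

End SubleadingTerm.

(** * Lagrange inversion *)

Section LagrangeInversion.

Variables (k : nat) (a : nat -> algC) (C V D Di : {poly algC}).

Let eta : {poly algC} := \sum_(j < k.+2) (a j)%:P * 'X^j.

Hypotheses (C0 : C`_0 = 1) (V0 : V`_0 = 1).

Hypothesis VC : eqX k.+2 (V * C) 1.

Hypothesis aV : eqX k.+2 (\sum_(j < k.+2) (a j)%:P * ('X * V) ^+ j) V.

Hypothesis DE : D = C - 'X * C^`().

Hypothesis DiD : eqX k.+1 (Di * D) 1.

Let coef_eta j : (j < k.+2)%N -> eta`_j = a j.
Proof.
move=> jk; rewrite coef_sum (bigD1 (Ordinal jk)) //= coefCM coefXn eqxx mulr1.
rewrite big1 ?addr0 // => i ij; rewrite coefCM coefXn; move: ij; rewrite -val_eqE /= eq_sym => /negPf ->.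
by rewrite mulr0.
Qed.

Let CV m j : (j <= m)%N -> eqX k.+2 (C ^+ m * V ^+ j) (C ^+ (m - j)).
Proof.
move=> jm; rewrite -{1}(subnK jm) exprD -mulrA -exprMn [C * V]mulrC.
rewrite -[X in eqX _ _ X]mulr1; apply: eqXMl.
by rewrite -[X in eqX _ _ X](expr1n _ j); apply: eqX_exp.
Qed.

(* The substitution t = u V(u) turns [t^m] eta^q into a coefficient in u. *)
Lemma coef_lagrange q m : (m < k.+2)%N -> (eta ^+ q)`_m = (D * C ^+ m * V ^+ q.+1)`_m.
Proof.
elim: q m => [|q IH] m mk.
  rewrite expr0 coef1 expr1; case: m mk => [|m] mk.
    rewrite expr0 mulr1 -!horner_coef0 hornerM !horner_coef0 V0 mulr1 DE coefB coefXM C0 subr0.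
    by [].
  have H : eqX k.+2 (D * C ^+ m.+1 * V) (D * C ^+ m).
    rewrite -mulrA; apply: eqXMl.
    by have := CV (ltn0Sn m); rewrite expr1 subSS subn0.
  (* $DC^m=C^{m+1}-u(C^{m+1})'/(m+1)$ has no term in $u^{m+1}$. *)
  rewrite (eqX_coef H mk) DE mulrBl -exprS -mulrA coefB coefXM /=.
  have := coef_deriv (C ^+ m.+1) m; rewrite deriv_exp coefMn /= => /eqP.
  by rewrite eqrMn2r => /eqP ->; rewrite subrr.
have sumV : eqX k.+2 (D * C ^+ m * V ^+ q.+1 * \sum_(j < k.+2) (a j)%:P * ('X * V) ^+ j) (D * C ^+ m * V ^+ q.+2).
  by rewrite [V ^+ q.+2]exprSr [X in eqX _ _ X]mulrA; apply: eqXMl.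
rewrite -(eqX_coef sumV mk) mulr_sumr coef_sum exprSr coefMr.
rewrite (big_ord_widen k.+2 (fun j => (eta ^+ q)`_(m - j) * eta`_j) mk) big_mkcond.
apply: eq_bigr => j _; rewrite exprMn; move: (ltn_ord j) => jk.
have -> : D * C ^+ m * V ^+ q.+1 * ((a j)%:P * ('X^j * V ^+ j)) =
    'X^j * ((a j)%:P * (D * V ^+ q.+1 * (C ^+ m * V ^+ j))) by ring.
rewrite coefXnM ltnS; case: leqP => jm //; rewrite coef_eta // ?IH ?(leq_ltn_trans (leq_subr _ _)) //.
have H := eqXMl (D * V ^+ q.+1) (CV jm).
rewrite coefCM (eqX_coef H) ?(leq_ltn_trans (leq_subr _ _)) // mulrC.
by rewrite mulrAC.
Qed.

Let VCV m p : eqX k.+2 (C ^+ m * V ^+ (m + p)) (V ^+ p).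
Proof.
rewrite exprD mulrA -[X in eqX _ _ X]mul1r; apply: eqXMr.
by have := CV (leqnn m); rewrite subnn expr0.
Qed.

(** Termwise from [coef_lagrange]; it is the change of variable $t=uV$ in the residue of
    $f\eta^N/t^{N+1}$, with $dt=V^2D\,du$. *)
Lemma coef_sum_lagrange (c : nat -> algC) N : (N < k.+2)%N ->
  ((\sum_(j < k.+2) (c j)%:P * 'X^j) * eta ^+ N)`_N =
  (D * V * \sum_(j < k.+2) (c j)%:P * ('X * V) ^+ j)`_N.
Proof.
move=> Nk; rewrite mulr_suml mulr_sumr !coef_sum; apply: eq_bigr => j _.
have -> : D * V * ((c j)%:P * ('X * V) ^+ j) = (c j)%:P * ('X^j * (D * V ^+ j.+1)).
  by rewrite exprMn exprS; ring.
rewrite -mulrA !coefCM !coefXnM; case: ltnP => jN //; congr (_ * _).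
have Nk' : (N - j < k.+2)%N := leq_ltn_trans (leq_subr _ _) Nk.
rewrite coef_lagrange //; have := eqXMl D (VCV (N - j) j.+1).
by rewrite addnS subnK // mulrA => /eqX_coef ->.
Qed.

Let eqX_comb2 N (p q l1 r1 l2 r2 c1 c2 : {poly algC}) :
  eqX N l1 r1 -> eqX N l2 r2 -> p - q = c1 * (l1 - r1) + c2 * (l2 - r2) -> eqX N p q.
Proof.
move=> [u ->] [v ->] E; exists (c1 * u + c2 * v).
by rewrite -[p](subrK q) E; ring.
Qed.

Let eqX_comb4 N (p q l1 r1 l2 r2 l3 r3 l4 r4 c1 c2 c3 c4 : {poly algC}) :
  eqX N l1 r1 -> eqX N l2 r2 -> eqX N l3 r3 -> eqX N l4 r4 ->
  p - q = c1 * (l1 - r1) + c2 * (l2 - r2) + c3 * (l3 - r3) + c4 * (l4 - r4) -> eqX N p q.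
Proof.
move=> [u ->] [v ->] [w ->] [z ->] E; exists (c1 * u + c2 * v + c3 * w + c4 * z).
by rewrite -[p](subrK q) E; ring.
Qed.

Let T : {poly algC} := 'X * V.

(** Differentiating $\eta(T)=V$ with $T'=V^2D$ gives $\eta'(T)D=-C'$, and once more
    $\eta''(T)V^2D^3=-CC''$; moreover $(1/D)'=uC''/D^2$. Each derivative costs one order of
    precision. *)
Let substitution_second_derivative :
  eqX k (D * V * (T ^+ 2 * (eta^`()^`() \Po T))) (- ('X * Di^`())).
Proof.
set C1 := C^`(); set C2 := C1^`(); set V1 := V^`(); set D1 := Di^`().
set P := eta^`() \Po T; set W := eta^`()^`() \Po T.
have T1 : T^`() = V + 'X * V1 by rewrite derivM derivX mul1r.
have P1 : P^`() = W * (V + 'X * V1) by rewrite deriv_comp T1.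
have dD : D^`() = - ('X * C2) by rewrite DE derivB derivM derivX -/C1 -/C2; ring.
have VC' : eqX k.+1 (V * C) 1 by apply: eqX_leq VC.
have s1 : eqX k.+1 (V1 * C + V * C1) 0.
  by have := eqX_deriv VC; rewrite derivM derivC.
have s2 : eqX k.+1 (V1 + C1 * V ^+ 2) 0.
  by apply: (eqX_comb2 (c1 := V) (c2 := - V1) s1 VC'); ring.
have s3 : eqX k.+1 (V + 'X * V1) (V ^+ 2 * D).
  by apply: (eqX_comb2 (c1 := 'X) (c2 := - V) s2 VC'); rewrite DE; ring.
have s4 : eqX k.+1 (P * (V + 'X * V1)) V1.
  have etaT : \sum_(j < k.+2) (a j)%:P * ('X * V) ^+ j = eta \Po T.
    rewrite /eta rmorph_sum; apply: eq_bigr => j _ /=.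
    by rewrite comp_polyM comp_polyC comp_Xn_poly.
  by have := eqX_deriv aV; rewrite etaT deriv_comp T1.
have s5 : eqX k.+1 (P * D) (- C1).
  apply: (eqX_comb4 (c1 := - (V * C + 1) * (P * D + C1)) (c2 := - C ^+ 2 * P) (c3 := C ^+ 2)
    (c4 := C ^+ 2) VC' s3 s4 s2); ring.
have s6 : eqX k (W * (V + 'X * V1) * D - P * 'X * C2) (- C2).
  by have := eqX_deriv s5; rewrite derivM derivN P1 dD -/C2 mulrN [P * ('X * _)]mulrA.
have low (p q : {poly algC}) : eqX k.+1 p q -> eqX k p q by apply: eqX_leq.
have s7 : eqX k (W * V ^+ 2 * D ^+ 3) (- (C2 * C)).
  apply: (eqX_comb4 (c1 := - (W * D ^+ 2)) (c2 := D) (c3 := 'X * C2) (c4 := 0)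
    (low _ _ s3) s6 (low _ _ s5) s6); rewrite DE; ring.
have DiD' : eqX k (Di * D) 1 by apply: low.
have s8 : eqX k (D1 * D + Di * (- ('X * C2))) 0.
  by have := eqX_deriv DiD; rewrite derivM dD derivC.
have s9 : eqX k (D1 - Di ^+ 2 * ('X * C2)) 0.
  by apply: (eqX_comb2 (c1 := Di) (c2 := - D1) s8 DiD'); ring.
rewrite /T; apply: (eqX_comb4 (c1 := - (Di * D + 1) * 'X^2 * V ^+ 3 * W * D)
  (c2 := 'X^2 * V * Di ^+ 2) (c3 := - ('X^2 * C2 * Di ^+ 2)) (c4 := 'X) DiD' s7 (low _ _ VC') s9).
ring.
Qed.

Let polyE (f : nat -> algC) :
  \sum_(j < k.+2) (f j)%:P * 'X^j = \poly_(j < k.+2) f j.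
Proof. by rewrite poly_def; apply: eq_bigr => j _; rewrite mul_polyC. Qed.

Let coefXderiv (p : {poly algC}) i : ('X * p^`())`_i = i%:R * p`_i.
Proof. by case: i => [|i]; rewrite coefXM ?mul0r //= coef_deriv mulr_natl. Qed.

Let binom_sumE : (\sum_(j < k.+2) 'C(j, 2)%:R * ((a j)%:P * 'X^j)) *+ 2 = 'X^2 * eta^`()^`().
Proof.
have -> : (\sum_(j < k.+2) 'C(j, 2)%:R * ((a j)%:P * 'X^j)) *+ 2 =
    \sum_(j < k.+2) (a j * (j * j.-1)%N%:R)%:P * 'X^j.
  rewrite -sumrMnl; apply: eq_bigr => j _.
  have -> : (j * j.-1)%N = ('C(j, 2) * 2)%N by rewrite -[2%N in RHS]/(2`!) bin_ffact ffactnS ffactn1.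
  by rewrite natrM mulrA !polyCM !polyC_natr -mulr_natr; ring.
rewrite (polyE (fun j => a j * (j * j.-1)%N%:R)) /eta (polyE a); apply/polyP => i; rewrite coefXnM coef_poly.
case: i => [|[|i]] /=; rewrite ?mul0n ?muln0 ?mulr0 ?if_same //.
rewrite subSS subSS subn0 !coef_deriv coef_poly; case: ifP => _; last by rewrite !mul0rn.
by rewrite -mulrnA -[RHS]mulr_natr mulnC.
Qed.

Lemma coef_second_derivative N : (N < k)%N ->
  ((\sum_(j < k.+2) 'C(j, 2)%:R * ((a j)%:P * 'X^j)) * eta ^+ N)`_N *+ 2 = - (N%:R * Di`_N).
Proof.
move=> Nk; have Nk2 : (N < k.+2)%N by lia.
rewrite -coefMn -mulrnAl binom_sumE.
have cE : 'X^2 * eta^`()^`() = \sum_(j < k.+2) (('X^2 * eta^`()^`())`_j)%:P * 'X^j.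
  rewrite (polyE (fun j => ('X^2 * eta^`()^`())`_j)).
  apply/polyP => i; rewrite coef_poly; case: ltnP => // ki.
  rewrite coefXnM; case: ltnP => // i2; rewrite !coef_deriv [eta`_ _]nth_default ?mul0rn //.
  by rewrite /eta (polyE a); apply: leq_trans (size_poly _ _) _; lia.
rewrite cE coef_sum_lagrange // -/T.
have -> : \sum_(j < k.+2) (('X^2 * eta^`()^`())`_j)%:P * ('X * V) ^+ j = T ^+ 2 * (eta^`()^`() \Po T).
  rewrite -(comp_Xn_poly T 2) -comp_polyM {2}cE rmorph_sum; apply: eq_bigr => j _ /=.
  by rewrite comp_polyM comp_polyC comp_Xn_poly.
by rewrite (eqX_coef substitution_second_derivative Nk) coefN coefXderiv.
Qed.

(** For $p=(\eta-t\eta')\eta^{n+1}$, the operator $p\mapsto tp'$ multiplies the coefficient of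
    $t^{n+1}$ by $n+1$, and Leibniz' rule writes $tp'$ through the two quantities compared. *)
Lemma coef_euler n : (n.+1 < k.+2)%N ->
  ((\sum_(j < k.+2) (j%:R - 1) * ((a j)%:P * 'X^j)) ^+ 2 * eta ^+ n)`_n.+1 *+ n.+1 =
  - ((\sum_(j < k.+2) 'C(j, 2)%:R * ((a j)%:P * 'X^j)) * eta ^+ n.+1)`_n.+1 *+ 2.
Proof.
move=> nk; have := binom_sumE; set S := \sum_(j < k.+2) 'C(j, 2)%:R * _ => SE.
have -> : - (S * eta ^+ n.+1)`_n.+1 *+ 2 = - ('X^2 * eta^`()^`() * eta ^+ n.+1)`_n.+1.
  by rewrite mulNrn -coefMn -mulrnAl SE.
have -> : \sum_(j < k.+2) (j%:R - 1) * ((a j)%:P * 'X^j) = 'X * eta^`() - eta.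
  have -> : \sum_(j < k.+2) (j%:R - 1) * ((a j)%:P * 'X^j) =
      \sum_(j < k.+2) ((j%:R - 1) * a j)%:P * 'X^j.
    by apply: eq_bigr => j _; rewrite polyCM polyCB polyC_natr polyC1 mulrA.
  rewrite /eta (polyE a) (polyE (fun j => (j%:R - 1) * a j)); apply/polyP => i; rewrite coefB coefXderiv !coef_poly.
  by case: ifP => _; rewrite ?mulr0 ?subr0 // mulrBl mul1r.
set E1 := eta^`(); set E2 := E1^`().
pose p := (eta - 'X * E1) * eta ^+ n.+1.
have dp : 'X * p^`() = - ('X^2 * E2 * eta ^+ n.+1) + n.+1%:R * ('X * E1 * eta ^+ n * (eta - 'X * E1)).
  rewrite /p derivM derivB derivM derivX deriv_exp /= -/E1 -/E2 -mulr_natr exprS.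
  have identity (u e1 e2 h hn c : {poly algC}) :
    u * ((e1 - (1 * e1 + u * e2)) * (h * hn) + (h - u * e1) * (e1 * hn * c)) =
    - (u ^+ 2 * e2 * (h * hn)) + c * (u * e1 * hn * (h - u * e1)) by ring.
  exact: identity.
have := coefXderiv p n.+1; rewrite dp coefD coefN mulr_natl coefMn => e.
have -> : ('X * E1 - eta) ^+ 2 * eta ^+ n = p - 'X * E1 * eta ^+ n * (eta - 'X * E1).
  have identity (u e1 h hn : {poly algC}) : (u * e1 - h) ^+ 2 * hn =
    (h - u * e1) * (h * hn) - u * e1 * hn * (h - u * e1) by ring.
  by rewrite /p [eta ^+ n.+1]exprS; exact: identity.
rewrite coefB mulrnBl -[X in X - _]mulr_natl -e addrK.
by [].
Qed.

End LagrangeInversion.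

(** To isolate the coefficient at [u], the exponents are fixed one variable at a time: [agree r]
    keeps the monomials whose first [r] exponents are those of [u]. *)
Lemma mpoly_eq0_meval k (p : {mpoly algC[k]}) : (forall v, p.@[v] = 0) -> p = 0.
Proof.
move=> p0; apply/mpolyP => u; rewrite mcoeff0.
pose agree r (m : 'X_{1..k}) := [forall i : 'I_k, (i < r)%N ==> (m i == u i)].
have H r : (r <= k)%N -> forall v : 'I_k -> algC,
    \sum_(m <- msupp p | agree r m) p@_m * \prod_(i < k | (r <= i)%N) v i ^+ m i = 0.
  elim: r => [|r IH] rk v.
    rewrite -[RHS](p0 v) mevalE; apply: eq_bigl => m.
    by apply/forallP => i; rewrite ltn0.
  pose i0 := Ordinal rk.
  pose q : {poly algC} := \sum_(m <- msupp p | agree r m)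
    (p@_m * \prod_(i < k | (r < i)%N) v i ^+ m i)%:P * 'X^(m i0).
  have q0 : q = 0.
    apply: poly_eq0_nat => N; set x := N.+1%:R.
    rewrite -[RHS](IH (ltnW rk) (fun i => if i == i0 then x else v i)) horner_sum.
    apply: eq_bigr => m _; rewrite hornerM hornerC hornerXn -mulrA; congr (_ * _).
    rewrite [RHS](bigD1 i0) //= eqxx mulrC; congr (_ * _); apply: eq_big => [i|i ri].
      by rewrite -val_eqE /=; lia.
    by rewrite -val_eqE /= gtn_eqF.
  have := congr1 (fun w : {poly algC} => w`_(u i0)) q0; rewrite coef0 coef_sum => e; rewrite -[RHS]e {e}.
  rewrite big_mkcond [RHS]big_mkcond /=; apply: eq_bigr => m _.
  have -> : agree r.+1 m = agree r m && (m i0 == u i0).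
    apply/forallP/andP => [A|[/forallP A /eqP e] i].
      split; last by have := A i0; rewrite ltnSn.
      by apply/forallP => i; apply/implyP => ir; have := A i; rewrite (leq_trans ir).
    apply/implyP; rewrite ltnS leq_eqVlt => /orP[/eqP ir|ir]; last by have := A i; rewrite ir.
    by have -> : i = i0; [apply: val_inj | apply/eqP].
  case: (agree r m) => //=; rewrite coefCM coefXn eq_sym.
  by case: eqP; rewrite ?mulr1 ?mulr0.
have := H k (leqnn k) (fun=> 0); have [um|/memN_msupp_eq0 //] := boolP (u \in msupp p).
rewrite (big_rem u) //= (_ : agree k u); last by apply/forallP => i; rewrite eqxx implybT.
rewrite big_pred0 => [|i]; last by rewrite leqNgt ltn_ord.
rewrite mulr1 big_seq_cond big_pred0 ?addr0 // => m; apply/negP => /andP[mr /forallP A].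
have mu : m = u by apply/mnmP => i; apply/eqP; have := A i; rewrite ltn_ord.
by move: mr; rewrite mu mem_rem_uniqF ?msupp_uniq.
Qed.

Lemma cumulant_weight_monomial k (js : seq nat) : all (fun j => 2 <= j)%N js ->
  (sumn js < k.+2)%N -> cumulant_weight (cumulant_monomial k js) = sumn js.
Proof.
elim: js => [|j js IH] /=.
  move=> _ _; rewrite /cumulant_weight big1 // => i _; rewrite mnmE /= muln0.
  by [].
move=> /andP[j2 /IH {}IH] lt; rewrite -IH; last by lia.
rewrite /cumulant_weight.
under eq_bigr => i _ do rewrite mnmE /= mulnDr.
rewrite big_split /=; congr (_ + _)%N; last by apply: eq_bigr => i _; rewrite mnmE.
have jk : (j - 2 < k)%N by lia.
rewrite (bigD1 (Ordinal jk)) //= big1 => [|i].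
  have -> : (j == (j - 2).+2) by lia.
  by rewrite muln1 addn0; lia.
rewrite -val_eqE /= => ij; have -> : (j == i.+2) = false by lia.
by rewrite muln0.
Qed.

(** * Monomials and words *)

Section Words.

Variables (n : nat).

Local Notation k := n.+2.

Definition cumulant_word t (f : {ffun 'I_t -> 'I_k}) : seq nat := [seq (f s).+2 | s <- enum 'I_t].

Lemma size_cumulant_word t (f : {ffun 'I_t -> 'I_k}) : size (cumulant_word f) = t.
Proof. by rewrite size_map size_enum_ord. Qed.

Lemma cumulant_word_monomial t (f : {ffun 'I_t -> 'I_k}) (js : seq nat) :
  all (fun j => 2 <= j < k.+2)%N js ->
  ((\sum_s U_(f s))%MM == cumulant_monomial k js) = perm_eq (cumulant_word f) js.
Proof.
move=> jsP.
have cE (i : 'I_k) : (\sum_s U_(f s))%MM i = count_mem i.+2 (cumulant_word f).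
  rewrite mnm_sumE -sum1_count /cumulant_word big_map big_enum_cond [RHS]big_mkcond /=.
  by apply: eq_bigr => s _; rewrite mnm1E -val_eqE /= eqSS eqSS; case: eqP.
apply/eqP/idP => [/mnmP H|/seq.permP H]; last first.
  by apply/mnmP => i; rewrite cE H mnmE.
apply/allP => j; rewrite mem_cat /= => jin.
have /andP[j2 jk] : (2 <= j < k.+2)%N.
  by case/orP: jin => [/mapP[s _ ->]|/(allP jsP) //]; have := ltn_ord (f s); rewrite /=; lia.
have jk' : (j - 2 < k)%N by lia.
have := H (Ordinal jk'); rewrite cE mnmE /=.
have -> : (j - 2).+2 = j by lia.
by move=> ->.
Qed.

Lemma card_cumulant_words (js : seq nat) : all (fun j => 2 <= j < k.+2)%N js ->
  #|[set f : {ffun 'I_(size js) -> 'I_k} | perm_eq (cumulant_word f) js]| = size (permutations js).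
Proof.
move=> jsP; set A := [set f | _].
have wI : injective (@cumulant_word (size js)).
  move=> f g e; apply/ffunP => s; apply: val_inj.
  have : nth 0%N (cumulant_word f) s = nth 0%N (cumulant_word g) s by rewrite e.
  rewrite /cumulant_word.
  rewrite (nth_map s) ?size_enum_ord // (nth_map s) ?size_enum_ord //.
  by rewrite !nth_ord_enum => -[].
rewrite cardE -(size_map (@cumulant_word (size js))); apply/perm_size/uniq_perm.
- by rewrite map_inj_uniq ?enum_uniq.
- exact: permutations_uniq.
move=> x; rewrite mem_permutations; apply/mapP/idP => [[f + ->]|xjs].
  by rewrite mem_enum inE.
have sx : size x = size js := perm_size xjs.
have xP : all (fun j => 2 <= j < k.+2)%N x by rewrite (perm_all _ xjs).
pose f : {ffun 'I_(size js) -> 'I_k} := [ffun s : 'I__ => inord (nth 0%N x s - 2)].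
have xE : x = cumulant_word f.
  apply: (@eq_from_nth _ 0%N); first by rewrite size_cumulant_word.
  move=> i; rewrite sx => ix; rewrite /cumulant_word (nth_map (Ordinal ix)) ?size_enum_ord //.
  have -> : nth (Ordinal ix) (enum 'I_(size js)) i = Ordinal ix.
    by apply: val_inj; rewrite /= nth_enum_ord.
  have /andP[x2 xk] : (2 <= nth 0%N x i < k.+2)%N by apply/(allP xP)/mem_nth; rewrite sx.
  by rewrite ffunE inordK /=; lia.
by exists f => //; rewrite mem_enum inE -xE.
Qed.

Variable R : 'I_k -> algC.

(** This is $\sum_j(j-1)R_ju^j=1-D$, with $j=i+2$. *)
Definition weighted_series : {poly algC} := \sum_(i < k) (i.+1%:R * R i)%:P * 'X^(i.+2).

Lemma coef_weighted_series_exp t N : (weighted_series ^+ t)`_N =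
  \sum_(f : {ffun 'I_t -> 'I_k} | sumn (cumulant_word f) == N) \prod_s ((f s).+1%:R * R (f s)).
Proof.
rewrite -[t in LHS]card_ord -prodr_const bigA_distr_bigA coef_sum [RHS]big_mkcond /=.
apply: eq_bigr => f _; rewrite big_split /= -rmorph_prod coefCM -expr_sum coefXn.
have -> : sumn (cumulant_word f) = (\sum_s (f s).+2)%N.
  by rewrite sumnE big_map big_enum.
by rewrite eq_sym; case: eqP; rewrite ?mulr1 ?mulr0.
Qed.

Lemma weighted_series_inv N :
  eqX N.+1 ((\sum_(t < N.+1) weighted_series ^+ t) * (1 - weighted_series)) 1.
Proof.
have [w ->] : exists w, weighted_series = 'X * w.
  exists (\sum_(i < k) (i.+1%:R * R i)%:P * 'X^(i.+1)).
  by rewrite mulr_sumr; apply: eq_bigr => i _; rewrite exprS mulrCA.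
rewrite mulrC -[1 - _]opprB mulNr -subrX1 exprMn.
by exists (- w ^+ N.+1); ring.
Qed.

End Words.

(** For $N=k-1$ it evaluates $12N\sum i^2-24\sum i\binom i2$ to $(k-1)k^2(k+1)$, the combination
    that arises in [kerov_weighted]. *)
Lemma sum_squares_binomial N :
  (24 * \sum_(i < N.+1) i * 'C(i, 2) + N * N.+1 ^ 2 * N.+2 = 12 * N * \sum_(i < N.+1) i ^ 2)%N.
Proof.
have S2 : (6 * \sum_(i < N.+1) i ^ 2 = N * N.+1 * (2 * N + 1))%N.
  elim: N => [|N IH]; first by rewrite big_ord_recl big_ord0.
  by rewrite big_ord_recr /= mulnDr IH; lia.
have S3 : (24 * \sum_(i < N.+1) i * 'C(i, 2) + N * N.+1 ^ 2 * N.+2 = 2 * N * (N * N.+1 * (2 * N + 1)))%N.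
  elim: N {S2} => [|N IH]; first by rewrite big_ord_recl big_ord0.
  rewrite big_ord_recr /=; have : (2 * 'C(N.+1, 2) = N.+1 * N)%N.
    by rewrite -[2%N in LHS]/(2`!) mulnC bin_ffact ffactnS ffactn1.
  by move: IH; set s := (\sum_(i < N.+1) _)%N; set b := 'C(_, _) => IH E; nia.
by rewrite S3 -S2; lia.
Qed.

(** * The coefficient of a monomial of weight k - 1 *)

Section KerovCoefficient.

Variables (n : nat) (K : {mpoly int[n.+2]}).

Local Notation k := n.+2.

Hypothesis kerovK : is_kerov_polynomial K.

Let c : algC := (n.+1 * k * k.+1)%:R / 24%:R.

(** Let [x] be the coefficient of $u^{k-1}$ in $1/D$. For the two coefficients in
    [kerov_subleading], [coef_second_derivative] gives $A=-(k-1)x/2$ and then [coef_euler] gives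
    $B=x$. *)
Lemma kerov_weighted (R : 'I_k -> algC) :
  \sum_(m <- msupp K | cumulant_weight m == n.+1) (K@_m)%:~R * \prod_(i < k) R i ^+ m i =
  c * \sum_(t < k.+1) \sum_(f : {ffun 'I_t -> 'I_k} | sumn (cumulant_word f) == n.+1)
    \prod_s ((f s).+1%:R * R (f s)).
Proof.
pose C : {poly algC} := 1 + \sum_(i < k) (R i)%:P * 'X^(i.+2).
have CE (i : 'I_k) : C`_i.+2 = R i.
  rewrite coefD coef1 add0r coef_sum (bigD1 i) //= coefCM coefXn eqxx mulr1 big1 ?addr0 // => j ji.
  by rewrite coefCM coefXn !eqSS eq_sym -val_eqE /= in ji *; rewrite (negPf ji) mulr0.
have C0 : C`_0 = 1.
  by rewrite coefD coef1 coef_sum big1 ?addr0 // => i _; rewrite coefCM coefXn mulr0.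
have C1 : C`_1 = 0.
  by rewrite coefD coef1 add0r coef_sum big1 // => i _; rewrite coefCM coefXn mulr0.
have DE : 1 - weighted_series R = C - 'X * C^`().
  apply/polyP => i; rewrite !coefB coefXM; case: i => [|i].
    by rewrite C0 coef1 coef_sum big1 // => i _; rewrite coefCM coefXn mulr0.
  rewrite coef_deriv /C coef1 sub0r coefD coef1 add0r !coef_sum -sumrMnl -sumrB -sumrN.
  apply: eq_bigr => j _; rewrite !coefCM coefXn; case: eqP => [[->]|_]; last by rewrite !mulr0 mul0rn subr0 oppr0.
  by rewrite !mulr1 [X in _ - X]mulrS opprD addrA subrr add0r mulr_natl.
have [V [a [V0 VC a0 a1 aV]]] := exists_poly_substitution k C0 C1.
have := kerov_subleading kerovK a0 a1 C0 VC aV.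
have W := weighted_series_inv R k.
have Nk : (n.+1 < k.+2)%N by lia.
have := coef_euler a Nk.
have := coef_second_derivative C0 V0 VC aV DE W (ltnSn n.+1).
pose h0 := \sum_(j < k.+2) (a j)%:P * 'X^j.
pose A := ((\sum_(j < k.+2) 'C(j, 2)%:R * ((a j)%:P * 'X^j)) * h0 ^+ n.+1)`_n.+1.
pose B := ((\sum_(j < k.+2) (j%:R - 1) * ((a j)%:P * 'X^j)) ^+ 2 * h0 ^+ n)`_n.+1.
pose x := (\sum_(t < k.+1) weighted_series R ^+ t)`_n.+1.
rewrite -/h0 -/A -/B -/x.
have -> : \sum_(t < k.+1) \sum_(f : {ffun 'I_t -> 'I_k} | sumn (cumulant_word f) == n.+1)
    \prod_s ((f s).+1%:R * R (f s)) = x.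
  by rewrite /x coef_sum; apply: eq_bigr => t _; rewrite coef_weighted_series_exp.
have -> : \sum_(m <- msupp K | cumulant_weight m == n.+1) (K@_m)%:~R * \prod_(i < k) C`_i.+2 ^+ m i =
    \sum_(m <- msupp K | cumulant_weight m == n.+1) (K@_m)%:~R * \prod_(i < k) R i ^+ m i.
  by apply: eq_bigr => m _; congr (_ * _); apply: eq_bigr => i _; rewrite CE.
set S := \sum_(m <- _ | _) _ => EA EB ES.
have E : 24%:R * (\sum_(i < k) i * 'C(i, 2))%N%:R + n.+1%:R * k%:R ^+ 2 * k.+1%:R =
    12%:R * n.+1%:R * (\sum_(i < k) i ^ 2)%N%:R :> algC.
  have := congr1 (fun u => u%:R : algC) (sum_squares_binomial n.+1).
  by rewrite natrD !natrM expr2.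
have N0 : n.+1%:R != 0 :> algC by rewrite pnatr_eq0.
have k0 : k%:R != 0 :> algC by rewrite pnatr_eq0.
have c24 : 24%:R != 0 :> algC by rewrite pnatr_eq0.
rewrite /c !natrM; move: ES E; move: (\sum_(i < k) i ^ 2)%N%:R (\sum_(i < k) i * 'C(i, 2))%N%:R.
rewrite -[B *+ _]mulr_natr in EB; rewrite -[_ *+ 2]mulr_natr in EA; rewrite -[_ *+ 2]mulr_natr mulNr EA opprK mulrC in EB.
have {EB}EB := mulfI N0 EB; rewrite {}EB in EA *.
move: k%:R k.+1%:R n.+1%:R k0 N0 EA => u v w u0 w0 EA s2 e ES E.
apply: (mulfI (mulf_neq0 c24 u0)); rewrite -mulrA ES.
have -> : 24%:R * - (s2 * A + e * x) = - (12%:R * s2 * (A * 2%:R)) - 24%:R * e * x by ring.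
rewrite EA; have -> : - (12%:R * s2 * - (w * x)) = 12%:R * w * s2 * x by ring.
by rewrite -E; field.
Qed.

(** As [kerov_weighted] holds for all values of the cumulants, both sides agree as polynomials. The
    words that give this monomial are the rearrangements of [js], all with the factor
    $\prod(j-1)$. *)
Lemma kerov_coefficient (js : seq nat) :
  all (fun j => 2 <= j)%N js -> sumn js = n.+1 ->
  (K@_(cumulant_monomial k js))%:~R =
    c * (size (permutations js))%:R * \prod_(j <- js) (j.-1)%:R.
Proof.
move=> js2 sjs; set u := cumulant_monomial k js.
have jsP : all (fun j => 2 <= j < k.+2)%N js.
  apply/allP => j jin; rewrite (allP js2 _ jin) /=.
  have : (j <= sumn js)%N by rewrite sumnE (big_rem j) //= leq_addr.
  by rewrite sjs; lia.
have wu : cumulant_weight u = n.+1 by rewrite cumulant_weight_monomial ?sjs //; lia.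
pose L : {mpoly algC[k]} := \sum_(m <- msupp K | cumulant_weight m == n.+1) (K@_m)%:~R *: 'X_[m].
pose M : {mpoly algC[k]} := c *: \sum_(t < k.+1)
  \sum_(f : {ffun 'I_t -> 'I_k} | sumn (cumulant_word f) == n.+1)
    (\prod_s (f s).+1%:R) *: 'X_[(\sum_s U_(f s))%MM].
have LM : L = M.
  apply/eqP; rewrite -subr_eq0; apply/eqP/mpoly_eq0_meval => v; rewrite mevalB.
  apply/eqP; rewrite subr_eq0; apply/eqP; rewrite mevalZ.
  have -> : L.@[v] = \sum_(m <- msupp K | cumulant_weight m == n.+1) (K@_m)%:~R * \prod_(i < k) v i ^+ m i.
    by rewrite raddf_sum /=; apply: eq_bigr => m _; rewrite mevalZ mevalX.
  rewrite kerov_weighted raddf_sum /=; congr (_ * _); apply: eq_bigr => t _; rewrite raddf_sum /=.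
  apply: eq_bigr => f _; rewrite mevalZ big_split /=; congr (_ * _).
  rewrite (big_morph (fun m : 'X_{1..k} => 'X_[m] : {mpoly algC[k]}) (@mpolyXD _ _) (mpolyX0 _ _)).
  by rewrite rmorph_prod /=; apply: eq_bigr => s _; rewrite mevalXU.
have := congr1 (mcoeff u) LM; rewrite mcoeffZ !raddf_sum /=.
have -> : \sum_(m <- msupp K | cumulant_weight m == n.+1) ((K@_m)%:~R *: 'X_[m] : {mpoly algC[k]})@_u = (K@_u)%:~R.
  under eq_bigr => m _ do rewrite mcoeffZ mcoeffX.
  have [um|/memN_msupp_eq0 K0] := boolP (u \in msupp K).
    rewrite big_mkcond (bigD1_seq u) ?msupp_uniq //= wu !eqxx mulr1 big1 ?addr0 // => m /negPf ->.
    by rewrite mulr0 if_same.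
  rewrite K0 big_seq_cond big1 // => m /andP[mK _]; case: eqP => [e|]; last by rewrite mulr0.
  by rewrite e K0 mul0r.
move=> ->; rewrite -mulrA; congr (_ * _).
have tk : (size js < k.+1)%N.
  have : (size js <= sumn js)%N.
    by elim: (js) js2 => //= j s IH /andP[j2 /IH]; lia.
  by rewrite sjs; lia.
under eq_bigr => t _.
  rewrite raddf_sum /=.
  under eq_bigr => f _ do rewrite mcoeffZ mcoeffX (cumulant_word_monomial _ jsP).
  over.
rewrite (bigD1 (Ordinal tk)) //= [X in _ + X]big1 ?addr0 => [|t tn]; last first.
  rewrite big1 // => f _; case: (boolP (perm_eq _ _)) => [/perm_size|]; last by rewrite mulr0.
  by rewrite size_cumulant_word => e; case/eqP: tn; apply: val_inj.
rewrite -(card_cumulant_words jsP) -sum1_card natr_sum mulr_suml big_mkcond [RHS]big_mkcond /=.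
apply: eq_bigr => f _; rewrite inE; case: (boolP (perm_eq _ _)) => [p|_]; last first.
  by rewrite mulr0 if_same.
rewrite (perm_sumn p) sjs eqxx mul1r mulr1 -(perm_big _ p) /= big_map big_enum.
by [].
Qed.

End KerovCoefficient.

(** For $H(z)=z$, that is $C=\eta=1$, all cumulants vanish and so does the residue. This covers
    $k=1$, where $k-1=0$ forces [js] to be empty. *)
Lemma kerov_constant1 (K : {mpoly int[1]}) : is_kerov_polynomial K -> K@_0%MM = 0.
Proof.
move=> kerovK; have := @kerov_homogeneous 1 K isT kerovK (fun j => (j == 0%N)%:R) 1.
move=> /(_ erefl erefl (coef1 _ 0)) H; lapply H => {H}; last first.
  exists 0; rewrite mulr0 addr0 big_ord_recl big1 ?addr0 => [|j _].
    by rewrite expr0 mulr1 !expr1n mulr1.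
  by rewrite polyC0 !mul0r.
rewrite mul1r big_ord_recl big_ord0 mulr1 polyC0 mul0r subr0.
have -> : \sum_(j < 3) ((j == 0 :> nat)%:R)%:P * 'X^j * 1 ^+ (2 - j) = 1 :> {poly algC}.
  rewrite big_ord_recl big1 ?addr0 => [|j _]; first by rewrite expr0 mulr1 expr1n mulr1.
  by rewrite polyC0 !mul0r.
have -> : (1 * geom 2 0 ^+ 1 : {poly algC})`_2 = 0.
  by rewrite mul1r expr1 /geom coef_poly /= expr0n.
rewrite oppr0 /mmap => E.
have [K0|/memN_msupp_eq0 //] := boolP (0%MM \in msupp K).
move: E; rewrite (bigD1_seq 0%MM) ?msupp_uniq //= [X in _ + X]big1 ?addr0 => [|m m0].
  rewrite [mmap1 _ _]big1 => [|i _]; last by rewrite mnm0E expr0.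
  by rewrite mulr1 => /eqP; rewrite intr_eq0 => /eqP.
rewrite /mmap1 big_ord_recl big_ord0 mulr1 coef1 /= expr0n.
suff -> : (m ord0 == 0)%N = false by rewrite mulr0.
by apply: contraNF m0 => /eqP m0; apply/eqP/mnmP => i; rewrite ord1 m0 mnm0E.
Qed.

Theorem theorem1p4p3 (k : nat) (K : {mpoly int[k]}) (js : seq nat) :
  (1 <= k)%N ->
  is_kerov_polynomial K ->
  all (fun j => 2 <= j)%N js ->
  sumn js = k.-1 ->
  (K@_(cumulant_monomial k js))%:~R =
    (k.-1 * k * k.+1)%:R / 24%:R * (size (permutations js))%:R
    * \prod_(j <- js) (j.-1)%:R :> rat.
Proof.
move=> k_gt0 kerovK js2 sjs.
case: k k_gt0 K kerovK sjs => [//|[|n]] _ K kerovK sjs.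
  have -> : js = [::] by case: js js2 sjs => [//|j s] /andP[/= ? _]; lia.
  rewrite !mul0r; have -> : cumulant_monomial 1 [::] = 0%MM.
    by apply/mnmP => i; rewrite !mnmE.
  by rewrite kerov_constant1.
apply: (fmorph_inj (ratr : {rmorphism rat -> algC})).
rewrite /= ratr_int (kerov_coefficient kerovK js2 sjs).
by rewrite !rmorphM fmorphV rmorph_prod !rmorph_nat /=; under [in RHS]eq_bigr do rewrite rmorph_nat.
Qed.
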